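(* Let $\alpha\in(0,1)$. Let the temporal mesh $0=t_0<t_1<\dots<t_M=T$ satisfy $$\tau_1\simeq M^{-r},\qquad \tau_j\simeq t_j/j,\qquad t_j\simeq\tau_1j^r\qquad\forall\,j=1,\dots,M$$ for some $r\ge1$, and also $\sigma_j\ge\sigma_{j+1}\ge0$ for all $j\ge2$ and $\sigma_j\in[0,\bar\sigma]$ for all $j\ge K+1$, where $\bar\sigma=\bar\sigma(\alpha)\in(0,1)$ is the constant described in the context, and $1\le K\lesssim1$ (i.e. $K$ is independent of $M$). Suppose that $u$ and $\{U^m\}$ satisfy $$D_t^\alpha u(t)=f(t)\ \text{ for } t\in(0,T],\quad u(0)=u_0;\qquad \delta_t^\alpha U^m=f(t_m)\ \text{ for } m=1,\dots,M,\quad U^0=u_0,$$ and $|\partial_t^lu|\lesssim1+t^{\alpha-l}$ for $l=1,3$ and $t\in(0,T]$. Then for all $m=1,\dots,M$ one has $$|u(t_m)-U^m|\lesssim\mathcal E^m:=\begin{cases}M^{-r}\,t_m^{\alpha-1}&\text{if }1\le r<3-\alpha,\\[2pt] M^{\alpha-3}\,t_m^{\alpha-1}\,[1+\ln(t_m/t_1)]&\text{if }r=3-\alpha,\\[2pt] M^{\alpha-3}\,t_m^{\alpha-(3-\alpha)/r}&\text{if }r>3-\alpha.\end{cases}$$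
   Context: For a mesh, $\tau_j:=t_j-t_{j-1}$ and $\sigma_j:=\frac{\tau_j-\tau_{j-1}}{\tau_j+\tau_{j-1}}$ for $2\le j\le M$; ''$\sigma_j\ge\sigma_{j+1}\ge0$ for all $j\ge2$'' means $\sigma_2\ge\sigma_3\ge\dots\ge\sigma_M\ge0$. $D_t^\alpha w(t):=\frac1{\Gamma(1-\alpha)}\int_0^t(t-s)^{-\alpha}w'(s)\,ds$ (Caputo derivative). Here $u$ is real-valued, continuous on $[0,T]$ and three times continuously differentiable on $(0,T]$. For mesh values $\{U^j\}_{j=0}^M$, $\Pi^mU$ is the following continuous piecewise polynomial interpolant on $[0,t_m]$. For $m=1$ it is the linear Lagrange interpolant at $t_0,t_1$. For $m\ge2$, on $(t_{j-1},t_j)$ with $1\le j<m$ it is the quadratic Lagrange interpolant at $t_{j-1},t_j,t_{j+1}$, and on $(t_{m-1},t_m)$ it is the quadratic Lagrange interpolant at $t_{m-2},t_{m-1},t_m$. The discrete fractional-derivative operator is $\delta_t^\alpha U^m:=D_t^\alpha(\Pi^mU)(t_m)$, $1\le m\le M$. Conventions: $a\lesssim b$ means $a\le Cb$ with a positive constant $C$ independent of $M$ and of the indices; $a\simeq b$ means $a\lesssim b$ and $b\lesssim a$. The constant in the conclusion may depend on the fixed $\alpha,r,T,K,u_0,f$ and on the constants in the hypotheses, but not on $M$, $m$ or the particular mesh. The constant $\bar\sigma(\alpha)\in(0,1)$ is a constant depending only on $\alpha$ with the following property (such a constant exists): on every temporal mesh (any $T$, $M$) with $\bar\sigma\ge\sigma_2\ge\sigma_3\ge\dots\ge\sigma_M\ge0$,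 (i) $U^0\ge0$ and $\delta_t^\alpha U^m\ge0$ $\forall m\ge1$ imply $U^j\ge0$ $\forall j\ge0$; (ii) $|U^0|\le B^0$ and $|\delta_t^\alpha U^m|\le\delta_t^\alpha B^m$ $\forall m\ge1$ imply $|U^j|\le B^j$ $\forall j\ge0$; (iii) $U^0=0$ implies $|U^m|\lesssim\max_{1\le j\le m}\{t_j^\alpha|\delta_t^\alpha U^j|\}$ $\forall m\ge1$, with constant independent of the mesh. *)

(* Defs.v *)
From mathcomp Require Import all_boot all_order all_algebra.
From mathcomp Require Import all_classical all_reals all_analysis.

Set Implicit Arguments.
Unset Strict Implicit.
Unset Printing Implicit Defensive.

Import Order.TTheory GRing.Theory Num.Theory.
Import numFieldNormedType.Exports.

Local Open Scope classical_set_scope.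
Local Open Scope ring_scope.

Section Caputo.
Variable R : realType.
Notation mu := (@lebesgue_measure R).

Definition Gamma (z : R) : R :=
  \int[mu]_(x in `]0, +oo[) (x `^ (z - 1) * expR (- x)).

Definition caputo (alpha : R) (w : R -> R) (t : R) : R :=
  (Gamma (1 - alpha))^-1 *
  \int[mu]_(s in `]0, t[) ((t - s) `^ (- alpha) * derive1 w s).

End Caputo.

Section DerivativesOnASet.
Variable R : realType.

(* Differentiability relative to A: it is the usual one at interior points of
   A, and the one-sided one at the right end point of an interval `]a, b]. *)
Definition dquot_in (A : set R) (f : R -> R) (t : R) :=
  (fun s => (f s - f t) / (s - t)) @ within A t^'.

Definition derive_in (A : set R) (f : R -> R) (t : R) : R :=
  lim (dquot_in A f t).

Definition deriven_in (A : set R) (l : nat) (f : R -> R) : R -> R :=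
  iter l (derive_in A) f.

Definition Ck_on (k : nat) (A : set R) (f : R -> R) : Prop :=
  (forall (l : nat) (t : R), (l < k)%N -> A t ->
     cvg (dquot_in A (deriven_in A l f) t)) /\
  (forall l : nat, (l <= k)%N -> {within A, continuous (deriven_in A l f)}).

End DerivativesOnASet.

Section Mesh.
Variable R : realType.

(* A mesh and the values on it are sequences of which only the entries of
   index 0, ..., M matter. *)
Definition is_mesh (T : R) (M : nat) (t : nat -> R) : Prop :=
  [/\ (0 < M)%N, t 0%N = 0, t M = T &
      forall j : nat, (j < M)%N -> t j < t j.+1].

Definition tau (t : nat -> R) (j : nat) : R := t j - t j.-1.

Definition sigma (t : nat -> R) (j : nat) : R :=
  (tau t j - tau t j.-1) / (tau t j + tau t j.-1).

Definition sigma_nonincreasing (M : nat) (t : nat -> R) : Prop :=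
  (forall j : nat, (2 <= j < M)%N -> sigma t j.+1 <= sigma t j) /\
  (forall j : nat, (2 <= j <= M)%N -> 0 <= sigma t j).

(* The Lagrange interpolant of degree n at the nodes t_a, ..., t_{a+n}. *)
Definition lagrange_interp (t U : nat -> R) (a n : nat) (s : R) : R :=
  \sum_(i < n.+1) U (a + i)%N *
    \prod_(k < n.+1 | k != i)
      ((s - t (a + k)%N) / (t (a + i)%N - t (a + k)%N)).

(* The piece of Pi^m U on the cell (t_{j-1}, t_j), 1 <= j <= m. *)
Definition interp_piece (t U : nat -> R) (m j : nat) : R -> R :=
  if m == 1%N then lagrange_interp t U 0 1
  else if (j < m)%N then lagrange_interp t U j.-1 2
  else lagrange_interp t U (m - 2) 2.

(* Only the values on [t_0, t_m] matter; for t_0 < s <= t_m the sum has exactly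
   one term. *)
Definition interpolant (t : nat -> R) (m : nat) (U : nat -> R) (s : R) : R :=
  if s <= t 0%N then U 0%N
  else \sum_(1 <= j < m.+1 | t j.-1 < s <= t j) interp_piece t U m j s.

Definition delta (alpha : R) (t U : nat -> R) (m : nat) : R :=
  caputo alpha (interpolant t m U) (t m).

(* The defining property of the constant bar-sigma(alpha). *)
Definition stability_constant (alpha sbar : R) : Prop :=
  let admissible (T : R) (M : nat) (t : nat -> R) :=
    [/\ is_mesh T M t, sigma_nonincreasing M t &
        (2 <= M)%N -> sigma t 2 <= sbar] in
  [/\ (forall T M t, admissible T M t -> forall U : nat -> R,
         0 <= U 0%N ->
         (forall m : nat, (1 <= m <= M)%N -> 0 <= delta alpha t U m) ->
         forall j : nat, (j <= M)%N -> 0 <= U j),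
      (forall T M t, admissible T M t -> forall U B : nat -> R,
         `|U 0%N| <= B 0%N ->
         (forall m : nat, (1 <= m <= M)%N ->
            `|delta alpha t U m| <= delta alpha t B m) ->
         forall j : nat, (j <= M)%N -> `|U j| <= B j) &
      (exists2 C : R, 0 < C &
         forall T M t, admissible T M t -> forall U : nat -> R,
         U 0%N = 0 ->
         forall m : nat, (1 <= m <= M)%N ->
           `|U m| <= C * \big[Num.max/0]_(1 <= j < m.+1)
                           (t j `^ alpha * `|delta alpha t U j|))].

Definition simeq (c a b : R) : Prop := a <= c * b /\ b <= c * a.

Definition error_bound (alpha r : R) (M : nat) (t : nat -> R) (m : nat) : R :=
  if r < 3 - alpha then M%:R `^ (- r) * t m `^ (alpha - 1)
  else if r == 3 - alpha then
    M%:R `^ (alpha - 3) * t m `^ (alpha - 1) * (1 + ln (t m / t 1%N))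
  else M%:R `^ (alpha - 3) * t m `^ (alpha - (3 - alpha) / r).

End Mesh.

(* Main.v *)
Require Import Defs.
From mathcomp Require Import all_boot all_order all_algebra.
From mathcomp Require Import all_classical all_reals all_analysis.
From mathcomp Require Import measurable_realfun ring lra zify.

Set Implicit Arguments.
Unset Strict Implicit.
Unset Printing Implicit Defensive.

Import Order.TTheory GRing.Theory Num.Theory.
Import numFieldNormedType.Exports.

Local Open Scope classical_set_scope.
Local Open Scope ring_scope.

(* With t_1 ~ M^-r, the truncation error of the L1-2 type operator delta at t_m
   is O((t_1 / t_m)^mu) for every mu <= (3 - alpha) / r with mu < alpha + 1: the
   interpolation error vanishes at both ends of a cell, so on each cell but the
   last a constant may be subtracted from the kernel (t_m - s)^-alpha.

   To convert this source into an error bound, compare with discrete barriers.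
   For B_c(s) = s (s + c)^(alpha - 2) the Caputo derivative is explicit,
     c^alpha t^(1 - alpha) (t + c)^-2 / (Gamma(1 - alpha) (1 - alpha)),
   hence positive and of the order of c^-1 near t = c, and delta B_c inherits a
   positive lower bound as soon as c is a large multiple of t_1.  A dyadic
   superposition of such barriers, c = 2^n P t_1, dominates (t_1 / t)^mu, while
   B_c <= s^(alpha - 1); the geometric sum of the weights produces the three
   regimes of the error bound.  When (3 - alpha) / r <= alpha, property (iii) of
   the stability constant suffices.

   Stability is only granted once sigma_j <= sbar, so the error is split as V + W
   with V supported on the first K nodes.  There it is bounded by induction,
   thanks to the positive diagonal coefficient of delta; since V vanishes at both
   ends, delta V decays like t_m^(-alpha - 1), and W is controlled by the
   stability property on the mesh shifted by t_{K-1}. *)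

(** * Dominated integration of derivatives *)

(** The exponent mu is left free because every mu > 1 leads to the same final rate t_1 t_m^(alpha -
    1). If (3 - alpha) / r exceeds 1 it may thus be lowered to 1 + alpha / 2, half way between 1 and
    the limit alpha + 1, where the history becomes a power sum of exponent -1 and a logarithm would
    appear. Origin of the barriers: s^(alpha - 1) is annihilated by the Riemann-Liouville derivative
    of order alpha but is singular at 0. B_c regularises it at scale c, vanishes at 0, and leaves a
    positive residue concentrated around t = c, so that one barrier per dyadic scale is natural. The
    mesh enters the estimates through three facts: steps do not decrease, their consecutive ratios
    are bounded, and a step ending at t_j is at most C t_j^(1 - 1/r) t_1^(1/r). These survive a
    restart of the mesh at a fixed node, which the treatment of the first K steps requires. An
    analytic obstacle runs through all integrals: the kernel is unbounded at t_m and u' at 0, so the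
    fundamental theorem is needed for integrands that are singular at the end points. *)

Section Primitive.
Variable R : realType.
Notation mu := (@lebesgue_measure R).
Implicit Types (F G f g : R -> R) (a b c : R).

(** [F] is continuous up to the end points, while [f] is continuous only inside and may blow up at
    the ends. Integrability of [f] is then deduced from a sign or from a majorant. *)
Definition prim F f a b : Prop :=
  [/\ {within `[a, b], continuous F},
      {in `]a, b[%R, forall x, is_derive x (1:R) F (f x)} &
      {in `]a, b[%R, forall x, {for x, continuous f}}].

Lemma primD F f G g a b : prim F f a b -> prim G g a b ->
  prim (fun x => F x + G x) (fun x => f x + g x) a b.
Proof.
move=> [cF dF cf] [cG dG cg]; split.
- by move=> x; apply: (@cvgD _ _ _ _ _ _ _ _ _ (cF x) (cG x)).
- by move=> x xab; have := dF x xab; have := dG x xab => ? ?; exact: is_deriveD.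
- by move=> x xab; apply: (@cvgD _ _ _ _ _ _ _ _ _ (cf x xab) (cg x xab)).
Qed.

Lemma primN F f a b : prim F f a b -> prim (fun x => - F x) (fun x => - f x) a b.
Proof.
move=> [cF dF cf]; split.
- by move=> x; apply: (@cvgN _ _ _ _ _ _ _ (cF x)).
- by move=> x xab; have := dF x xab => ?; exact: is_deriveN.
- by move=> x xab; apply: (@cvgN _ _ _ _ _ _ _ (cf x xab)).
Qed.

Lemma primB F f G g a b : prim F f a b -> prim G g a b ->
  prim (fun x => F x - G x) (fun x => f x - g x) a b.
Proof. by move=> pF pG; apply: primD pF (primN pG). Qed.

Lemma primZ k F f a b : prim F f a b ->
  prim (fun x => k * F x) (fun x => k * f x) a b.
Proof.
move=> [cF dF cf]; split.
- by move=> x; apply: cvgM; [exact: cvg_cst|exact: cF].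
- by move=> x xab; have := dF x xab => ?; exact: is_deriveZ.
- by move=> x xab; apply: cvgM; [exact: cvg_cst|exact: (cf x xab)].
Qed.

Lemma prim_cst k a b : prim (fun=> k) (fun=> 0) a b.
Proof.
split.
- by move=> x; apply: cvg_cst.
- by move=> x _; exact: is_derive_cst.
- by move=> x _; apply: cvg_cst.
Qed.

Lemma prim_lin a b : prim (fun x => x) (fun=> 1) a b.
Proof.
split.
- by apply: continuous_subspaceT => x; exact: cvg_id.
- by move=> x _; exact: is_derive_id.
- by move=> x _; apply: cvg_cst.
Qed.

Lemma prim_eq F f F' f' a b : {in `[a, b], F =1 F'} -> {in `]a, b[, f =1 f'} ->
  prim F f a b -> prim F' f' a b.
Proof.
move=> FF ff [cF dF cf]; split.
- apply: subspace_eq_continuous cF => x; rewrite inE => xab; exact: FF.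
- move=> x xab; have := dF x xab; rewrite ff//.
  apply: near_eq_is_derive.
  move: (near_in_itvoo xab).
  by apply: filterS => y yab; apply: FF; exact: subset_itv_oo_cc.
- move=> x xab; have := cf x xab; rewrite /prop_for /continuous_at -ff//.
  apply: cvg_trans; apply: near_eq_cvg.
  by move: (near_in_itvoo xab); apply: filterS => y yab; exact: ff.
Qed.

Lemma prim_cvgl F f a b : a < b -> prim F f a b -> F x @[x --> a^'+] --> F a.
Proof. by move=> ab [/(continuous_within_itvP _ ab)[]]. Qed.

Lemma prim_cvgr F f a b : a < b -> prim F f a b -> F x @[x --> b^'-] --> F b.
Proof. by move=> ab [/(continuous_within_itvP _ ab)[]]. Qed.

Lemma measurable_oo f a b : {in `]a, b[%R, forall x, {for x, continuous f}} ->
  measurable_fun `]a, b[ f.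
Proof.
move=> cf; apply: open_continuous_measurable_fun; first exact: interval_open.
by move=> x; rewrite inE => xab; exact: cf.
Qed.

Lemma prim_inside F f a b c d : a < c -> c <= d -> d < b -> prim F f a b ->
  mu.-integrable `[c, d] (EFin \o f) /\
  (\int[mu]_(x in `[c, d]) (f x)%:E = (F d - F c)%:E)%E.
Proof.
move=> ac cd db [cF dF cf].
have cfcd : {within `[c, d], continuous f}.
  apply: continuous_in_subspaceT => x; rewrite inE/= in_itv/= => /andP[cx xd].
  by apply: cf; rewrite in_itv/= (lt_le_trans ac cx) (le_lt_trans xd db).
split.
  by apply: continuous_compact_integrable => //; exact: segment_compact.
move: cd; rewrite le_eqVlt => /predU1P[<-|cd].
  by rewrite set_itv1 integral_set1 subrr.
rewrite (@continuous_FTC2 _ f F _ _ cd cfcd) ?EFinB//; last first.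
  move=> x; rewrite in_itv/= => /andP[cx xd].
  rewrite derive1E; apply: (@derive_val _ _ _ _ _ _ _ (dF x _)).
  by rewrite in_itv/= (lt_trans ac cx) (lt_trans xd db).
have sub x : c <= x -> x <= d -> is_derive x (1:R) F (f x).
  by move=> cx xd; apply: dF; rewrite in_itv/= (lt_le_trans ac cx) (le_lt_trans xd db).
have cnt x : c <= x -> x <= d -> {for x, continuous F}.
  move=> cx xd; apply: differentiable_continuous; apply/derivable1_diffP.
  by have := sub x cx xd => -[].
split.
- move=> x; rewrite in_itv/= => /andP[cx xd].
  by have := sub x (ltW cx) (ltW xd) => -[].
- by apply: cvg_at_right_filter; apply: cnt => //; exact: ltW.
- by apply: cvg_at_left_filter; apply: cnt => //; exact: ltW.
Qed.

(** Monotone convergence along the segments [a + h n, b - h n]: for a nonnegative integrand,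
    continuity of [F] at both ends yields integrability and the value at once. *)
Lemma prim_ge0 F f a b : a < b -> prim F f a b ->
  {in `]a, b[%R, forall x, 0 <= f x} ->
  mu.-integrable `]a, b[ (EFin \o f) /\ \int[mu]_(x in `]a, b[) f x = F b - F a.
Proof.
move=> ab pF f0; have [cF dF cf] := pF.
(* Denominators start at 3, so that every segment is nondegenerate. *)
pose h n : R := (b - a) / n.+3%:R.
have h0 n : 0 < h n by rewrite divr_gt0// subr_gt0.
have hlt n : a + h n < b - h n.
  rewrite -subr_gt0 /h.
  rewrite [X in 0 < X](_ : _ = (b - a) * (1 - 2 / n.+3%:R)); last by ring.
  rewrite mulr_gt0 ?subr_gt0// ltr_pdivrMr// mul1r.
  by rewrite (ltr_nat R 2).
pose S (n : nat) : set R := `[a + h n, b - h n]%classic.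
have hdec n : h n.+1 <= h n.
  by rewrite ler_pM2l ?subr_gt0// lef_pV2 ?posrE// ler_nat.
have hcv : h n @[n --> \oo] --> (0 : R).
  rewrite -[X in _ --> X](mulr0 (b - a)); apply: cvgM; first exact: cvg_cst.
  have := @cvg_harmonic R; rewrite -(cvg_shiftn 2).
  by apply: cvg_trans; apply: near_eq_cvg; apply: nearW => n; rewrite /= addn2.
have nS : nondecreasing_seq S.
  apply/nondecreasing_seqP => n; apply/subsetPset => x; rewrite /S /= !in_itv/=.
  by have := hdec n => hd /andP[? ?]; apply/andP; split; lra.
have mS n : measurable (S n) by exact: measurable_itv.
have US : \bigcup_n S n = `]a, b[%classic.
  apply/seteqP; split => [x [n _]|x].
    rewrite /S /= !in_itv/= => /andP[? ?]; have := h0 n => ?.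
    by apply/andP; split; lra.
  rewrite /= in_itv/= => /andP[ax xb].
  have [N _ HN] : \forall n \near \oo, h n < Num.min (x - a) (b - x).
    apply: (cvgr_lt 0 hcv); by rewrite lt_min !subr_gt0 ax xb.
  exists N => //; have := HN N (leqnn N); rewrite lt_min => /andP[? ?].
  by rewrite /S /= in_itv/=; apply/andP; split; lra.
have intS n : (\int[mu]_(x in S n) (f x)%:E = (F (b - h n) - F (a + h n))%:E)%E.
  apply: (proj2 (@prim_inside F f a b _ _ _ _ _ pF)); last by rewrite ltrBlDr ltrDl.
    by rewrite ltrDl.
  exact: ltW.
have mf : measurable_fun `]a, b[ (EFin \o f).
  by apply/measurable_EFinP; exact: measurable_oo.
have cv1 : (\int[mu]_(x in S n) (f x)%:E @[n --> \oo] -->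
    \int[mu]_(x in \bigcup_n S n) (f x)%:E)%E.
  apply: ge0_nondecreasing_set_cvg_integral => //.
  - move=> n; apply: measurable_funS mf => // x Sx.
    by rewrite -US; exists n.
  - move=> n x Sx; rewrite lee_fin; apply: f0; have : (\bigcup_n S n) x by exists n.
    by rewrite US.
have cva : F (a + h n) @[n --> \oo] --> F a.
  have /cvg_at_rightP := prim_cvgl ab pF; apply; split.
    by move=> n; rewrite ltrDl.
  by rewrite -[X in _ --> X]addr0; apply: cvgD => //; exact: cvg_cst.
have cvb : F (b - h n) @[n --> \oo] --> F b.
  have /cvg_at_leftP := prim_cvgr ab pF; apply; split.
    by move=> n; rewrite ltrBlDr ltrDl.
  by rewrite -[X in _ --> X]subr0; apply: cvgB => //; exact: cvg_cst.
have cv2 : (\int[mu]_(x in S n) (f x)%:E @[n --> \oo] --> (F b - F a)%:E)%E.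
  under eq_cvg do rewrite intS.
  by apply: cvg_EFin; [exact: nearW|exact: cvgB].
rewrite US in cv1.
have E : (\int[mu]_(x in `]a, b[) (f x)%:E = (F b - F a)%:E)%E.
  by apply: cvg_unique cv1 cv2.
split; last by rewrite /Rintegral E.
apply/integrableP; split => //.
have -> : (\int[mu]_(x in `]a, b[) `|(EFin \o f) x| =
    \int[mu]_(x in `]a, b[) (f x)%:E)%E.
  by apply: eq_integral => x /set_mem xab /=; rewrite ger0_norm//; exact: f0.
by rewrite E ltry.
Qed.

Lemma int_dom f G g a b : a < b -> prim G g a b ->
  {in `]a, b[%R, forall x, {for x, continuous f}} ->
  {in `]a, b[%R, forall x, `|f x| <= g x} ->
  mu.-integrable `]a, b[ (EFin \o f) /\
  `|\int[mu]_(x in `]a, b[) f x| <= G b - G a.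
Proof.
move=> ab pG cf fg.
have g0 : {in `]a, b[%R, forall x, 0 <= g x}.
  by move=> x xab; apply: le_trans (fg x xab).
have [ig Eg] := prim_ge0 ab pG g0.
have if_ : mu.-integrable `]a, b[ (EFin \o f).
  apply: le_integrable ig => //.
  - by apply/measurable_EFinP; exact: measurable_oo.
  - move=> x xab /=; rewrite lee_fin (ger0_norm (g0 x xab)); exact: fg.
split=> //; rewrite -Eg; apply: le_trans (le_normr_Rintegral _ if_) _ => //.
apply: le_Rintegral => //.
- exact: (integrable_norm if_).
Qed.

(** The nonnegative case, applied to [f + g] and to [g], and a subtraction. *)
Lemma prim_dom F f G g a b : a < b -> prim F f a b -> prim G g a b ->
  {in `]a, b[%R, forall x, `|f x| <= g x} ->
  mu.-integrable `]a, b[ (EFin \o f) /\ \int[mu]_(x in `]a, b[) f x = F b - F a.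
Proof.
move=> ab pF pG fg; have [_ _ cf] := pF.
have [if_ _] := int_dom ab pG cf fg; split=> //.
have g0 : {in `]a, b[%R, forall x, 0 <= g x}.
  by move=> x xab; apply: le_trans (fg x xab).
have [ig Eg] := prim_ge0 ab pG g0.
have [is_ Es] : mu.-integrable `]a, b[ (EFin \o (fun x => f x + g x)) /\
   \int[mu]_(x in `]a, b[) (f x + g x) = (F b + G b) - (F a + G a).
  apply: (prim_ge0 ab (primD pF pG)) => x xab.
  by have := fg x xab; rewrite ler_norml => /andP[? _]; lra.
move: Es; rewrite RintegralD// Eg; lra.
Qed.

End Primitive.

(** * Real powers and their primitives *)

Section PowR.
Variable R : realType.
Implicit Types (a b c p q s t x y : R).

Lemma powR_le_base p x y : 0 <= p -> 0 <= x -> x <= y -> x `^ p <= y `^ p.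
Proof.
by move=> p0 x0 xy; apply: ge0_ler_powR => //; rewrite nnegrE// (le_trans x0).
Qed.

Lemma powR_ge_base p x y : p <= 0 -> 0 < x -> x <= y -> y `^ p <= x `^ p.
Proof.
move=> p0 x0 xy; rewrite -[p]opprK !(powRN _ (- p)).
rewrite lef_pV2 ?posrE ?powR_gt0//; last exact: lt_le_trans xy.
by apply: powR_le_base => //; [rewrite oppr_ge0|exact: ltW].
Qed.

Lemma powR_add x p q : 0 < x -> x `^ (p + q) = x `^ p * x `^ q.
Proof. by move=> x0; rewrite powRD// (gt_eqF x0) implybT. Qed.

Lemma powR_addK x p : 0 < x -> x `^ p * x `^ (- p) = 1.
Proof. by move=> x0; rewrite -powR_add// subrr powRr0. Qed.

Lemma powR_sub1 x p : 0 < x -> x `^ (p - 1) = x `^ p / x.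
Proof. by move=> x0; rewrite powR_add// powR_inv1// ltW. Qed.

Lemma powR_div x y p : 0 <= x -> 0 < y -> (x / y) `^ p = x `^ p * y `^ (- p).
Proof.
move=> x0 y0; rewrite powRM ?invr_ge0 ?(ltW y0)//; congr (_ * _).
by rewrite -powR_inv1 ?(ltW y0)// -powRrM mulN1r.
Qed.

Lemma powR_half x p : 0 < x -> -1 <= p -> p <= 0 -> (x / 2) `^ p <= 2 * x `^ p.
Proof.
move=> x0 p1 p0; rewrite powR_div ?(ltW x0)// mulrC ler_wpM2r ?powR_ge0//.
rewrite -[leRHS](powRr1 (ler0n R 2)).
by apply: ler_powR; [rewrite ler1n|lra].
Qed.

(** With its base cut at 0 the power is continuous on the whole line; this gives [prim_powR_comp]
    its continuity at end points where the base reaches 0. *)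
Lemma continuous_powR_max p : 0 < p -> continuous (fun x => (Num.max x 0) `^ p).
Proof.
move=> p0 x; have [x0|x0|->] := ltrgt0P x.
- have : {for x, continuous (fun y => y `^ p)}.
    apply: differentiable_continuous; apply/derivable1_diffP.
    by apply: derivable_powR; rewrite in_itv/= andbT.
  rewrite /prop_for /continuous_at (max_l (ltW x0)); apply: cvg_trans.
  apply: near_eq_cvg; near=> y; rewrite max_l//.
  by apply: ltW; near: y; exact: lt_nbhsr.
- rewrite /continuous_at (max_r (ltW x0)) powR0 ?gt_eqF//.
  have : (fun=> 0 : R) y @[y --> x] --> (0 : R) by exact: cvg_cst.
  apply: cvg_trans; apply: near_eq_cvg; near=> y.
  rewrite max_r ?powR0 ?gt_eqF//.
  by apply: ltW; near: y; exact: lt_nbhsl.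
- rewrite /continuous_at maxxx powR0 ?gt_eqF//.
  apply/cvgr0Pnorm_le => e e0.
  have q0 : 0 < e `^ p^-1 by exact: powR_gt0.
  near=> y.
  rewrite ger0_norm ?powR_ge0//.
  have -> : e = (e `^ p^-1) `^ p by rewrite -powRrM mulVf ?gt_eqF// powRr1// ltW.
  apply: powR_le_base; [exact: ltW|by rewrite le_max lexx orbT|].
  rewrite ge_max (ltW q0) andbT.
  by apply: ltW; near: y; exact: lt_nbhsl.
Unshelve. all: by end_near. Qed.

Lemma is_derive_powR_comp (h : R -> R) h' s p : 0 < h s -> is_derive s (1:R) h h' ->
  is_derive s (1:R) (fun x => (h x) `^ p) (p * (h s) `^ (p - 1) * h').
Proof.
move=> hs dh; have := is_derive1_powR p hs => dp.
exact: (@is_derive1_comp R (fun x => x `^ p) h s _ _ dp dh).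
Qed.

(** For p < 1 the derivative may blow up where [h] vanishes, which can happen at the end points
    only. *)
Lemma prim_powR_comp (h h' : R -> R) p a b : 0 < p -> prim h h' a b ->
  {in `]a, b[%R, forall s, 0 < h s} -> {in `[a, b]%R, forall s, 0 <= h s} ->
  prim (fun s => (h s) `^ p) (fun s => p * (h s) `^ (p - 1) * h' s) a b.
Proof.
move=> p0 [ch dh ch'] h0 hge0; split.
- have : {within `[a, b], continuous (fun s => (Num.max (h s) 0) `^ p)}.
    by move=> x; exact: (cvg_comp _ _ (ch x) (continuous_powR_max p0 (x:=h x))).
  move=> H; apply: subspace_eq_continuous H => x; rewrite inE => xab.
  by rewrite /from_subspace /= max_l// hge0.
- by move=> s sab; apply: is_derive_powR_comp; [exact: h0|exact: dh].
- move=> s sab; apply: cvgM; last exact: ch'.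
  apply: cvgM; first exact: cvg_cst.
  apply: (@continuous_comp _ _ _ h (fun y => y `^ (p - 1))).
    apply: differentiable_continuous; apply/derivable1_diffP.
    by have := dh s sab => -[].
  apply: differentiable_continuous; apply/derivable1_diffP.
  by apply: derivable_powR; rewrite in_itv/= andbT h0.
Qed.

Lemma prim_powR p a b : 0 < p -> 0 <= a ->
  prim (fun s => p^-1 * s `^ p) (fun s => s `^ (p - 1)) a b.
Proof.
move=> p0 a0; have := @prim_powR_comp (fun s => s) (fun=> 1) p a b p0 (prim_lin a b).
move=> H; have /(primZ p^-1) : prim (fun s => s `^ p) (fun s => p * s `^ (p - 1) * 1) a b.
  apply: H => s; rewrite in_itv/= => /andP[? ?]; first exact: le_lt_trans a0 _.
  exact: le_trans a0 _.
by apply: prim_eq => // s _; rewrite mulr1 mulKf// gt_eqF.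
Qed.

Lemma prim_weight al t a b : al < 1 -> b <= t ->
  prim (fun s => - ((1 - al)^-1 * (t - s) `^ (1 - al)))
       (fun s => (t - s) `^ (- al)) a b.
Proof.
move=> al1 bt; have p0 : 0 < 1 - al by rewrite subr_gt0.
have pl : prim (fun s => t - s) (fun s => 0 - 1) a b.
  exact: primB (prim_cst t a b) (prim_lin a b).
have := prim_powR_comp p0 pl => H.
have /(primZ (- (1 - al)^-1)) : prim (fun s => (t - s) `^ (1 - al))
   (fun s => (1 - al) * (t - s) `^ (1 - al - 1) * (0 - 1)) a b.
  apply: H => s; rewrite in_itv/= => /andP[? ?]; lra.
apply: prim_eq => s _; first by rewrite mulNr.
rewrite sub0r mulrN1 mulrNN mulKf ?gt_eqF//; congr (_ `^ _); ring.
Qed.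

Lemma cont_weight al t a b : b <= t ->
  {in `]a, b[%R, forall s, {for s, continuous (fun s => (t - s) `^ (- al))}}.
Proof.
move=> bt s; rewrite in_itv/= => /andP[sa sb].
apply: (@continuous_comp _ _ _ (fun s => t - s) (fun y => y `^ (- al))).
  by apply: cvgB; [exact: cvg_cst|exact: cvg_id].
apply: differentiable_continuous; apply/derivable1_diffP.
by apply: derivable_powR; rewrite in_itv/= andbT subr_gt0 (lt_le_trans sb).
Qed.

End PowR.

(** * Integrals against the kernel (t - s)^-al *)

Section WeightedIntegral.
Variable R : realType.
Notation mu := (@lebesgue_measure R).
Implicit Types (F G f g X x : R -> R) (a b c t al A D d k : R).

Definition wint al t a b g : R := \int[mu]_(s in `]a, b[) ((t - s) `^ (- al) * g s).

Definition wintegrable al t a b g :=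
  mu.-integrable `]a, b[ (EFin \o (fun s => (t - s) `^ (- al) * g s)).

Lemma integrable_add f g a b : mu.-integrable `]a, b[ (EFin \o f) ->
  mu.-integrable `]a, b[ (EFin \o g) ->
  mu.-integrable `]a, b[ (EFin \o (fun s => f s + g s)).
Proof.
move=> i1 i2; have -> : EFin \o (fun s => f s + g s) = ((EFin \o f) \+ (EFin \o g))%E.
  by apply/funext.
exact: integrableD.
Qed.

Lemma integrable_scale k f a b : mu.-integrable `]a, b[ (EFin \o f) ->
  mu.-integrable `]a, b[ (EFin \o (fun s => k * f s)).
Proof.
move=> i1; have -> : EFin \o (fun s => k * f s) = (fun s => k%:E * (EFin \o f) s)%E.
  by apply/funext.
exact: integrableZl.
Qed.

Lemma cont_wfun al t a b g : b <= t ->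
  {in `]a, b[%R, forall s, {for s, continuous g}} ->
  {in `]a, b[%R, forall s, {for s, continuous (fun s => (t - s) `^ (- al) * g s)}}.
Proof.
by move=> bt cg s sab; apply: cvgM; [exact: cont_weight bt _ sab|exact: cg].
Qed.

(** The integral of [x] is [X b - X a], so the kernel may be replaced by a constant [k] at the cost
    of its deviation [D]. If [X a = X b], this deviation is all that remains. *)
Lemma wint_ref al t a b k D X x G g : a < b -> b <= t ->
  prim X x a b -> prim G g a b -> {in `]a, b[%R, forall s, `|x s| <= g s} ->
  {in `]a, b[%R, forall s, `|(t - s) `^ (- al) - k| <= D} ->
  wintegrable al t a b x /\ `|wint al t a b x - k * (X b - X a)| <= D * (G b - G a).
Proof.
move=> ab bt pX pG xg kD; have [_ _ cx] := pX.
have [ix Ex] := prim_dom ab pX pG xg.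
have := @int_dom R (fun s => ((t - s) `^ (- al) - k) * x s) _ _ _ _ ab (primZ D pG).
case.
- move=> s sab; apply: cvgM; last exact: cx.
  by apply: cvgB; [exact: cont_weight bt _ sab|exact: cvg_cst].
- by move=> s sab; rewrite normrM ler_pM//; [exact: kD|exact: xg].
move=> iy By.
have ikx : mu.-integrable `]a, b[ (EFin \o (fun s => k * x s)). by exact: integrable_scale.
have eqf : (fun s => (t - s) `^ (- al) * x s) =
   (fun s => ((t - s) `^ (- al) - k) * x s + k * x s).
  by apply/funext => s; ring.
split.
  by rewrite /wintegrable eqf; exact: integrable_add.
have -> : wint al t a b x =
    \int[mu]_(s in `]a, b[) (((t - s) `^ (- al) - k) * x s + k * x s).
  by apply: eq_Rintegral => s _; ring.
by rewrite RintegralD// RintegralZl// Ex addrK mulrBr.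
Qed.

Lemma wint_bound al t a b d x : al < 1 -> a < b -> b <= t ->
  {in `]a, b[%R, forall s, {for s, continuous x}} ->
  {in `]a, b[%R, forall s, `|x s| <= d} ->
  wintegrable al t a b x /\
  `|wint al t a b x| <= d * (((t - a) `^ (1 - al) - (t - b) `^ (1 - al)) / (1 - al)).
Proof.
move=> al1 ab bt cx xd.
have := int_dom ab (primZ d (prim_weight a al1 bt)) (cont_wfun (al:=al) bt cx).
case.
  move=> s sab; rewrite normrM (ger0_norm (powR_ge0 _ _)) mulrC.
  by rewrite ler_wpM2r ?powR_ge0//; exact: xd.
move=> i B; split=> //; apply: le_trans B _.
by rewrite le_eqVlt; apply/orP; left; apply/eqP; ring.
Qed.

(** Singularities at 0 and at t. On each half of ]0, t[ one of the two singular factors is at most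
    twice its value at length t, so a sum of two terms with one singularity each is a majorant on
    the whole interval. In the contribution of [A] the powers of t cancel. *)
Lemma wint_sing al t A d x : 0 < al < 1 -> 0 < t -> 0 <= A -> 0 <= d ->
  {in `]0, t[%R, forall s, {for s, continuous x}} ->
  {in `]0, t[%R, forall s, `|x s| <= A * s `^ (al - 1) + d} ->
  wintegrable al t 0 t x /\
  `|wint al t 0 t x| <= 2 * A * ((1 - al)^-1 + al^-1) + d * t `^ (1 - al) / (1 - al).
Proof.
move=> /andP[al0 al1] t0 A0 d0 cx xd.
pose g s := (2 * A * t `^ (al - 1) + d) * (t - s) `^ (- al)
            + (2 * A * t `^ (- al)) * s `^ (al - 1).
have pG := primD (primZ (2 * A * t `^ (al - 1) + d) (prim_weight 0 al1 (lexx t)))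
  (primZ (2 * A * t `^ (- al)) (prim_powR t al0 (lexx 0))).
have := int_dom t0 pG (cont_wfun (al:=al) (lexx t) cx).
case.
  move=> s sab; have := xd s sab; move: sab; rewrite in_itv/= => /andP[s0 st] xs.
  rewrite normrM (ger0_norm (powR_ge0 _ _)).
  have w0 := powR_ge0 (t - s) (- al); have v0 := powR_ge0 s (al - 1).
  have t1 := powR_ge0 t (- al); have t2 := powR_ge0 t (al - 1).
  apply: (@le_trans _ _ ((t - s) `^ (- al) * (A * s `^ (al - 1) + d))).
    exact: ler_wpM2l.
  rewrite mulrDl mulrDr [_ * d]mulrC -addrA [d * _ + _]addrC addrA lerD2r.
  have [h|h] := leP (t / 2) s.
    have v1 : s `^ (al - 1) <= 2 * t `^ (al - 1).
      by apply: (le_trans _ (powR_half t0 _ _)); [apply: powR_ge_base; lra|lra|lra].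
    rewrite -[leLHS]addr0 lerD//; last by rewrite !mulr_ge0.
    rewrite mulrCA -!mulrA [X in _ <= X]mulrCA ler_wpM2l// mulrA.
    by rewrite [leLHS]mulrC ler_wpM2r.
  have w1 : (t - s) `^ (- al) <= 2 * t `^ (- al).
    by apply: (le_trans _ (powR_half t0 _ _)); [apply: powR_ge_base; lra|lra|lra].
  rewrite -[leLHS]add0r lerD//; first by rewrite !mulr_ge0.
  rewrite mulrCA -!mulrA [X in _ <= X]mulrCA ler_wpM2l// mulrA.
  by rewrite ler_wpM2r.
move=> i B; split=> //; apply: le_trans B _.
rewrite subrr subr0 !powR0 ?gt_eqF ?subr_gt0//.
have E1 : t `^ (al - 1) * t `^ (1 - al) = 1 by rewrite -opprB mulrC powR_addK.
have E2 : t `^ (- al) * t `^ al = 1 by rewrite mulrC powR_addK.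
rewrite le_eqVlt; apply/orP; left; apply/eqP.
transitivity (2 * A * ((1 - al)^-1 * (t `^ (al - 1) * t `^ (1 - al)) + al^-1 *
   (t `^ (- al) * t `^ al)) + d * t `^ (1 - al) / (1 - al)); first by ring.
by rewrite E1 E2 !mulr1.
Qed.

Lemma int_split (f : R -> R) a b c : a <= b -> b < c ->
  mu.-integrable `]a, b[ (EFin \o f) -> mu.-integrable `]b, c[ (EFin \o f) ->
  mu.-integrable `]a, c[ (EFin \o f) /\
  \int[mu]_(s in `]a, c[) f s = \int[mu]_(s in `]a, b[) f s + \int[mu]_(s in `]b, c[) f s.
Proof.
rewrite le_eqVlt => /predU1P[<-|ab] bc i1 i2.
  by split=> //; rewrite set_itvoo0 ?Rintegral_set0 ?add0r.
have U : `]a, c[%classic = `]a, b] `|` `]b, c[.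
  by rewrite -itv_bndbnd_setU// bnd_simp; exact: ltW.
have dis : [disjoint `]a, b]%classic & `]b, c[%classic].
  apply/disj_set2P; rewrite -subset0 => s [] /=; rewrite !in_itv/= => /andP[_ h].
  by move=> /andP[h' _]; move: (lt_le_trans h' h); rewrite ltxx.
have [/measurable_EFinP m1 f1] := integrableP _ _ _ i1.
have [/measurable_EFinP m2 f2] := integrableP _ _ _ i2.
have m1' : measurable_fun `]a, b] f by apply/measurable_fun_itv_bndo_bndcP.
have mU : measurable_fun (`]a, b] `|` `]b, c[) (EFin \o f).
  by apply/measurable_EFinP; apply/measurable_funU.
have iU : mu.-integrable `]a, c[ (EFin \o f).
  rewrite U; apply/integrableP; split => //.
  rewrite ge0_integral_setU//=; last first.
    apply/measurable_EFinP; apply: measurableT_comp => //; exact/measurable_EFinP.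
  apply: lte_add_pinfty => //.
  rewrite -integral_itv_bndo_bndc//.
  by apply/measurable_EFinP; exact: measurableT_comp.
split=> //.
rewrite U Rintegral_setU//; last by rewrite -U.
by congr (_ + _); rewrite Rintegral_itv_bndo_bndc.
Qed.

End WeightedIntegral.

(** * The operator delta cell by cell *)
Section Cells.
Variable R : realType.
Notation mu := (@lebesgue_measure R).
Implicit Types (t U V : nat -> R) (al s : R) (m j n : nat).

(** Divided differences: [quad] is the Lagrange interpolant in Newton form, and its derivative is
    affine with coefficients made of them. *)
Definition dd1 t U (a : nat) : R := (U a.+1 - U a) / (t a.+1 - t a).
Definition dd2 t U (a : nat) : R := (dd1 t U a.+1 - dd1 t U a) / (t a.+2 - t a).
Definition quad t U (a : nat) s : R :=
  U a + dd1 t U a * (s - t a) + dd2 t U a * ((s - t a) * (s - t a.+1)).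
Definition dquad t U (a : nat) s : R :=
  dd1 t U a + dd2 t U a * (2 * s - t a - t a.+1).

(* Cells are numbered from 0: cell j is (t_j, t_{j+1}). *)
Definition stencil m j : nat := if (j.+1 < m)%N then j else m.-2.
Definition piece t U m j s : R :=
  if m == 1%N then U 0%N + dd1 t U 0 * (s - t 0%N) else quad t U (stencil m j) s.
Definition dpiece t U m j s : R :=
  if m == 1%N then dd1 t U 0 else dquad t U (stencil m j) s.
Definition ddpiece t U m j : R :=
  if m == 1%N then 0 else 2 * dd2 t U (stencil m j).

Lemma prod_neq2 (i : 'I_2) (F : 'I_2 -> R) : \prod_(k < 2 | k != i) F k =
  (if ord0 != i then F ord0 else 1) *
  (if lift ord0 ord0 != i then F (lift ord0 ord0) else 1).
Proof.
rewrite big_mkcond !big_ord_recl big_ord0 /=.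
by rewrite mulr1.
Qed.

Lemma prod_neq3 (i : 'I_3) (F : 'I_3 -> R) : \prod_(k < 3 | k != i) F k =
  (if ord0 != i then F ord0 else 1) *
  ((if lift ord0 ord0 != i then F (lift ord0 ord0) else 1) *
  (if lift ord0 (lift ord0 ord0) != i then F (lift ord0 (lift ord0 ord0)) else 1)).
Proof.
rewrite big_mkcond !big_ord_recl big_ord0 /=.
by rewrite mulr1.
Qed.

Lemma lagrange1 t U a s : t a != t a.+1 ->
  lagrange_interp t U a 1 s = U a + dd1 t U a * (s - t a).
Proof.
move=> h; rewrite /lagrange_interp !big_ord_recl big_ord0 /=.
rewrite !prod_neq2 /= /bump /= /dd1 !addn0 !addn1.
by field; rewrite !subr_eq0 [_ == t a]eq_sym h.
Qed.

Lemma lagrange2 t U a s : t a != t a.+1 -> t a.+1 != t a.+2 -> t a != t a.+2 ->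
  lagrange_interp t U a 2 s = quad t U a s.
Proof.
move=> h1 h2 h3; rewrite /lagrange_interp !big_ord_recl big_ord0 /=.
rewrite !prod_neq3 /= /quad /dd2 /dd1 /bump /=.
rewrite !addn0 !addn1 !addn2.
by field; rewrite !subr_eq0 [_ == t a]eq_sym h1 [t a.+2 == t a.+1]eq_sym h2
  ?[_ == t a]eq_sym ?h3 ?h1.
Qed.

Definition increasing_to t n := forall j, (j < n)%N -> t j < t j.+1.

Lemma increasing_lt t n i j : increasing_to t n -> (i < j <= n)%N -> t i < t j.
Proof.
move=> ht; elim: j => [//|j IH] /andP[ij jn].
have := ht j jn; move: ij; rewrite ltnS leq_eqVlt => /predU1P[-> //|ij].
by apply: lt_trans; apply: IH; rewrite ij ltnW.
Qed.

Lemma increasing_le t n i j : increasing_to t n -> (i <= j <= n)%N -> t i <= t j.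
Proof.
move=> ht /andP[]; rewrite leq_eqVlt => /predU1P[-> //|ij jn].
by apply: ltW; apply: (increasing_lt ht); rewrite ij.
Qed.

Lemma interp_pieceE t U m j s : increasing_to t m -> (j < m)%N ->
  interp_piece t U m j.+1 s = piece t U m j s.
Proof.
move=> ht jm; rewrite /interp_piece /piece /stencil.
have ne i k : (i < k <= m)%N -> t i != t k.
  by move=> ik; rewrite lt_eqF// (increasing_lt ht).
case: eqP => [m1|/eqP m1].
  by rewrite lagrange1// ne// m1.
have m2 : (2 <= m)%N by lia.
case: ifP => jm'.
  by rewrite lagrange2// ne//; apply/andP; split; lia.
rewrite subn2 lagrange2// ne//; apply/andP; split; lia.
Qed.

Lemma interpolantE t U m j s : t 0%N = 0 -> increasing_to t m -> (j < m)%N ->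
  t j < s <= t j.+1 -> interpolant t m U s = piece t U m j s.
Proof.
move=> t0 ht jm /andP[js sj]; rewrite /interpolant.
have -> : (s <= t 0%N) = false.
  apply/negbTE; rewrite -ltNge; apply: le_lt_trans js.
  by apply: (increasing_le ht); lia.
rewrite big_mkcond /= (bigD1_seq j.+1)/=; first last.
- exact: iota_uniq.
- by rewrite mem_index_iota; lia.
rewrite js sj /= interp_pieceE// big1_seq ?addr0// => i /andP[ij].
rewrite mem_index_iota => im; case: ifP => // /andP[h1 h2]; exfalso.
have [h|h|h] := ltngtP i j.+1; last by rewrite h eqxx in ij.
- have : t i <= t j by apply: (increasing_le ht); lia.
  lra.
- have : t j.+1 <= t i.-1 by apply: (increasing_le ht); lia.
  lra.
Qed.

Lemma is_derive_ext (f g : R -> R) s df dg :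
  is_derive s (1:R) f df -> f =1 g -> df = dg -> is_derive s (1:R) g dg.
Proof. by move=> H /funext <- <-. Qed.

Lemma is_derive_quad t U a s : is_derive s (1:R) (quad t U a) (dquad t U a s).
Proof.
rewrite /quad.
have d (k : R) : is_derive s (1:R) (fun s => s - k) 1.
  by have := is_deriveB (is_derive_id s 1) (is_derive_cst k s 1); rewrite subr0.
have d1 := is_deriveZ (dd1 t U a) (d (t a)).
have d2 := is_deriveZ (dd2 t U a) (is_deriveM (d (t a)) (d (t a.+1))).
apply: (is_derive_ext (is_deriveD (is_deriveD (is_derive_cst (U a) s 1) d1) d2)) => //.
by rewrite /dquad /GRing.scale /=; ring.
Qed.

Lemma is_derive_dquad t U a s : is_derive s (1:R) (dquad t U a) (2 * dd2 t U a).
Proof.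
have d : is_derive s (1:R) (fun s : R => 2 * s - t a - t a.+1) 2.
  apply: (is_derive_ext (is_deriveB (is_deriveB (is_deriveZ 2 (is_derive_id s 1))
    (is_derive_cst (t a) s 1)) (is_derive_cst (t a.+1) s 1))) => //.
  by rewrite /GRing.scale /=; ring.
apply: (is_derive_ext (is_deriveD (is_derive_cst (dd1 t U a) s 1)
  (is_deriveZ (dd2 t U a) d))) => //.
by rewrite /GRing.scale /=; ring.
Qed.

Lemma is_derive_piece t U m j s : is_derive s (1:R) (piece t U m j) (dpiece t U m j s).
Proof.
rewrite /dpiece; case: ifPn => [/eqP m1|m1].
  have -> : piece t U m j = fun s => U 0%N + dd1 t U 0 * (s - t 0%N).
    by apply/funext => x; rewrite /piece m1 eqxx.
  apply: (is_derive_ext (is_deriveD (is_derive_cst (U 0%N) s 1) (is_deriveZ (dd1 t U 0)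
    (is_deriveB (is_derive_id s 1) (is_derive_cst (t 0%N) s 1))))) => //.
  by rewrite /GRing.scale /=; ring.
have -> : piece t U m j = quad t U (stencil m j).
  by apply/funext => x; rewrite /piece (negbTE m1).
exact: is_derive_quad.
Qed.

Lemma is_derive_dpiece t U m j s : is_derive s (1:R) (dpiece t U m j) (ddpiece t U m j).
Proof.
rewrite /ddpiece; case: ifPn => [/eqP m1|m1].
  have -> : dpiece t U m j = cst (dd1 t U 0).
    by apply/funext => x; rewrite /dpiece m1 eqxx.
  exact: is_derive_cst.
have -> : dpiece t U m j = dquad t U (stencil m j).
  by apply/funext => x; rewrite /dpiece (negbTE m1).
exact: is_derive_dquad.
Qed.

Lemma dpieceE t U m j s s0 :
  dpiece t U m j s = dpiece t U m j s0 - ddpiece t U m j * (s0 - s).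
Proof.
rewrite /dpiece /ddpiece; case: ifP => _; first by ring.
by rewrite /dquad; ring.
Qed.

Lemma is_derive_continuous (f : R -> R) df s :
  is_derive s (1:R) f df -> {for s, continuous f}.
Proof.
by move=> [d _]; apply: differentiable_continuous; exact/derivable1_diffP.
Qed.

Lemma prim_everywhere (f f' f'' : R -> R) a b :
  (forall s, is_derive s (1:R) f (f' s)) -> (forall s, is_derive s (1:R) f' (f'' s)) ->
  prim f f' a b.
Proof.
move=> df df'; split.
- by apply: continuous_subspaceT => s; exact: is_derive_continuous (df s).
- by move=> s _.
- by move=> s _; exact: is_derive_continuous (df' s).
Qed.

Lemma prim_piece t U m j a b : prim (piece t U m j) (dpiece t U m j) a b.
Proof.
apply: (@prim_everywhere _ _ (fun=> ddpiece t U m j)) => s.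
  exact: is_derive_piece.
exact: is_derive_dpiece.
Qed.

Lemma derive1_interpolant t U m j s : t 0%N = 0 -> increasing_to t m -> (j < m)%N ->
  s \in `]t j, t j.+1[%R -> derive1 (interpolant t m U) s = dpiece t U m j s.
Proof.
move=> t0 ht jm sj; rewrite derive1E.
have /near_eq_is_derive/(_ (is_derive_piece t U m j s)) [_ ->//] :
    \near s, piece t U m j s = interpolant t m U s.
move: (near_in_itvoo sj); apply: filterS => y; rewrite in_itv/= => /andP[? ?].
by apply/esym; apply: interpolantE => //; apply/andP; split => //; exact: ltW.
Qed.

(** The derivative of [w] is prescribed inside the cells; the nodes are negligible for the
    integral. *)
Lemma caputo_cells al t m (w : R -> R) (x : nat -> R -> R) :
  t 0%N = 0 -> increasing_to t m ->
  (forall j, (j < m)%N -> {in `]t j, t j.+1[%R, derive1 w =1 x j}) ->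
  (forall j, (j < m)%N -> wintegrable al (t m) (t j) (t j.+1) (x j)) ->
  caputo al w (t m) =
  (Gamma (1 - al))^-1 * \sum_(0 <= j < m) wint al (t m) (t j) (t j.+1) (x j).
Proof.
move=> t0 ht wx ix; rewrite /caputo; congr (_ * _).
pose f s := (t m - s) `^ (- al) * derive1 w s.
have fx j : (j < m)%N -> {in `]t j, t j.+1[%classic,
   (fun s => (t m - s) `^ (- al) * x j s) =1 f}.
  by move=> jm s /set_mem sj; rewrite /f (wx j jm).
suff H n : (n <= m)%N -> mu.-integrable `]0, t n[ (EFin \o f) /\
    \int[mu]_(s in `]0, t n[) f s =
    \sum_(0 <= j < n) wint al (t m) (t j) (t j.+1) (x j).
  by have [] := H m (leqnn m).
elim: n => [_|n IH nm].
  rewrite t0 big_geq// set_itvoo0 ?lexx// Rintegral_set0; split => //.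
  exact: integrable_set0.
have [i1 E1] := IH (ltnW nm).
have i2 : mu.-integrable `]t n, t n.+1[ (EFin \o f).
  apply: eq_integrable (ix n nm) => // s sn /=.
  by rewrite -(fx n nm).
have t0n : 0 <= t n by rewrite -t0; apply: (increasing_le ht); lia.
have [i3 E3] := int_split t0n (ht n nm) i1 i2.
split=> //; rewrite E3 big_nat_recr//= E1; congr (_ + _).
by rewrite /wint; apply: eq_Rintegral => s sn; exact/esym/(fx n nm).
Qed.

(** Integral over (a, b) of the kernel times P - Q (T - s): expanded in powers of T - s, both terms
    are pure powers. *)
Definition waff al T a b (P Q : R) : R :=
  P * (((T - a) `^ (1 - al) - (T - b) `^ (1 - al)) / (1 - al))
  - Q * (((T - a) `^ (2 - al) - (T - b) `^ (2 - al)) / (2 - al)).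

Lemma wint_affine al T a b P Q : al < 1 -> a < b -> b <= T ->
  wintegrable al T a b (fun s => P - Q * (T - s)) /\
  wint al T a b (fun s => P - Q * (T - s)) = waff al T a b P Q.
Proof.
move=> al1 ab bT; have p0 : 0 < 2 - al by lra.
have pl : prim (fun s => T - s) (fun s => 0 - 1) a b.
  exact: primB (prim_cst T a b) (prim_lin a b).
have p2 : prim (fun s => (T - s) `^ (2 - al))
   (fun s => (2 - al) * (T - s) `^ (2 - al - 1) * (0 - 1)) a b.
  by apply: prim_powR_comp => // s; rewrite in_itv/= => /andP[? ?]; lra.
have pF := primD (primZ P (prim_weight a al1 bT)) (primZ (Q / (2 - al)) p2).
have ab1 : 1 - al != 0 by rewrite subr_eq0 gt_eqF.
have ab2 : 2 - al != 0 by rewrite gt_eqF.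
have mulK s : s < T -> (T - s) `^ (2 - al - 1) = (T - s) `^ (- al) * (T - s).
  move=> sT; rewrite -{3}[T - s]powRr1 ?subr_ge0 ?(ltW sT)//.
  by rewrite -powR_add ?subr_gt0//; congr (_ `^ _); ring.
have /(prim_eq (fun s _ => erefl)) pF' : {in `]a, b[%R,
   (fun s => P * (T - s) `^ (- al) +
      Q / (2 - al) * ((2 - al) * (T - s) `^ (2 - al - 1) * (0 - 1))) =1
   (fun s => (T - s) `^ (- al) * (P - Q * (T - s)))}.
  move=> s; rewrite in_itv/= => /andP[_ sb].
  by rewrite mulK ?(lt_le_trans sb)//; field.
have pF2 := pF' _ pF.
have [|] := prim_dom ab pF2 (primZ (`|P| + `|Q| * (T - a)) (prim_weight a al1 bT)).
  move=> s; rewrite in_itv/= => /andP[sa sb].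
  rewrite normrM (ger0_norm (powR_ge0 _ _)) mulrC ler_wpM2r ?powR_ge0//.
  apply: le_trans (ler_normB _ _) _; rewrite lerD2l normrM ler_wpM2l//.
  by rewrite ger0_norm; lra.
move=> i1 E1; split=> //; rewrite /wint E1 /waff; field.
by rewrite ab1 ab2.
Qed.

(** A closed form in the divided differences of [U]: linearity of [delta] and its dependence on U 0,
    ..., U m alone become algebra, free of integrability conditions. *)
Lemma delta_waff al t U m : al < 1 -> t 0%N = 0 -> increasing_to t m ->
  delta al t U m = (Gamma (1 - al))^-1 * \sum_(0 <= j < m)
     waff al (t m) (t j) (t j.+1) (dpiece t U m j (t m)) (ddpiece t U m j).
Proof.
move=> al1 t0 ht; rewrite /delta.
rewrite (@caputo_cells _ _ _ _ (fun j s =>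
  dpiece t U m j (t m) - ddpiece t U m j * (t m - s)) t0 ht).
- congr (_ * _); apply: eq_big_nat => j /andP[_ jm].
  rewrite (proj2 (wint_affine _ _ al1 (ht j jm) _))//.
  by apply: (increasing_le ht); rewrite jm leqnn.
- move=> j jm s sj; rewrite (derive1_interpolant U t0 ht jm sj).
  exact: dpieceE.
- move=> j jm; apply: (proj1 (wint_affine _ _ al1 (ht j jm) _)).
  by apply: (increasing_le ht); rewrite jm leqnn.
Qed.

Lemma delta_wint al t U m : al < 1 -> t 0%N = 0 -> increasing_to t m ->
  delta al t U m = (Gamma (1 - al))^-1 * \sum_(0 <= j < m)
     wint al (t m) (t j) (t j.+1) (dpiece t U m j).
Proof.
move=> al1 t0 ht; rewrite delta_waff//; congr (_ * _).
apply: eq_big_nat => j /andP[_ jm].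
have tj : t j.+1 <= t m by apply: (increasing_le ht); rewrite jm leqnn.
rewrite -(proj2 (wint_affine _ _ al1 (ht j jm) tj)); congr wint.
by apply/funext => s; rewrite -dpieceE.
Qed.

Lemma dd1D t U V a : dd1 t (fun j => U j + V j) a = dd1 t U a + dd1 t V a.
Proof. by rewrite /dd1; ring. Qed.

Lemma dd2D t U V a : dd2 t (fun j => U j + V j) a = dd2 t U a + dd2 t V a.
Proof. by rewrite /dd2 !dd1D; ring. Qed.

Lemma dd1Z t k U a : dd1 t (fun j => k * U j) a = k * dd1 t U a.
Proof. by rewrite /dd1; ring. Qed.

Lemma dd2Z t k U a : dd2 t (fun j => k * U j) a = k * dd2 t U a.
Proof. by rewrite /dd2 !dd1Z; ring. Qed.

Lemma deltaD al t U V m : al < 1 -> t 0%N = 0 -> increasing_to t m ->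
  delta al t (fun j => U j + V j) m = delta al t U m + delta al t V m.
Proof.
move=> al1 t0 ht; rewrite !delta_waff// -mulrDr -big_split /=; congr (_ * _).
apply: eq_bigr => j _; rewrite /dpiece /ddpiece /waff /dquad.
by case: ifP => _; rewrite ?dd1D ?dd2D; ring.
Qed.

Lemma deltaZ al t k U m : al < 1 -> t 0%N = 0 -> increasing_to t m ->
  delta al t (fun j => k * U j) m = k * delta al t U m.
Proof.
move=> al1 t0 ht; rewrite !delta_waff// mulrCA; congr (_ * _).
rewrite mulr_sumr.
apply: eq_bigr => j _; rewrite /dpiece /ddpiece /waff /dquad.
by case: ifP => _; rewrite ?dd1Z ?dd2Z; ring.
Qed.

Lemma delta0 al t m : al < 1 -> t 0%N = 0 -> increasing_to t m ->
  delta al t (fun=> 0) m = 0.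
Proof.
move=> al1 t0 ht; transitivity (delta al t (fun=> 0 * 0) m).
  by congr (delta al t _ m); apply/funext => j; rewrite mul0r.
by rewrite (deltaZ 0 (fun=> 0) al1 t0 ht) mul0r.
Qed.

Lemma delta_sum al t m N (c : nat -> R) (B : nat -> nat -> R) :
  al < 1 -> t 0%N = 0 -> increasing_to t m ->
  delta al t (fun j => \sum_(0 <= n < N) c n * B n j) m =
  \sum_(0 <= n < N) c n * delta al t (B n) m.
Proof.
move=> al1 t0 ht; elim: N => [|N IH].
  rewrite big_geq// -[RHS](delta0 al1 t0 ht); congr (delta al t _ m).
  by apply/funext => j; rewrite big_geq.
transitivity (delta al t (fun j => \sum_(0 <= n < N) c n * B n j + c N * B N j) m).
  by congr (delta al t _ m); apply/funext => j; rewrite big_nat_recr.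
rewrite (deltaD _ (fun j => c N * B N j) al1 t0 ht) (deltaZ (c N) (B N) al1 t0 ht).
by rewrite IH big_nat_recr.
Qed.

Lemma eq_delta al t U V m : al < 1 -> t 0%N = 0 -> increasing_to t m ->
  (forall j, (j <= m)%N -> U j = V j) -> delta al t U m = delta al t V m.
Proof.
move=> al1 t0 ht UV; rewrite !delta_waff//; congr (_ * _).
apply: eq_big_nat => j /andP[_ jm].
have E1 a : (a.+1 <= m)%N -> dd1 t U a = dd1 t V a.
  by move=> am; rewrite /dd1 !UV// ltnW.
have E2 a : (a.+2 <= m)%N -> dd2 t U a = dd2 t V a.
  by move=> am; rewrite /dd2 !E1// ltnW.
rewrite /dpiece /ddpiece /dquad; case: ifPn => m1; first by rewrite E1//; lia.
have sm : ((stencil m j).+2 <= m)%N by rewrite /stencil; case: ifP; lia.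
by rewrite E1 ?E2//; apply: leq_trans sm.
Qed.

End Cells.

(** * Interpolation error *)
Section InterpolationError.
Variable R : realType.
Implicit Types (t U : nat -> R) (al s x y G p : R) (f w : R -> R) (m j n : nat).

Lemma MVT_bound f f' a b G x y : {in `]a, b[%R, forall s, is_derive s (1:R) f (f' s)} ->
  {in `]a, b[%R, forall s, `|f' s| <= G} -> x \in `]a, b[%R -> y \in `]a, b[%R ->
  `|f x - f y| <= G * `|x - y|.
Proof.
move=> df fG; wlog xy : x y / x <= y => [H|] xab yab.
  have [xy|/ltW yx] := leP x y; first exact: H.
  by rewrite distrC [`|x - y|]distrC; exact: H.
move: xab yab; rewrite !in_itv/= => /andP[ax xb] /andP[ay yb].
have sub s : x <= s -> s <= y -> s \in `]a, b[%R.
  by move=> xs sy; rewrite in_itv/= (lt_le_trans ax xs) (le_lt_trans sy yb).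
have cf : {within `[x, y], continuous f}.
  apply: derivable_within_continuous => s; rewrite in_itv/= => /andP[xs sy].
  by have := df s (sub s xs sy) => -[].
have dxy s : s \in `]x, y[%R -> is_derive s (1:R) f (f' s).
  by rewrite in_itv/= => /andP[xs sy]; apply/df/sub; exact: ltW.
have [c cxy E] := MVT_segment xy dxy cf.
rewrite distrC E normrM [`|x - y|]distrC ler_wpM2r//; apply: fG.
by move: cxy; rewrite in_itv/= => /andP[? ?]; exact: sub.
Qed.

(** By the mean value theorem the slope is itself a value of [w1]. *)
Lemma linear_interp_error t U w w1 w2 G : t 0%N < t 1%N ->
  {within `[t 0%N, t 1%N], continuous w} -> w (t 0%N) = U 0%N -> w (t 1%N) = U 1%N ->
  {in `]t 0%N, t 1%N[%R, forall s, is_derive s (1:R) w (w1 s)} ->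
  {in `]t 0%N, t 1%N[%R, forall s, is_derive s (1:R) w1 (w2 s)} ->
  {in `]t 0%N, t 1%N[%R, forall s, `|w2 s| <= G} ->
  {in `]t 0%N, t 1%N[%R, forall s, `|w1 s - dd1 t U 0| <= (t 1%N - t 0%N) * G}.
Proof.
move=> t01 cw E0 E1 d1 d2 wG s st; have [c ct E] := MVT t01 d1 cw.
have -> : dd1 t U 0 = w1 c.
  by rewrite /dd1 -E0 -E1 E mulfK// gt_eqF// subr_gt0.
apply: le_trans (MVT_bound d2 wG st ct) _; rewrite mulrC ler_wpM2r//.
  by apply: le_trans (wG c ct).
by move: st ct; rewrite !in_itv/= ler_norml => /andP[? ?] /andP[? ?]; lra.
Qed.

Section QuadraticInterpolation.
Variables (t U : nat -> R) (a : nat) (w w1 w2 : R -> R).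
Hypotheses (t01 : t a < t a.+1) (t12 : t a.+1 < t a.+2).
Hypotheses (cw : {within `[t a, t a.+2], continuous w}).
Hypothesis (wU : forall i, (i <= 2)%N -> w (t (a + i)%N) = U (a + i)%N).
Let I := `]t a, t a.+2[%R.
Hypothesis (d1 : {in I, forall s, is_derive s (1:R) w (w1 s)}).
Hypothesis (d2 : {in I, forall s, is_derive s (1:R) w1 (w2 s)}).

Let t02 : t a < t a.+2. Proof. exact: lt_trans t12. Qed.

Lemma quad_nodes i : (i <= 2)%N -> quad t U a (t (a + i)%N) = U (a + i)%N.
Proof.
case: i => [|[|[|//]]] _; rewrite /quad ?addn0 ?addn1 ?addn2.
- by rewrite subrr !mul0r !mulr0 !addr0.
- rewrite /dd1 subrr !mulr0 addr0; field; rewrite subr_eq0 gt_eqF//.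
- by rewrite /dd2 /dd1; field; rewrite !subr_eq0 !gt_eqF.
Qed.

Let E i : (i <= 2)%N -> w (t (a + i)%N) - quad t U a (t (a + i)%N) = 0.
Proof. by move=> i2; rewrite wU// quad_nodes// subrr. Qed.

Let dchi s : s \in I -> is_derive s (1:R) (fun s => w s - quad t U a s)
  (w1 s - dquad t U a s).
Proof. by move=> /d1 ?; have := is_derive_quad t U a s => ?; exact: is_deriveB. Qed.

Let dchi1 s : s \in I -> is_derive s (1:R) (fun s => w1 s - dquad t U a s)
  (w2 s - 2 * dd2 t U a).
Proof. by move=> /d2 ?; have := is_derive_dquad t U a s => ?; exact: is_deriveB. Qed.

Let cchi : {within `[t a, t a.+2], continuous (fun s => w s - quad t U a s)}.
Proof.
have [cq _ _] := prim_everywhere (t a) (t a.+2) (is_derive_quad t U a) (is_derive_dquad t U a).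
by move=> x; apply: cvgB; [exact: cw|exact: cq].
Qed.

Let zero i : (i < 2)%N -> exists2 c, c \in `]t (a + i)%N, t (a + i).+1[%R &
  w1 c = dquad t U a c.
Proof.
move=> i2.
have le0 : t a <= t (a + i)%N by case: i i2 => [|[|//]] _; rewrite ?addn0 ?addn1// ltW.
have le2 : t (a + i).+1 <= t a.+2.
  by case: i i2 {le0} => [|[|//]] _; rewrite ?addn0 ?addn1// ltW.
have lti : t (a + i)%N < t (a + i).+1.
  by case: i i2 {le0 le2} => [|[|//]] _; rewrite ?addn0 ?addn1.
have [s si||c ci Ec] := @MVT _ (fun s => w s - quad t U a s)
    (fun s => w1 s - dquad t U a s) _ _ lti.
- by apply: dchi; move: si; rewrite !in_itv/= => /andP[? ?]; apply/andP; split; lra.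
- apply: continuous_subspaceW cchi => s /=; rewrite !in_itv/= => /andP[? ?].
  by apply/andP; split; lra.
exists c => //; apply/eqP; rewrite -subr_eq0.
move: Ec; rewrite (E (ltnW i2)) -addnS (E i2) subr0 addnS => /esym/eqP.
by rewrite mulf_eq0 [X in _ || X]gt_eqF ?orbF// subr_gt0.
Qed.

(** Rolle's argument: [w - quad] vanishes at three nodes, so its derivative vanishes in both cells
    and its second derivative in between. *)
Lemma quad_interp_zeros :
  (exists2 c, c \in I & w1 c = dquad t U a c) /\
  (exists2 c, c \in I & w2 c = 2 * dd2 t U a).
Proof.
have [c1 /[!in_itv]/= /andP[l1 r1] z1] := zero (isT : (0 < 2)%N).
have [c2 /[!in_itv]/= /andP[l2 r2] z2] := zero (isT : (1 < 2)%N).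
rewrite !(addn0, addn1) in l1 r1 l2 r2.
split; first by exists c1 => //; rewrite in_itv/= l1/=; lra.
have c12 : c1 < c2 by lra.
have sub s : c1 <= s -> s <= c2 -> s \in I.
  by move=> ? ?; rewrite in_itv/=; apply/andP; split; lra.
have [s sc||c /[!in_itv]/= /andP[? ?] Ec] := @MVT _ (fun s => w1 s - dquad t U a s)
    (fun s => w2 s - 2 * dd2 t U a) _ _ c12.
- by apply: dchi1; move: sc; rewrite !in_itv/= => /andP[? ?]; apply: sub; exact: ltW.
- apply: derivable_within_continuous => s; rewrite in_itv/= => /andP[? ?].
  by have := dchi1 (sub s _ _) => -[].
exists c; first by apply: sub; exact: ltW.
apply/eqP; rewrite -subr_eq0; move: Ec; rewrite z1 z2 !subrr => /esym/eqP.
by rewrite mulf_eq0 [X in _ || X]gt_eqF ?orbF// subr_gt0.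
Qed.

(** [2 * dd2] is a value of [w2], hence the factor 2 in front of [G]. *)
Lemma quad_interp_error2 G : {in I, forall s, `|w2 s| <= G} ->
  {in I, forall s, `|w1 s - dquad t U a s| <= (t a.+2 - t a) * (2 * G)}.
Proof.
move=> wG s sI; have [[c1 c1I z1] [c3 c3I z3]] := quad_interp_zeros.
have := MVT_bound dchi1 _ sI c1I; rewrite z1 subrr subr0 => H.
apply: (le_trans (H (2 * G) _)).
  move=> x xI; apply: le_trans (ler_normB _ _) _; rewrite -z3.
  by have := wG x xI; have := wG c3 c3I; lra.
rewrite mulrC ler_wpM2r//.
  by have := wG s sI; have := normr_ge0 (w2 s); lra.
by move: sI c1I; rewrite !in_itv/= ler_norml => /andP[? ?] /andP[? ?]; lra.
Qed.

Lemma quad_interp_error3 (w3 : R -> R) G :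
  {in I, forall s, is_derive s (1:R) w2 (w3 s)} ->
  {in I, forall s, `|w3 s| <= G} ->
  {in I, forall s, `|w1 s - dquad t U a s| <= (t a.+2 - t a) ^+ 2 * G}.
Proof.
move=> d3 wG s sI; have [[c1 c1I z1] [c3 c3I z3]] := quad_interp_zeros.
have G0 : 0 <= G by apply: le_trans (wG s sI).
have dist x y : x \in I -> y \in I -> `|x - y| <= t a.+2 - t a.
  by rewrite !in_itv/= ler_norml => /andP[? ?] /andP[? ?]; lra.
have := MVT_bound dchi1 _ sI c1I; rewrite z1 subrr subr0 => H.
apply: (le_trans (H ((t a.+2 - t a) * G) _)).
  move=> x xI; rewrite -z3; apply: le_trans (MVT_bound d3 wG xI c3I) _.
  by rewrite mulrC ler_wpM2r// dist.
rewrite expr2 mulrAC ler_wpM2r//.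
by rewrite ler_wpM2l ?dist// subr_ge0 ltW.
Qed.

End QuadraticInterpolation.

(** With L the width of the stencil, the slope gives p, and the second difference at most 2 p / L
    times a factor of size at most 2 L. *)
Lemma dquad_bound t U a s p : t a < t a.+1 -> t a.+1 < t a.+2 ->
  t a <= s <= t a.+2 -> `|dd1 t U a| <= p -> `|dd1 t U a.+1| <= p ->
  `|dquad t U a s| <= 5 * p.
Proof.
move=> h01 h12 /andP[s0 s2] b0 b1; have p0 : 0 <= p by apply: le_trans b0.
have L0 : 0 < t a.+2 - t a by rewrite subr_gt0 (lt_trans h01).
rewrite /dquad; apply: le_trans (ler_normD _ _) _.
have -> : 5 * p = p + 4 * p by ring.
apply: lerD => //.
rewrite /dd2 -mulrA normrM mulrC normrM normfV (gtr0_norm L0).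
rewrite -mulrA ler_pdivrMl//.
have n1 : `|dd1 t U a.+1 - dd1 t U a| <= 2 * p.
  by apply: le_trans (ler_normB _ _) _; lra.
have n2 : `|2 * s - t a - t a.+1| <= 2 * (t a.+2 - t a).
  by rewrite ler_norml; apply/andP; split; lra.
apply: le_trans (ler_pM _ _ n2 n1) _ => //.
by rewrite le_eqVlt; apply/orP; left; apply/eqP; ring.
Qed.

Lemma stencil_cell t m j : increasing_to t m -> (j < m)%N -> m != 1%N ->
  [/\ ((stencil m j).+2 <= m)%N, t (stencil m j) <= t j, t j.+1 <= t (stencil m j).+2,
     t (stencil m j) < t (stencil m j).+1 & t (stencil m j).+1 < t (stencil m j).+2].
Proof.
move=> ht jm m1; rewrite /stencil; case: ifPn => h; split; try lia.
- by [].
- by apply: ltW; apply: ht; lia.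
- by apply: ht; lia.
- by apply: ht; lia.
- by apply: (increasing_le ht); lia.
- by apply: (increasing_le ht); lia.
- by apply: ht; lia.
- by apply: ht; lia.
Qed.

Lemma dpiece_bound t U m j s p : increasing_to t m -> (j < m)%N ->
  t j <= s <= t j.+1 -> (forall i, (i < m)%N -> `|dd1 t U i| <= p) ->
  `|dpiece t U m j s| <= 5 * p.
Proof.
move=> ht jm /andP[s0 s1] bp; rewrite /dpiece; case: ifPn => m1.
  have p0 := le_trans (normr_ge0 _) (bp j jm).
  by have := bp 0%N (leq_trans (ltn0Sn _) jm); lra.
have [sm h1 h2 h3 h4] := stencil_cell ht jm m1.
apply: dquad_bound => //; [|by apply: bp; lia|by apply: bp; lia].
by apply/andP; split; lra.
Qed.

(** This includes the last cell, whose stencil starts one node earlier. The derivative of an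
    interpolation error therefore has mean zero on every cell. *)
Lemma piece_nodes t U m j : increasing_to t m -> (j < m)%N ->
  piece t U m j (t j) = U j /\ piece t U m j (t j.+1) = U j.+1.
Proof.
move=> ht jm; rewrite /piece; case: ifPn => m1.
  have j0 : j = 0%N by move/eqP: m1; lia.
  rewrite j0 subrr mulr0 addr0; split=> //; rewrite /dd1 divfK ?subrKC//.
  by rewrite subr_eq0 gt_eqF//; apply: ht; move/eqP: m1 => ->.
have [sm h1 h2 h3 h4] := stencil_cell ht jm m1.
have Q := quad_nodes U h3 h4; move: Q.
rewrite /stencil; case: ifPn => jm' Q.
  split; first by have := Q 0%N isT; rewrite addn0.
  by have := Q 1%N isT; rewrite addn1.
have E1 : j = (m.-2 + 1)%N by move/eqP: m1; lia.
have E2 : j.+1 = (m.-2 + 2)%N by move/eqP: m1; lia.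
by split; [rewrite E1; apply: Q|rewrite E2; apply: Q].
Qed.

End InterpolationError.

(** * Truncation error on quasi-graded meshes *)
Section TruncationSum.
Variable R : realType.
Implicit Types (t U D : nat -> R) (al s x y p A C T a b c q : R) (m j n : nat).

(* Quasi-graded meshes, with the grading exponent rho = 1/r. *)
Definition qmesh C rho (M : nat) t : Prop :=
  [/\ t 0%N = 0, increasing_to t M,
      forall j, (j.+1 < M)%N -> t j.+1 - t j <= t j.+2 - t j.+1 <= C * (t j.+1 - t j) &
      forall j, (j < M)%N -> t j.+1 - t j <= C * (t j.+1 `^ (1 - rho) * t 1%N `^ rho)].

Lemma is_derive_rsub T s : is_derive s (1:R) (fun s => T - s) (-1).
Proof.
by apply: (is_derive_ext (is_deriveB (is_derive_cst T s 1) (is_derive_id s 1))); rewrite ?sub0r.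
Qed.

Lemma is_derive_addr (c : R) s : is_derive s (1:R) (fun s => s + c) 1.
Proof.
by apply: (is_derive_ext (is_deriveD (is_derive_id s 1) (is_derive_cst c s 1))); rewrite ?addr0.
Qed.

Lemma weight_mono al T a b : 0 < al -> a <= b -> b < T ->
  (T - a) `^ (- al) <= (T - b) `^ (- al).
Proof. by move=> al0 ab bt; apply: powR_ge_base; lra. Qed.

(** The kernel is smooth at distance T / 2 from its singularity; 4 bounds 2^(al + 1). *)
Lemma weight_diff al T a b : 0 < al < 1 -> 0 <= a -> a < b -> b <= T / 2 ->
  (T - b) `^ (- al) - (T - a) `^ (- al) <= 4 * ((b - a) * T `^ (- al - 1)).
Proof.
move=> /andP[al0 al1] a0 ab bT.
have T0 : 0 < T by lra.
have d s : s < T -> is_derive s (1:R) (fun s => (T - s) `^ (- al))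
    (- al * (T - s) `^ (- al - 1) * -1).
  move=> sT; apply: is_derive_powR_comp; first by rewrite subr_gt0.
  exact: is_derive_rsub.
have dab s : s \in `]a, b[%R -> is_derive s (1:R) (fun s => (T - s) `^ (- al))
    (- al * (T - s) `^ (- al - 1) * -1).
  by rewrite in_itv/= => /andP[? ?]; apply: d; lra.
have cab : {within `[a, b], continuous (fun s => (T - s) `^ (- al))}.
  apply: derivable_within_continuous => s; rewrite in_itv/= => /andP[? ?].
  by have [] := d s ltac:(lra).
have [c /[!in_itv]/= /andP[ac cb] ->] := MVT ab dab cab.
have -> : - al * (T - c) `^ (- al - 1) * -1 * (b - a) =
  (b - a) * (al * (T - c) `^ (- al - 1)) by ring.
rewrite [leRHS]mulrCA.
rewrite ler_wpM2l ?subr_ge0 ?(ltW ab)//.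
have h : (T - c) `^ (- al - 1) <= 4 * T `^ (- al - 1).
  apply: (@le_trans _ _ ((T / 2) `^ (- al - 1))); first by apply: powR_ge_base; lra.
  rewrite powR_div ?(ltW T0)// mulrC ler_wpM2r ?powR_ge0//.
  have -> : (4 : R) = 2 `^ 2 by rewrite -[2 in RHS]/(2%:R) powR_mulrn// -natrX.
  by apply: ler_powR; [rewrite ler1n|lra].
by apply: le_trans h; rewrite ler_piMl ?powR_ge0// ltW.
Qed.

(** Oscillation of the kernel over cell j; meaningful for [j.+1 < m], since the kernel is singular
    at [t m]. *)
Definition wjump al t m j : R := (t m - t j.+1) `^ (- al) - (t m - t j) `^ (- al).

(** In the first half of (0, t_{n+1}) the kernel is smooth and oscillates by O(step * t_{n+1}^(-al -
    1)) on a cell. In the second half the oscillations telescope to at most the kernel one step away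
    from its singularity, so a uniform bound [Dn] suffices there. *)
Lemma history_near al t n D Dn : 0 < al < 1 -> t 0%N = 0 -> increasing_to t n.+1 ->
  0 <= Dn -> (forall j, (j < n)%N -> 0 <= D j) ->
  (forall j, (j < n)%N -> t n.+1 / 2 < t j.+1 -> D j <= Dn) ->
  \sum_(0 <= j < n) wjump al t n.+1 j * D j <=
  4 * (t n.+1 `^ (- al - 1) * \sum_(0 <= j < n) (t j.+1 - t j) * D j)
  + (t n.+1 - t n) `^ (- al) * Dn.
Proof.
move=> al01 t0 ht Dn0 D0 Dnear; have /andP[al0 al1] := al01.
have tp j : (0 < j <= n.+1)%N -> 0 < t j.
  by move=> jn; rewrite -t0; apply: (increasing_lt ht); lia.
have wj0 j : (j < n)%N -> 0 <= wjump al t n.+1 j.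
  move=> jn; rewrite subr_ge0; apply: weight_mono => //.
    by apply: ltW; apply: ht; lia.
  by apply: (increasing_lt ht); lia.
have tele : \sum_(0 <= j < n) wjump al t n.+1 j <= (t n.+1 - t n) `^ (- al).
  rewrite /wjump telescope_sumr// t0 subr0 lerBlDr lerDl; exact: powR_ge0.
apply: (@le_trans _ _ (\sum_(0 <= j < n)
   (4 * (t n.+1 `^ (- al - 1) * ((t j.+1 - t j) * D j)) + wjump al t n.+1 j * Dn))).
  rewrite big_nat [leRHS]big_nat; apply: ler_sum => j /andP[_ jn].
  have hj : t j < t j.+1 by apply: ht; lia.
  have Tw := powR_ge0 (t n.+1) (- al - 1).
  have [far|near] := leP (t j.+1) (t n.+1 / 2).
    rewrite -[leLHS]addr0; apply: lerD; last by rewrite mulr_ge0// wj0.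
    have tj0 : 0 <= t j by rewrite -t0; apply: (increasing_le ht); lia.
    apply: le_trans (ler_wpM2r (D0 j jn) (weight_diff al01 tj0 hj far)) _.
    by rewrite le_eqVlt; apply/orP; left; apply/eqP; ring.
  rewrite -[leLHS]add0r; apply: lerD.
    by rewrite !mulr_ge0// ?D0// subr_ge0 ltW.
  by apply: ler_wpM2l; [exact: wj0|exact: Dnear].
rewrite big_split /= -!mulr_sumr -mulr_suml lerD2l.
by apply: ler_wpM2r.
Qed.

(** A Riemann sum of s^(p - 1) at right end points. If p < 1 the integrand decreases and each term
    is below its integral; if p >= 1 each term is at most the increment of t^p. The factor 1 + 1/p
    covers both. *)
Lemma sum_pow_ge0 t n p : 0 < p -> t 0%N = 0 -> increasing_to t n ->
  \sum_(0 <= j < n) (t j.+1 - t j) * t j.+1 `^ (p - 1) <= (1 + p^-1) * t n `^ p.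
Proof.
move=> p0 t0 ht.
have p1 : 1 <= 1 + p^-1 by rewrite lerDl invr_ge0 ltW.
have step j : (j < n)%N -> (t j.+1 - t j) * t j.+1 `^ (p - 1) <=
    (1 + p^-1) * (t j.+1 `^ p - t j `^ p).
  move=> jn; have hj := ht j jn.
  have tj : 0 <= t j by rewrite -t0; apply: (increasing_le ht); lia.
  have tj1 : 0 < t j.+1 by exact: le_lt_trans hj.
  have mono : t j `^ p <= t j.+1 `^ p.
    by apply: powR_le_base => //; exact: ltW.
  have tp := powR_ge0 (t j.+1) (p - 1).
  have [p1'|p1'] := leP 1 p.
    apply: (@le_trans _ _ (t j.+1 `^ p - t j `^ p)); last first.
      by rewrite ler_peMl// subr_ge0.
    rewrite mulrBl mulr_powRB1//; last exact: ltW.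
    rewrite lerD2l lerN2 -(mulr_powRB1 tj p0) ler_wpM2l//.
    by apply: powR_le_base; [lra| |exact: ltW].
  have pr := prim_powR (t j.+1) p0 tj.
  have [c /[!in_itv]/= /andP[c1 c2] E] : exists2 c, c \in `]t j, t j.+1[%R &
      p^-1 * t j.+1 `^ p - p^-1 * t j `^ p = c `^ (p - 1) * (t j.+1 - t j).
    by case: pr => cF dF _; exact: (MVT hj dF cF).
  apply: (@le_trans _ _ (p^-1 * (t j.+1 `^ p - t j `^ p))); last first.
    by apply: ler_wpM2r; rewrite ?subr_ge0// lerDr.
  rewrite mulrBr E mulrC; apply: ler_wpM2r; first lra.
  by apply: powR_ge_base; lra.
apply: (@le_trans _ _ (\sum_(0 <= j < n) (1 + p^-1) * (t j.+1 `^ p - t j `^ p))).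
  by rewrite big_nat [leRHS]big_nat; apply: ler_sum => j /andP[_]; exact: step.
rewrite -mulr_sumr telescope_sumr// t0 powR0 ?gt_eqF// subr0//.
Qed.

(** The integrand decreases, so each term is below the integral over its cell; the shift by c
    removes the singularity at 0. *)
Lemma sum_pow_lt0 t n q c : 0 < q -> 0 < c -> t 0%N = 0 -> increasing_to t n ->
  \sum_(0 <= j < n) (t j.+1 - t j) * (t j.+1 + c) `^ (- 1 - q) <= q^-1 * c `^ (- q).
Proof.
move=> q0 c0 t0 ht.
have step j : (j < n)%N -> (t j.+1 - t j) * (t j.+1 + c) `^ (- 1 - q) <=
    q^-1 * ((t j + c) `^ (- q) - (t j.+1 + c) `^ (- q)).
  move=> jn; have hj := ht j jn.
  have tj : 0 <= t j by rewrite -t0; apply: (increasing_le ht); lia.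
  have d s : 0 <= s -> is_derive s (1:R) (fun s => (s + c) `^ (- q))
      (- q * (s + c) `^ (- q - 1) * 1).
    move=> s0; apply: is_derive_powR_comp; first by rewrite ltr_wpDl.
    exact: is_derive_addr.
  have dab s : s \in `]t j, t j.+1[%R -> is_derive s (1:R) (fun s => (s + c) `^ (- q))
      (- q * (s + c) `^ (- q - 1) * 1).
    by rewrite in_itv/= => /andP[? ?]; apply: d; lra.
  have cab : {within `[t j, t j.+1], continuous (fun s => (s + c) `^ (- q))}.
    apply: derivable_within_continuous => s; rewrite in_itv/= => /andP[? ?].
    by have [] := d s ltac:(lra).
  have [e /[!in_itv]/= /andP[e1 e2] E] := MVT hj dab cab.
  rewrite ler_pdivlMl// -[leRHS]opprB E mulr1 !mulNr opprK -mulrA ler_wpM2l ?(ltW q0)//.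
  rewrite [leRHS]mulrC; apply: ler_wpM2l; first lra.
  by rewrite [- 1 - q]addrC; apply: powR_ge_base; lra.
apply: (@le_trans _ _ (\sum_(0 <= j < n)
    q^-1 * ((t j + c) `^ (- q) - (t j.+1 + c) `^ (- q)))).
  by rewrite big_nat [leRHS]big_nat; apply: ler_sum => j /andP[_]; exact: step.
rewrite -mulr_sumr; apply: ler_wpM2l; first by rewrite invr_ge0 ltW.
under eq_bigr do rewrite -opprB.
rewrite sumrN telescope_sumr// opprB t0 add0r lerBlDr lerDl.
exact: powR_ge0.
Qed.

End TruncationSum.

(** * Local errors summed over a quasi-graded mesh *)

Section QuasiGraded.
Variable R : realType.
Implicit Types (t U D : nat -> R) (al rho nu mu e s x y p A C T a b c q : R) (m j n M : nat).

Lemma powR_natr x p n : 0 <= x -> (x `^ p) ^+ n = x `^ (p * n%:R).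
Proof. by move=> x0; rewrite -powR_mulrn ?powR_ge0// powRrM. Qed.

Lemma qmesh_pos C rho M t j : qmesh C rho M t -> (0 < j <= M)%N -> 0 < t j.
Proof. by move=> [t0 ht _ _] jM; rewrite -t0; apply: (increasing_lt ht). Qed.

Lemma qmesh_ge1 C rho M t j : qmesh C rho M t -> (0 < j <= M)%N -> t 1%N <= t j.
Proof. by move=> [t0 ht _ _] jM; apply: (increasing_le ht). Qed.

Lemma qmesh_step C rho M t j c : qmesh C rho M t -> 0 <= C -> 0 < rho <= 1 -> 0 <= c ->
  (j < M)%N -> t j.+1 - t j <= C * ((t j.+1 + c) `^ (1 - rho) * t 1%N `^ rho).
Proof.
move=> qm C0 /andP[r0 r1] c0 jM; have [_ _ _ h] := qm.
have tj := qmesh_pos (j:=j.+1) qm jM.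
apply: le_trans (h j jM) _; rewrite ler_wpM2l// ler_wpM2r ?powR_ge0//.
by apply: powR_le_base; lra.
Qed.

Lemma step_le C rho M t i j : qmesh C rho M t -> (i <= j < M)%N ->
  t i.+1 - t i <= t j.+1 - t j.
Proof.
move=> [_ _ h _] /andP[]; elim: j => [|j IH]; first by rewrite leqn0 => /eqP ->.
rewrite leq_eqVlt ltnS => /predU1P[-> //|ij jM].
by apply: le_trans (IH ij (ltnW jM)) _; have /andP[] := h j jM.
Qed.

(** With x = t_{j+1} + c, the mesh condition bounds the cube of a step by C^3 x^(3 - 3 rho) t_1^(3
    rho). As t_1 <= x, the exponent 3 rho of t_1 may be lowered to nu. *)
Lemma cube_pow C rho M t j c e nu : qmesh C rho M t -> 0 <= C -> 0 < rho <= 1 ->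
  0 <= c -> (j < M)%N -> nu <= 3 * rho ->
  (t j.+1 - t j) ^+ 3 * (t j.+1 + c) `^ e <=
  C ^+ 3 * (t 1%N `^ nu * (t j.+1 + c) `^ (e + 3 - nu)).
Proof.
move=> qm C0 r01 c0 jM nu3; have /andP[r0 r1] := r01.
have [_ ht _ _] := qm.
have tj := qmesh_pos (j:=j.+1) qm jM; have t1j := qmesh_ge1 (j:=j.+1) qm jM.
have t1 : 0 < t 1%N by apply: (qmesh_pos qm); lia.
set x := t j.+1 + c; have x0 : 0 < x by rewrite /x; lra.
have hj : 0 <= t j.+1 - t j by rewrite subr_ge0; apply/ltW/ht.
have h3 : (t j.+1 - t j) ^+ 3 <= C ^+ 3 * (x `^ (3 - 3 * rho) * t 1%N `^ (3 * rho)).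
  have := qmesh_step qm C0 r01 c0 jM; rewrite -/x => h.
  apply: (@le_trans _ _ ((C * (x `^ (1 - rho) * t 1%N `^ rho)) ^+ 3)).
    by apply: lerXn2r => //; rewrite nnegrE ?mulr_ge0 ?powR_ge0.
  rewrite !exprMn !powR_natr ?(ltW x0) ?(ltW t1)// [rho * _]mulrC.
  by rewrite (_ : (1 - rho) * 3%:R = 3 - 3 * rho)//; ring.
apply: le_trans (ler_wpM2r (powR_ge0 x e) h3) _.
rewrite -[C ^+ 3 * _ * _]mulrA ler_wpM2l ?exprn_ge0//.
have E1 : t 1%N `^ (3 * rho) = t 1%N `^ nu * t 1%N `^ (3 * rho - nu).
  by rewrite -powR_add//; congr (_ `^ _); ring.
have E2 : x `^ (e + 3 - nu) = x `^ (3 * rho - nu) * (x `^ (3 - 3 * rho) * x `^ e).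
  by rewrite -!powR_add//; congr (_ `^ _); ring.
have le1 : t 1%N `^ (3 * rho - nu) <= x `^ (3 * rho - nu).
  by apply: powR_le_base; rewrite ?subr_ge0 /x; lra.
rewrite E1 E2 mulrCA -!mulrA ler_wpM2l ?powR_ge0// mulrCA.
by rewrite ler_wpM2r ?mulr_ge0 ?powR_ge0.
Qed.

Lemma last_pow C rho M t j c e al : qmesh C rho M t -> 0 <= C -> 0 < rho <= 1 ->
  0 <= c -> (j < M)%N -> al < 3 ->
  (t j.+1 - t j) `^ (3 - al) * (t j.+1 + c) `^ e <=
  C `^ (3 - al) * (t 1%N `^ ((3 - al) * rho) *
    (t j.+1 + c) `^ (e + (3 - al) - (3 - al) * rho)).
Proof.
move=> qm C0 r01 c0 jM al3; have /andP[r0 r1] := r01.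
have [_ ht _ _] := qm.
have tj := qmesh_pos (j:=j.+1) qm jM.
have t1 : 0 < t 1%N by apply: (qmesh_pos qm); lia.
set x := t j.+1 + c; have x0 : 0 < x by rewrite /x; lra.
have hj : 0 <= t j.+1 - t j by rewrite subr_ge0; apply/ltW/ht.
have := qmesh_step qm C0 r01 c0 jM; rewrite -/x => h.
have p0 : 0 <= 3 - al by lra.
apply: le_trans (ler_wpM2r (powR_ge0 x e) (powR_le_base p0 hj h)) _.
rewrite powRM ?mulr_ge0 ?powR_ge0// powRM ?powR_ge0// -!powRrM -!mulrA.
rewrite ler_wpM2l ?powR_ge0// mulrCA [rho * _]mulrC ler_wpM2l ?powR_ge0//.
rewrite -powR_add// le_eqVlt; apply/orP; left; apply/eqP; congr (_ `^ _); ring.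
Qed.

(** Steps do not decrease, and t_{j+1} + c exceeds half of t_{n+1} + c; the exponent is at least -4,
    whence 2^4. *)
Lemma near_pow C rho M t c e n j : qmesh C rho M t -> 0 <= c -> - 4 <= e -> e <= 0 ->
  (n < M)%N -> (j < n)%N -> t n.+1 / 2 < t j.+1 ->
  (t j.+1 - t j) ^+ 3 * (t j.+1 + c) `^ e <=
  16 * ((t n.+1 - t n) ^+ 3 * (t n.+1 + c) `^ e).
Proof.
move=> qm c0 e4 e0 nM jn near; have [_ ht _ _] := qm.
have tn := qmesh_pos (j:=n.+1) qm nM.
rewrite mulrCA; apply: ler_pM; rewrite ?powR_ge0 ?exprn_ge0 ?subr_ge0//.
- by apply: ltW; apply: ht; lia.
- have : t j < t j.+1 by apply: ht; lia.
  have := step_le (i:=j) (j:=n) qm ltac:(lia) => h1 h2.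
  by apply: lerXn2r => //; rewrite nnegrE; lra.
apply: (@le_trans _ _ (((t n.+1 + c) / 2) `^ e)); first by apply: powR_ge_base; lra.
rewrite powR_div ?addr_ge0 ?(ltW tn)// mulrC ler_wpM2r ?powR_ge0//.
have -> : (16 : R) = 2 `^ 4 by rewrite -[4 in RHS]/(4%:R) powR_mulrn// -natrX.
by apply: ler_powR; [rewrite ler1n|lra].
Qed.

Section Sums.
Variables (al C rho : R) (M n : nat) (t D : nat -> R) (A c e : R).
Hypotheses (al01 : 0 < al < 1) (qm : qmesh C rho M t) (C0 : 0 <= C) (r01 : 0 < rho <= 1).
Hypotheses (nM : (n < M)%N) (c0 : 0 <= c) (A0 : 0 <= A) (e4 : - 4 <= e) (e0 : e <= 0).
Hypothesis D0 : forall j, (j < n)%N -> 0 <= D j.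
Hypothesis DA : forall j, (j < n)%N ->
  D j <= A * ((t j.+1 - t j) ^+ 3 * (t j.+1 + c) `^ e).

(** [D j] stands for a step times the interpolation error on cell j. There are two instances: the
    solution, with c = 0 and e = al - 3, and a barrier, with c > 0 and e = al - 4. *)
Lemma jump_sum nu : nu <= 3 * rho ->
  \sum_(0 <= j < n) wjump al t n.+1 j * D j <=
  A * (4 * C ^+ 3 * (t n.+1 `^ (- al - 1) * (t 1%N `^ nu *
     \sum_(0 <= j < n) (t j.+1 - t j) * (t j.+1 + c) `^ (e + 3 - nu)))
  + 16 * ((t n.+1 - t n) `^ (3 - al) * (t n.+1 + c) `^ e)).
Proof.
move=> nu3; have [t0 ht _ _] := qm; have ht' : increasing_to t n.+1.
  by move=> j jn; apply: ht; exact: leq_trans nM.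
have hn : 0 < t n.+1 - t n by rewrite subr_gt0; exact: ht.
apply: le_trans (history_near (Dn := A * (16 * ((t n.+1 - t n) ^+ 3 * (t n.+1 + c) `^ e)))
  al01 t0 ht' _ D0 _) _.
- by rewrite !mulr_ge0 ?powR_ge0 ?exprn_ge0// ltW.
- move=> j jn near; apply: le_trans (DA jn) _; rewrite ler_wpM2l//.
  exact: near_pow qm c0 e4 e0 nM jn near.
rewrite mulrDr; apply: lerD.
  have -> : A * (4 * C ^+ 3 * (t n.+1 `^ (- al - 1) * (t 1%N `^ nu *
     \sum_(0 <= j < n) (t j.+1 - t j) * (t j.+1 + c) `^ (e + 3 - nu)))) =
     4 * (t n.+1 `^ (- al - 1) * (A * (C ^+ 3 * (t 1%N `^ nu *
     \sum_(0 <= j < n) (t j.+1 - t j) * (t j.+1 + c) `^ (e + 3 - nu))))) by ring.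
  rewrite ler_wpM2l// ler_wpM2l ?powR_ge0// 3!mulr_sumr.
  rewrite big_nat [leRHS]big_nat; apply: ler_sum => j /andP[_ jn].
  have hj : 0 <= t j.+1 - t j by rewrite subr_ge0; apply/ltW/ht'; exact: leqW.
  apply: le_trans (ler_wpM2l hj (DA jn)) _.
  rewrite [leLHS]mulrCA ler_wpM2l//.
  apply: le_trans (ler_wpM2l hj (cube_pow e qm C0 r01 c0 (ltn_trans jn nM) nu3)) _.
  by rewrite le_eqVlt; apply/orP; left; apply/eqP; ring.
rewrite mulrCA ler_wpM2l// mulrCA ler_wpM2l// mulrA.
rewrite ler_wpM2r ?powR_ge0//.
rewrite -powR_mulrn ?(ltW hn)// -powR_add// le_eqVlt; apply/orP; left; apply/eqP.
by congr (_ `^ _); ring.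
Qed.

End Sums.

Section SumsU.
Variables (al C rho : R) (M n : nat) (t D : nat -> R) (A mu : R).
Hypotheses (al01 : 0 < al < 1) (qm : qmesh C rho M t) (C0 : 0 <= C) (r01 : 0 < rho <= 1).
Hypotheses (nM : (n < M)%N) (A0 : 0 <= A).
Hypotheses (mu1 : mu <= (3 - al) * rho) (mu2 : mu < al + 1).

Lemma last_pow_u : (t n.+1 - t n) `^ (3 - al) * t n.+1 `^ (al - 3) <=
  C `^ (3 - al) * (t 1%N `^ mu * t n.+1 `^ (- mu)).
Proof.
have /andP[al0 al1] := al01; have /andP[r0 r1] := r01.
have tn := qmesh_pos (j:=n.+1) qm nM; have t1n := qmesh_ge1 (j:=n.+1) qm nM.
have t1 : 0 < t 1%N by apply: (qmesh_pos qm); rewrite (leq_trans _ nM).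
have al3 : al < 3 by lra.
have := last_pow (al - 3) qm C0 r01 (lexx 0) nM al3.
rewrite addr0 => /le_trans; apply; rewrite ler_wpM2l ?powR_ge0//.
have E1 : t 1%N `^ ((3 - al) * rho) = t 1%N `^ mu * t 1%N `^ ((3 - al) * rho - mu).
  by rewrite -powR_add//; congr (_ `^ _); ring.
have E2 : t n.+1 `^ (- mu) = t n.+1 `^ ((3 - al) * rho - mu) *
    t n.+1 `^ (al - 3 + (3 - al) - (3 - al) * rho).
  by rewrite -powR_add//; congr (_ `^ _); ring.
rewrite E1 E2 -mulrA ler_wpM2l ?powR_ge0// ler_wpM2r ?powR_ge0//.
by apply: powR_le_base => //; [rewrite subr_ge0|exact: ltW].
Qed.

(** The far part is a power sum of exponent al - mu; mu < al + 1 makes it of order t^(al + 1 - mu),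
    without a logarithm. *)
Lemma jump_sum_u : (forall j, (j < n)%N -> 0 <= D j) ->
  (forall j, (j < n)%N -> D j <= A * ((t j.+1 - t j) ^+ 3 * t j.+1 `^ (al - 3))) ->
  \sum_(0 <= j < n) wjump al t n.+1 j * D j <=
  A * ((4 * C ^+ 3 * (1 + (al + 1 - mu)^-1) + 16 * C `^ (3 - al)) *
    (t 1%N `^ mu * t n.+1 `^ (- mu))).
Proof.
move=> D0 DA; have /andP[al0 al1] := al01; have /andP[r0 r1] := r01.
have [t0 ht _ _] := qm.
have mu3 : mu <= 3 * rho.
  apply: le_trans mu1 _; apply: ler_wpM2r; lra.
have DA0 j : (j < n)%N -> D j <= A * ((t j.+1 - t j) ^+ 3 * (t j.+1 + 0) `^ (al - 3)).
  by move=> jn; rewrite addr0; exact: DA.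
have e4 : - 4 <= al - 3 by lra.
have e0 : al - 3 <= 0 by lra.
apply: le_trans (jump_sum al01 qm C0 r01 nM (lexx 0) A0 e4 e0 D0 DA0 mu3) _.
rewrite ler_wpM2l// [leRHS]mulrDl [t n.+1 + 0]addr0; apply: lerD; last first.
  by rewrite -mulrA ler_wpM2l//; exact: last_pow_u.
have tn := qmesh_pos (j:=n.+1) qm nM.
rewrite -[4 * _ * (1 + _) * _]mulrA ler_wpM2l ?mulr_ge0 ?exprn_ge0//.
have p0 : 0 < al + 1 - mu by rewrite subr_gt0.
have ht' : increasing_to t n by move=> j jn; apply/ht/(ltn_trans jn).
have S := sum_pow_ge0 p0 t0 ht'.
have -> : \sum_(0 <= j < n) (t j.+1 - t j) * (t j.+1 + 0) `^ (al - 3 + 3 - mu) =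
   \sum_(0 <= j < n) (t j.+1 - t j) * t j.+1 `^ (al + 1 - mu - 1).
  by apply: eq_bigr => j _; rewrite addr0; congr (_ * _ `^ _); ring.
rewrite mulrCA [leRHS]mulrCA ler_wpM2l ?powR_ge0//.
apply: (@le_trans _ _ (t n.+1 `^ (- al - 1) *
   ((1 + (al + 1 - mu)^-1) * t n.+1 `^ (al + 1 - mu)))).
  rewrite ler_wpM2l ?powR_ge0//; apply: le_trans S _.
  apply: ler_wpM2l; first by rewrite addr_ge0// invr_ge0 ltW.
  apply: powR_le_base; [exact: ltW| |exact/ltW/ht].
  by rewrite -t0; apply: (increasing_le ht); rewrite leq0n ltnW.
rewrite mulrCA -powR_add// le_eqVlt; apply/orP; left; apply/eqP.
by congr (_ * _ `^ _); ring.
Qed.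

End SumsU.

Section SumsB.
Variables (al C rho : R) (M n : nat) (t D : nat -> R) (A c : R).
Hypotheses (al01 : 0 < al < 1) (qm : qmesh C rho M t) (C0 : 0 <= C) (r01 : 0 < rho <= 1).
Hypotheses (nM : (n < M)%N) (A0 : 0 <= A) (c0 : 0 < c).
Let nu := (3 - al) * rho.
Hypotheses (nu1 : al < nu) (ct : c <= t n.+1).

Lemma last_pow_b : (t n.+1 - t n) `^ (3 - al) * (t n.+1 + c) `^ (al - 4) <=
  C `^ (3 - al) * (t 1%N `^ nu * (c `^ (al - nu) * t n.+1 `^ (- al - 1))).
Proof.
have /andP[al0 al1] := al01; have /andP[r0 r1] := r01.
have tn := qmesh_pos (j:=n.+1) qm nM.
have al3 : al < 3 by lra.
apply: le_trans (last_pow (al - 4) qm C0 r01 (ltW c0) nM al3) _.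
rewrite -/nu ler_wpM2l ?powR_ge0// ler_wpM2l ?powR_ge0//.
have -> : al - 4 + (3 - al) - nu = (al - nu) + (- al - 1) by ring.
rewrite powR_add; last exact: addr_gt0.
apply: ler_pM; rewrite ?powR_ge0//; apply: powR_ge_base => //.
- by rewrite subr_le0 ltW.
- by rewrite lerDr ltW.
- by rewrite -opprD oppr_le0 addr_ge0// ltW.
- by rewrite lerDl ltW.
Qed.

(** Here the power sum has exponent -1 - (nu - al). As al < nu it is governed by its small
    arguments, which contribute c^(al - nu). *)
Lemma jump_sum_b : (forall j, (j < n)%N -> 0 <= D j) ->
  (forall j, (j < n)%N -> D j <= A * ((t j.+1 - t j) ^+ 3 * (t j.+1 + c) `^ (al - 4))) ->
  \sum_(0 <= j < n) wjump al t n.+1 j * D j <=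
  A * ((4 * C ^+ 3 * (nu - al)^-1 + 16 * C `^ (3 - al)) *
    (t 1%N `^ nu * (c `^ (al - nu) * t n.+1 `^ (- al - 1)))).
Proof.
move=> D0 DA; have /andP[al0 al1] := al01; have /andP[r0 r1] := r01.
have [t0 ht _ _] := qm.
have nu3 : nu <= 3 * rho by rewrite /nu ler_wpM2r ?(ltW r0)// gerBl ltW.
have e4 : - 4 <= al - 4 by lra.
have e0 : al - 4 <= 0 by lra.
apply: le_trans (jump_sum al01 qm C0 r01 nM (ltW c0) A0 e4 e0 D0 DA nu3) _.
rewrite ler_wpM2l// [leRHS]mulrDl; apply: lerD; last first.
  by rewrite -mulrA ler_wpM2l//; exact: last_pow_b.
have tn := qmesh_pos (j:=n.+1) qm nM.
rewrite -[4 * _ * _ * _]mulrA ler_wpM2l ?mulr_ge0 ?exprn_ge0//.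
have q0 : 0 < nu - al by rewrite subr_gt0.
have ht' : increasing_to t n by move=> j jn; apply/ht/(ltn_trans jn).
have S := sum_pow_lt0 q0 c0 t0 ht'.
have -> : \sum_(0 <= j < n) (t j.+1 - t j) * (t j.+1 + c) `^ (al - 4 + 3 - nu) =
   \sum_(0 <= j < n) (t j.+1 - t j) * (t j.+1 + c) `^ (- 1 - (nu - al)).
  by apply: eq_bigr => j _; congr (_ * _ `^ _); ring.
have -> : (nu - al)^-1 * (t 1%N `^ nu * (c `^ (al - nu) * t n.+1 `^ (- al - 1))) =
  t n.+1 `^ (- al - 1) * (t 1%N `^ nu * ((nu - al)^-1 * c `^ (- (nu - al)))).
  by rewrite opprB; ring.
by rewrite ler_wpM2l ?powR_ge0// ler_wpM2l ?powR_ge0.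
Qed.

End SumsB.

End QuasiGraded.

(** * From cellwise errors to the truncation error *)

Section Truncation.
Variable R : realType.
Implicit Types (t U D E : nat -> R) (w : R -> R).
Implicit Types (al rho nu mu s x y p A C T a b c q : R) (m j n M : nat).

Definition Gammainv al : R := (Gamma (1 - al))^-1.

Lemma Gammainv_ge0 al : 0 <= Gammainv al.
Proof.
rewrite invr_ge0; apply: Rintegral_ge0 => x _.
by rewrite mulr_ge0 ?powR_ge0 ?expR_ge0.
Qed.

(** Integrability of [w1] against the kernel is obtained from that of the polynomial derivative and
    of the difference, so all estimates may address the difference. *)
Lemma delta_sub_caputo al t m w w1 U E :
  al < 1 -> t 0%N = 0 -> increasing_to t m ->
  (forall j, (j < m)%N -> {in `]t j, t j.+1[%R, forall s, is_derive s (1:R) w (w1 s)}) ->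
  (forall j, (j < m)%N ->
     wintegrable al (t m) (t j) (t j.+1) (fun s => dpiece t U m j s - w1 s) /\
     `|wint al (t m) (t j) (t j.+1) (fun s => dpiece t U m j s - w1 s)| <= E j) ->
  `|delta al t U m - caputo al w (t m)| <= Gammainv al * \sum_(0 <= j < m) E j.
Proof.
move=> al1 t0 ht dw wE.
have tm j : (j < m)%N -> t j.+1 <= t m.
  by move=> jm; apply: (increasing_le ht); rewrite jm leqnn.
have idp j : (j < m)%N -> wintegrable al (t m) (t j) (t j.+1) (dpiece t U m j).
  move=> jm; have [H _] := wint_affine (dpiece t U m j (t m)) (ddpiece t U m j) al1
    (ht j jm) (tm j jm).
  by congr wintegrable : H; apply/funext => s; rewrite -dpieceE.
have iw1 j : (j < m)%N -> wintegrable al (t m) (t j) (t j.+1) w1 /\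
    wint al (t m) (t j) (t j.+1) w1 = wint al (t m) (t j) (t j.+1) (dpiece t U m j)
     - wint al (t m) (t j) (t j.+1) (fun s => dpiece t U m j s - w1 s).
  move=> jm; have [i1 _] := wE j jm.
  have e s : (t m - s) `^ (- al) * w1 s = (t m - s) `^ (- al) * dpiece t U m j s
     + -1 * ((t m - s) `^ (- al) * (dpiece t U m j s - w1 s)) by ring.
  have i2 := integrable_add (idp j jm) (integrable_scale (-1) i1).
  split.
    by have /funext E' := e; rewrite /wintegrable E'.
  have -> : wint al (t m) (t j) (t j.+1) w1 =
    \int[lebesgue_measure]_(s in `]t j, t j.+1[) ((t m - s) `^ (- al) * dpiece t U m j s
     + -1 * ((t m - s) `^ (- al) * (dpiece t U m j s - w1 s))).
    by apply: eq_Rintegral => s _.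
  rewrite RintegralD//; last exact: integrable_scale; last exact: idp.
  by rewrite RintegralZl// mulN1r.
rewrite delta_wint// (@caputo_cells _ al t m w (fun=> w1) t0 ht).
- rewrite -mulrBr -sumrB normrM (ger0_norm (Gammainv_ge0 al)).
  rewrite ler_wpM2l ?Gammainv_ge0//.
  apply: le_trans (ler_norm_sum _ _ _) _.
  rewrite big_nat [leRHS]big_nat; apply: ler_sum => j /andP[_ jm].
  by rewrite (proj2 (iw1 j jm)) opprB addrC subrK; have [] := wE j jm.
- by move=> j jm s sj; rewrite derive1E; have := dw j jm s sj => -[_ ->].
- by move=> j jm; have [] := iw1 j jm.
Qed.

Lemma history_cell al t m j w w1 U G g : 0 < al < 1 -> increasing_to t m ->
  (j.+1 < m)%N -> prim w w1 (t j) (t j.+1) -> U j = w (t j) -> U j.+1 = w (t j.+1) ->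
  prim G g (t j) (t j.+1) ->
  {in `]t j, t j.+1[%R, forall s, `|dpiece t U m j s - w1 s| <= g s} ->
  wintegrable al (t m) (t j) (t j.+1) (fun s => dpiece t U m j s - w1 s) /\
  `|wint al (t m) (t j) (t j.+1) (fun s => dpiece t U m j s - w1 s)| <=
    wjump al t m j * (G (t j.+1) - G (t j)).
Proof.
move=> /andP[al0 al1] ht jm pw Uj Uj1 pG bg.
have jm' := ltnW jm; have hj := ht j jm'.
have tm : t j.+1 < t m by apply: (increasing_lt ht); rewrite jm leqnn.
have pX := primB (prim_piece t U m j (t j) (t j.+1)) pw.
have [|i B] := @wint_ref R al (t m) _ _ ((t m - t j) `^ (- al)) (wjump al t m j)
  _ _ _ _ hj (ltW tm) pX pG bg.
  move=> s; rewrite in_itv/= => /andP[js sj].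
  have w0 := weight_mono al0 (ltW js) (lt_trans sj tm).
  by rewrite ger0_norm ?subr_ge0// /wjump lerD2r; apply: weight_mono => //; exact: ltW.
split=> //; move: B; have [-> ->] := piece_nodes U ht jm'.
by rewrite Uj Uj1 !subrr mulr0 subr0.
Qed.

(** The kernel is unbounded on the last cell, so no constant is subtracted: a uniform bound is
    integrated against it. *)
Lemma last_cell al t n w1 U d : al < 1 -> increasing_to t n.+1 ->
  {in `]t n, t n.+1[%R, forall s, {for s, continuous w1}} ->
  {in `]t n, t n.+1[%R, forall s, `|dpiece t U n.+1 n s - w1 s| <= d} ->
  wintegrable al (t n.+1) (t n) (t n.+1) (fun s => dpiece t U n.+1 n s - w1 s) /\
  `|wint al (t n.+1) (t n) (t n.+1) (fun s => dpiece t U n.+1 n s - w1 s)| <=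
    d * ((t n.+1 - t n) `^ (1 - al) / (1 - al)).
Proof.
move=> al1 ht cw bd; have hn := ht n (leqnn _).
have [|i B] := wint_bound al1 hn (lexx _) _ bd.
  move=> s sn; apply: cvgB; last exact: cw.
  exact: is_derive_continuous (is_derive_dpiece t U n.+1 n s).
split=> //; apply: le_trans B _.
by rewrite subrr powR0 ?subr0// subr_eq0 gt_eqF.
Qed.

Lemma prim_increment F f G g a b : a < b -> prim F f a b -> prim G g a b ->
  {in `]a, b[%R, forall s, `|f s| <= g s} -> `|F b - F a| <= G b - G a.
Proof.
move=> ab pF pG fg; have [_ _ cf] := pF.
have [_ <-] := prim_dom ab pF pG fg.
by have [] := int_dom ab pG cf fg.
Qed.

End Truncation.

(** * Truncation error of the solution *)

Section TruncationU.
Variable R : realType.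
Implicit Types (t U D E : nat -> R).
Implicit Types (al rho nu mu s x y p A C T a b c q : R) (m j n M : nat).

Lemma ratio_le C rho M t j : qmesh C rho M t -> 0 <= C -> (0 < j)%N -> (j < M)%N ->
  t j.+1 <= (1 + C) * t j.
Proof.
move=> [t0 ht h _] C0; case: j => [//|j] _ jM; have /andP[_ hj] := h j jM.
have tj : 0 <= t j by rewrite -t0; apply: (increasing_le ht); rewrite leq0n (ltnW (ltnW jM)).
have : C * (t j.+1 - t j) <= C * t j.+1 by rewrite ler_wpM2l// gerBl.
lra.
Qed.

(** The three groups belong to the node m = 1, to the history, and to the last cell; the last group
    adds the constants of m = 2 and of m >= 3. *)
Definition trunc_const al mu C : R :=
  (2 * ((1 - al)^-1 + al^-1) + al^-1 / (1 - al))
  + (al^-1 * (5 * (1 + C) + 1) + (1 + C) ^+ 5) *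
     (4 * C ^+ 3 * (1 + (al + 1 - mu)^-1) + 16 * C `^ (3 - al))
  + ((al^-1 * (5 * (1 + C)) + 1) * (1 + C) ^+ 3 / (1 - al)
     + 4 * (1 + C) ^+ 6 * C `^ (3 - al) / (1 - al)).

Section Fixed.
Variables (al rho mu C A T : R) (M : nat) (t : nat -> R) (u u1 u2 u3 : R -> R).
Hypotheses (al01 : 0 < al < 1) (r01 : 0 < rho <= 1) (C1 : 1 <= C) (A0 : 0 <= A).
Hypotheses (mu0 : 0 <= mu) (mu1 : mu <= (3 - al) * rho) (mu2 : mu < al + 1).
Hypotheses (qm : qmesh C rho M t) (tM : t M = T) (cu : {within `[0, T], continuous u}).
Hypothesis d1 : {in `]0, T[%R, forall s, is_derive s (1:R) u (u1 s)}.
Hypothesis d2 : {in `]0, T[%R, forall s, is_derive s (1:R) u1 (u2 s)}.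
Hypothesis d3 : {in `]0, T[%R, forall s, is_derive s (1:R) u2 (u3 s)}.
Hypothesis b1 : {in `]0, T[%R, forall s, `|u1 s| <= A * s `^ (al - 1)}.
Hypothesis b3 : {in `]0, T[%R, forall s, `|u3 s| <= A * s `^ (al - 3)}.

Let U j := u (t j).
Let al0 : 0 < al. Proof. by have /andP[] := al01. Qed.
Let al1 : al < 1. Proof. by have /andP[] := al01. Qed.
Let al1n : al - 1 <= 0. Proof. by rewrite subr_le0 ltW. Qed.
Let al3n : al - 3 <= 0. Proof. by have /andP[] := al01; lra. Qed.
Let al3m : - (al - 3) <= 3. Proof. by have /andP[] := al01; lra. Qed.
Let mu2' : mu <= 2. Proof. by have h := mu2; have /andP[] := al01; lra. Qed.
Let C0 : 0 <= C. Proof. exact: le_trans C1. Qed.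
Let t0 : t 0%N = 0. Proof. by have [] := qm. Qed.
Let ht : increasing_to t M. Proof. by have [] := qm. Qed.
Let htm m : (m <= M)%N -> increasing_to t m.
Proof. by move=> mM j jm; apply: ht; exact: leq_trans mM. Qed.
Let tge0 j : (j <= M)%N -> 0 <= t j.
Proof. by move=> jM; rewrite -t0; apply: (increasing_le ht). Qed.
Let tleT j : (j <= M)%N -> t j <= T.
Proof. by move=> jM; rewrite -tM; apply: (increasing_le ht); rewrite jM leqnn. Qed.
Let tpos j : (0 < j <= M)%N -> 0 < t j. Proof. exact: qmesh_pos qm. Qed.

Lemma prim_u a b : 0 <= a -> b <= T -> prim u u1 a b.
Proof.
move=> a0 bT; split.
- apply: continuous_subspaceW cu => s /=; rewrite !in_itv/= => /andP[sa sb].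
  by rewrite (le_trans a0 sa) (le_trans sb bT).
- move=> s; rewrite in_itv/= => /andP[sa sb]; apply: d1.
  by rewrite in_itv/= (le_lt_trans a0 sa) (lt_le_trans sb bT).
- move=> s; rewrite in_itv/= => /andP[sa sb].
  apply: (is_derive_continuous (d2 _)).
  by rewrite in_itv/= (le_lt_trans a0 sa) (lt_le_trans sb bT).
Qed.

Lemma increment_u a b : 0 <= a -> a < b -> b <= T ->
  `|u b - u a| <= A * (al^-1 * b `^ al).
Proof.
move=> a0 ab bT.
apply: le_trans (prim_increment ab (prim_u a0 bT) (primZ A (prim_powR b al0 a0)) _) _.
  move=> s; rewrite in_itv/= => /andP[sa sb]; apply: b1.
  by rewrite in_itv/= (le_lt_trans a0 sa) (lt_le_trans sb bT).
by rewrite gerBl !mulr_ge0 ?powR_ge0// invr_ge0 ltW.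
Qed.

Lemma dd1_u0 : (0 < M)%N -> `|dd1 t U 0| <= A * (al^-1 * t 1%N `^ (al - 1)).
Proof.
move=> M0; have tt1 : 0 < t 1%N by exact: tpos.
rewrite /dd1 t0 subr0 normrM normfV (gtr0_norm tt1) ler_pdivrMr//.
have tT : t 1%N <= T by exact: tleT.
have := increment_u (lexx 0) tt1 tT; rewrite /U t0 => /le_trans; apply.
by rewrite -!mulrA ler_wpM2l// ler_wpM2l ?invr_ge0 ?(ltW al0)// powR_sub1// divfK ?gt_eqF.
Qed.

(** Bound for the slopes on the first two cells. A stencil that starts at t_0 is treated with it and
    with the bound on u', because the bound on u''' blows up at 0. *)
Let P := A * (al^-1 * ((1 + C) * t 1%N `^ (al - 1))).

Lemma dd1_u0' : (0 < M)%N -> `|dd1 t U 0| <= P.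
Proof.
move=> M0; apply: le_trans (dd1_u0 M0) _; rewrite ler_wpM2l// ler_wpM2l ?invr_ge0 ?(ltW al0)//.
by rewrite ler_peMl ?powR_ge0// lerDl.
Qed.

Lemma dd1_u1 : (1 < M)%N -> `|dd1 t U 1| <= P.
Proof.
move=> M1; have tt1 : 0 < t 1%N by apply: tpos; exact: ltnW.
have h1 : t 1%N <= t 2%N - t 1%N.
  by have [_ _ h _] := qm; have /andP[] := h 0%N M1; rewrite t0 subr0.
have t12 : t 1%N < t 2%N by exact: ht.
have tT : t 2%N <= T by exact: tleT.
have h1p : 0 < t 2%N - t 1%N by rewrite subr_gt0.
rewrite /dd1 normrM normfV (gtr0_norm h1p) ler_pdivrMr//.
apply: le_trans (increment_u (ltW tt1) t12 tT) _.
rewrite /P -!mulrA ler_wpM2l// ler_wpM2l ?invr_ge0 ?(ltW al0)//.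
apply: (@le_trans _ _ (((1 + C) * t 1%N) `^ al)).
  apply: powR_le_base; [exact: ltW|exact: tge0|exact: ratio_le qm C0 _ _].
have C10 : 0 <= 1 + C by rewrite addr_ge0.
rewrite powRM ?(ltW tt1)//.
apply: ler_pM; rewrite ?powR_ge0//.
  rewrite -[leRHS](powRr1 C10); apply: ler_powR; last exact: ltW.
  by rewrite lerDl.
rewrite -[X in X <= _](divfK (lt0r_neq0 tt1)) -powR_sub1//.
by rewrite ler_wpM2l ?powR_ge0.
Qed.

(** Both singularities sit in the same cell, the purpose of [wint_sing]. The bound is independent of
    t_1, in agreement with (t_1 / t_m)^mu = 1. *)
Lemma trunc_u1 : (0 < M)%N ->
  `|delta al t U 1 - caputo al u (t 1%N)| <=
  Gammainv al * (A * (2 * ((1 - al)^-1 + al^-1) + al^-1 / (1 - al))).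
Proof.
move=> M0; have tt1 : 0 < t 1%N by exact: tpos.
have tT : t 1%N <= T by exact: tleT.
have := @delta_sub_caputo _ al t 1 u u1 U
  (fun=> A * (2 * ((1 - al)^-1 + al^-1) + al^-1 / (1 - al))) al1 t0 (htm M0).
rewrite big_nat1; apply.
  move=> [|//] _ s; rewrite t0 in_itv/= => /andP[s0 s1]; apply: d1.
  by rewrite in_itv/= s0 (lt_le_trans s1).
move=> [|//] _; rewrite t0.
pose d := A * (al^-1 * t 1%N `^ (al - 1)).
have d0 : 0 <= d by rewrite !mulr_ge0 ?powR_ge0// invr_ge0 ltW.
have [|s|i B] := wint_sing (x := fun s => dpiece t U 1 0 s - u1 s) al01 tt1 A0 d0.
- move=> s; rewrite in_itv/= => /andP[s0 s1]; apply: cvgB.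
    exact: is_derive_continuous (is_derive_dpiece t U 1 0 s).
  by apply: (is_derive_continuous (d2 _)); rewrite in_itv/= s0 (lt_le_trans s1).
- rewrite in_itv/= => /andP[s0 s1]; apply: le_trans (ler_normB _ _) _.
  rewrite addrC lerD//; first by apply: b1; rewrite in_itv/= s0 (lt_le_trans s1).
  exact: dd1_u0.
split=> //; apply: le_trans B _.
have E1 : t 1%N `^ (al - 1) * t 1%N `^ (1 - al) = 1 by rewrite -opprB mulrC powR_addK.
have -> : d * t 1%N `^ (1 - al) / (1 - al) = A * (al^-1 *
  (t 1%N `^ (al - 1) * t 1%N `^ (1 - al)) / (1 - al)) by rewrite /d; ring.
rewrite E1 mulr1 le_eqVlt; apply/orP; left; apply/eqP; ring.
Qed.

(** Integral over cell j of a bound for the error derivative: 5 P + A s^(al - 1) on the first cell,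
    the third-order interpolation estimate on the others. *)
Let D j : R := if j == 0%N then A * (al^-1 * (5 * (1 + C) + 1) * t 1%N `^ al)
  else (t j.+1 - t j) * ((t j.+2 - t j) ^+ 2 * (A * t j `^ (al - 3))).

Lemma D_ge0 j : (j < M)%N -> 0 <= D j.
Proof.
move=> jM; rewrite /D; case: ifP => _.
  by rewrite !mulr_ge0 ?powR_ge0 ?addr_ge0 ?mulr_ge0 ?addr_ge0 ?invr_ge0 ?(ltW al0).
apply: mulr_ge0; first by rewrite subr_ge0; apply/ltW/ht.
by apply: mulr_ge0; [exact: exprn_even_ge0|rewrite mulr_ge0 ?powR_ge0].
Qed.

(** The first cell fits the general form since its step is t_1, so that t_1^al = t_1^3 t_1^(al - 3).
    Elsewhere (1 + C)^2 comes from the width of the stencil and (1 + C)^3 from replacing t_j by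
    t_{j+1}. *)
Lemma D_le j : (j.+1 < M)%N -> D j <=
  A * (al^-1 * (5 * (1 + C) + 1) + (1 + C) ^+ 5) *
   ((t j.+1 - t j) ^+ 3 * t j.+1 `^ (al - 3)).
Proof.
move=> jM; have jM' := ltnW jM; have C10 : 0 <= 1 + C by rewrite addr_ge0.
have K1 : 0 <= al^-1 * (5 * (1 + C) + 1).
  by rewrite mulr_ge0 ?invr_ge0 ?(ltW al0)// addr_ge0 ?mulr_ge0.
have K2 : 0 <= (1 + C) ^+ 5 by rewrite exprn_ge0.
have hj : 0 < t j.+1 - t j by rewrite subr_gt0; exact: ht.
have tj1 : 0 < t j.+1 by exact: tpos.
have X0 : 0 <= (t j.+1 - t j) ^+ 3 * t j.+1 `^ (al - 3).
  by rewrite mulr_ge0 ?powR_ge0// exprn_ge0// ltW.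
rewrite -mulrA /D; case: ifPn => [/eqP j0|j0].
  rewrite ler_wpM2l// [leRHS]mulrDl -[leLHS]addr0 lerD//; last by rewrite mulr_ge0.
  rewrite ler_wpM2l// j0 t0 subr0.
  have tt1 : 0 < t 1%N by rewrite -j0.
  rewrite -powR_mulrn ?(ltW tt1)// -powR_add// le_eqVlt; apply/orP; left; apply/eqP.
  by congr (_ `^ _); ring.
have j0' : (0 < j)%N by rewrite lt0n.
have tj : 0 < t j by apply: tpos; rewrite j0' ltnW.
have rt := ratio_le qm C0 j0' jM'.
have hj2 : t j.+2 - t j <= (1 + C) * (t j.+1 - t j).
  have [_ _ h _] := qm; have /andP[_ hh] := h j jM.
  have -> : t j.+2 - t j = (t j.+1 - t j) + (t j.+2 - t j.+1) by ring.
  by rewrite mulrDl mul1r lerD2l.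
have hj20 : 0 <= t j.+2 - t j.
  by rewrite subr_ge0; apply: (increasing_le ht); rewrite jM !leqW.
have e1 : (t j.+2 - t j) ^+ 2 <= (1 + C) ^+ 2 * (t j.+1 - t j) ^+ 2.
  by rewrite -exprMn; apply: lerXn2r => //; rewrite nnegrE mulr_ge0// ltW.
have e2 : t j `^ (al - 3) <= (1 + C) ^+ 3 * t j.+1 `^ (al - 3).
  have C1p : 0 < 1 + C by rewrite ltr_pwDl.
  apply: (@le_trans _ _ ((t j.+1 / (1 + C)) `^ (al - 3))).
    apply: powR_ge_base => //; [by rewrite divr_gt0|by rewrite ler_pdivrMr// mulrC].
  rewrite powR_div ?(ltW tj1)// mulrC ler_wpM2r ?powR_ge0//.
  by rewrite -powR_mulrn//; apply: ler_powR; rewrite ?lerDl.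
apply: (@le_trans _ _ ((t j.+1 - t j) * (((1 + C) ^+ 2 * (t j.+1 - t j) ^+ 2) *
    (A * ((1 + C) ^+ 3 * t j.+1 `^ (al - 3)))))).
  rewrite ler_wpM2l ?(ltW hj)//; apply: ler_pM => //.
  - by rewrite exprn_even_ge0.
  - by rewrite mulr_ge0 ?powR_ge0.
  - by rewrite ler_wpM2l.
have -> : (t j.+1 - t j) * (((1 + C) ^+ 2 * (t j.+1 - t j) ^+ 2) *
    (A * ((1 + C) ^+ 3 * t j.+1 `^ (al - 3)))) =
   A * ((1 + C) ^+ 5 * ((t j.+1 - t j) ^+ 3 * t j.+1 `^ (al - 3))) by ring.
by rewrite ler_wpM2l// ler_wpM2r// lerDr.
Qed.

Lemma first_dquad s : (1 < M)%N -> t 0%N <= s <= t 2%N -> `|dquad t U 0 s| <= 5 * P.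
Proof.
move=> M1 s02; apply: dquad_bound s02 _ _; [exact/ht/ltnW|exact: ht| |exact: dd1_u1].
by apply: dd1_u0'; exact: ltnW.
Qed.

Lemma quad_error_u (a : nat) (G : R) : (0 < a)%N -> (a.+2 <= M)%N -> 
  G = (t a.+2 - t a) ^+ 2 * (A * t a `^ (al - 3)) ->
  {in `]t a, t a.+2[%R, forall s, `|dquad t U a s - u1 s| <= G}.
Proof.
move=> a0 aM -> s sI; rewrite distrC.
have aM1 := ltnW aM; have ta : 0 < t a by apply: tpos; rewrite a0 ltnW.
have t2T := tleT aM.
have sub : {subset `]t a, t a.+2[%R <= `]0, T[%R}.
  move=> x; rewrite !in_itv/= => /andP[? ?].
  by rewrite (lt_trans ta) ?(lt_le_trans _ t2T).
apply: (@quad_interp_error3 _ t U a u u1 u2 _ _ _ _ _ _ u3) => //.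
- exact: ht.
- exact: ht.
- apply: continuous_subspaceW cu => x /=; rewrite !in_itv/= => /andP[xa xb].
  by rewrite (le_trans (ltW ta) xa) (le_trans xb t2T).
- by move=> x /sub; exact: d1.
- by move=> x /sub; exact: d2.
- by move=> x /sub; exact: d3.
- move=> x xI; apply: le_trans (b3 (sub _ xI)) _; rewrite ler_wpM2l//.
  move: xI; rewrite in_itv/= => /andP[xa _]; by apply: powR_ge_base => //; exact: ltW.
Qed.

Lemma history_u n j : (0 < n)%N -> (n < M)%N -> (j < n)%N ->
  wintegrable al (t n.+1) (t j) (t j.+1) (fun s => dpiece t U n.+1 j s - u1 s) /\
  `|wint al (t n.+1) (t j) (t j.+1) (fun s => dpiece t U n.+1 j s - u1 s)| <=
    wjump al t n.+1 j * D j.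
Proof.
move=> n0 nM jn; have jM := ltn_trans jn nM.
have hn1 := htm nM.
have tj0 := tge0 (ltnW jM); have tj1T := tleT jM.
have pu := prim_u tj0 tj1T.
have n1 : (n.+1 == 1)%N = false by rewrite eqSS eqn0Ngt n0.
have sten : stencil n.+1 j = j by rewrite /stencil ltnS jn.
rewrite /D; case: ifPn => [/eqP j0|j0].
  have pG := primD (primZ (5 * P) (prim_lin (t j) (t j.+1)))
    (primZ A (prim_powR (t j.+1) al0 tj0)).
  have [|i B] := history_cell (U := U) al01 hn1 (jn : (j.+1 < n.+1)%N) pu erefl erefl pG.
    move=> s sj; apply: le_trans (ler_normB _ _) _; apply: lerD.
      rewrite mulr1 /dpiece n1 sten j0; apply: first_dquad; first exact: leq_ltn_trans nM.
      move: sj; rewrite j0 in_itv/= => /andP[s0 s1]; rewrite ltW//=.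
      by apply: le_trans (ltW s1) _; apply/ltW/ht/(leq_ltn_trans n0).
    apply: b1; move: sj; rewrite !in_itv/= => /andP[sa sb].
    by rewrite (le_lt_trans tj0 sa) (lt_le_trans sb tj1T).
  split=> //; apply: le_trans B _; rewrite j0 t0 powR0 ?(gt_eqF al0)//.
  have tt1 : 0 < t 1%N by apply: tpos; exact: leq_ltn_trans nM.
  have -> : t 1%N `^ al = t 1%N `^ (al - 1) * t 1%N by rewrite powR_sub1// divfK ?gt_eqF.
  rewrite le_eqVlt; apply/orP; left; apply/eqP; rewrite /P; ring.
have j0' : (0 < j)%N by rewrite lt0n.
pose g := (t j.+2 - t j) ^+ 2 * (A * t j `^ (al - 3)).
have pG := primZ g (prim_lin (t j) (t j.+1)).
have [|i B] := history_cell (U := U) al01 hn1 (jn : (j.+1 < n.+1)%N) pu erefl erefl pG.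
  move=> s sj; rewrite mulr1 /dpiece n1 sten.
  have j2M : (j.+2 <= M)%N by exact: leq_trans nM.
  apply: (quad_error_u j0' j2M erefl).
  move: sj; rewrite !in_itv/= => /andP[-> sj] /=.
  by apply: lt_trans sj _; exact: ht.
split=> //; apply: le_trans B _.
rewrite le_eqVlt; apply/orP; left; apply/eqP; rewrite /g; ring.
Qed.

Lemma cont_u1 n : (n < M)%N -> {in `]t n, t n.+1[%R, forall s, {for s, continuous u1}}.
Proof.
move=> nM s; rewrite in_itv/= => /andP[s1 s2]; apply: (is_derive_continuous (d2 _)).
by rewrite in_itv/= (le_lt_trans _ s1) ?(lt_le_trans s2) ?tleT ?tge0// ltnW.
Qed.

(** The stencil starts at t_0, which leaves only the crude bound; it is enough because t_2 <= (1 +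
    C) t_1 keeps (t_1 / t_2)^mu away from 0. *)
Lemma last_u2 : (1 < M)%N ->
  wintegrable al (t 2%N) (t 1%N) (t 2%N) (fun s => dpiece t U 2 1 s - u1 s) /\
  `|wint al (t 2%N) (t 1%N) (t 2%N) (fun s => dpiece t U 2 1 s - u1 s)| <=
   A * ((al^-1 * (5 * (1 + C)) + 1) * (1 + C) ^+ 3 / (1 - al)) *
   (t 1%N `^ mu * t 2%N `^ (- mu)).
Proof.
move=> M1; have C1p : 0 < 1 + C by rewrite ltr_pwDl.
have tt1 : 0 < t 1%N by apply: tpos; exact: ltnW.
have tt2 : 0 < t 2%N by exact: tpos.
have rt := ratio_le (j:=1) qm C0 isT M1.
have t12 : t 1%N < t 2%N by exact: ht.
have tT : t 2%N <= T by exact: tleT.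
have [|i B] := last_cell (U:=U) (d := 5 * P + A * t 1%N `^ (al - 1)) al1 (htm M1) (cont_u1 M1).
  move=> s; rewrite in_itv/= => /andP[s1 s2].
  apply: le_trans (ler_normB _ _) _; apply: lerD.
    apply: first_dquad => //; rewrite (ltW s2) andbT t0; apply: ltW.
    exact: lt_trans s1.
  apply: le_trans (b1 _) _.
    by rewrite in_itv/= (lt_trans tt1 s1) (lt_le_trans s2).
  by rewrite ler_wpM2l//; apply: powR_ge_base => //; exact: ltW.
split=> //; apply: le_trans B _.
have e1 : (t 2%N - t 1%N) `^ (1 - al) <= (1 + C) * t 1%N `^ (1 - al).
  apply: (@le_trans _ _ (((1 + C) * t 1%N) `^ (1 - al))).
    apply: powR_le_base; [by rewrite subr_ge0 ltW|by rewrite subr_ge0 ltW|].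
    by apply: le_trans rt; rewrite gerBl ltW.
  rewrite powRM ?(ltW tt1) ?(ltW C1p)// ler_wpM2r ?powR_ge0//.
  rewrite -[leRHS](powRr1 (ltW C1p)); apply: ler_powR; first by rewrite lerDl.
  by rewrite gerBl ltW.
have e2 : 1 <= (1 + C) ^+ 2 * (t 1%N `^ mu * t 2%N `^ (- mu)).
  rewrite -[leLHS](powR_addK mu tt2).
  rewrite mulrA ler_wpM2r ?powR_ge0//.
  apply: le_trans (powR_le_base mu0 (ltW tt2) rt) _.
  rewrite powRM ?(ltW tt1) ?(ltW C1p)// ler_wpM2r ?powR_ge0//.
  rewrite -powR_mulrn ?(ltW C1p)//; apply: ler_powR; first by rewrite lerDl.
  exact: mu2'.
have E1 : t 1%N `^ (al - 1) * t 1%N `^ (1 - al) = 1 by rewrite -opprB mulrC powR_addK.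
have al1' : 0 <= (1 - al)^-1 by rewrite invr_ge0 subr_ge0 ltW.
have K0 : 0 <= al^-1 * (5 * (1 + C)) + 1.
  by rewrite addr_ge0// !mulr_ge0 ?invr_ge0 ?(ltW al0)// ltW.
have P0 : 0 <= 5 * P + A * t 1%N `^ (al - 1).
  by rewrite addr_ge0// !mulr_ge0 ?powR_ge0// ?invr_ge0 ?(ltW al0)// ltW.
apply: (@le_trans _ _ ((5 * P + A * t 1%N `^ (al - 1)) *
   ((1 + C) * t 1%N `^ (1 - al) / (1 - al)))).
  by rewrite ler_wpM2l// ler_wpM2r.
have -> : (5 * P + A * t 1%N `^ (al - 1)) * ((1 + C) * t 1%N `^ (1 - al) / (1 - al))
  = (A * ((al^-1 * (5 * (1 + C)) + 1) * (1 + C) / (1 - al))) *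
    (t 1%N `^ (al - 1) * t 1%N `^ (1 - al)) by rewrite /P; ring.
rewrite E1.
have -> : A * ((al^-1 * (5 * (1 + C)) + 1) * (1 + C) ^+ 3 / (1 - al)) *
  (t 1%N `^ mu * t 2%N `^ (- mu)) = A * ((al^-1 * (5 * (1 + C)) + 1) * (1 + C) / (1 - al)) *
  ((1 + C) ^+ 2 * (t 1%N `^ mu * t 2%N `^ (- mu))) by ring.
by rewrite ler_wpM2l// !mulr_ge0// ltW.
Qed.

Lemma last_u3 n : (1 < n)%N -> (n < M)%N ->
  wintegrable al (t n.+1) (t n) (t n.+1) (fun s => dpiece t U n.+1 n s - u1 s) /\
  `|wint al (t n.+1) (t n) (t n.+1) (fun s => dpiece t U n.+1 n s - u1 s)| <=
   A * (4 * (1 + C) ^+ 6 * C `^ (3 - al) / (1 - al)) *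
   (t 1%N `^ mu * t n.+1 `^ (- mu)).
Proof.
(* From here on [t n] is the first node of the stencil, two ratios below [t n.+2]; hence the power
   (1 + C)^6. *)
case: n => [//|n] n1 nM; have n0 : (0 < n)%N by [].
have C1p : 0 < 1 + C by rewrite ltr_pwDl.
have nM1 := ltnW nM; have nM2 := ltnW nM1.
have tn : 0 < t n by apply: tpos; rewrite n0 ltnW.
have tn2 : 0 < t n.+2 by exact: tpos.
have hn : 0 < t n.+2 - t n.+1 by rewrite subr_gt0; exact: ht.
pose g := (t n.+2 - t n) ^+ 2 * (A * t n `^ (al - 3)).
have [|i B] := last_cell (U:=U) (d := g) al1 (htm nM) (cont_u1 nM).
  move=> s; rewrite /dpiece /stencil /= ltnn in_itv/= => /andP[s1 s2].
  apply: (quad_error_u n0 nM erefl).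
  by rewrite in_itv/= s2 andbT; apply: lt_trans s1; exact: ht.
split=> //; apply: le_trans B _.
have e1 : (t n.+2 - t n) ^+ 2 <= 4 * (t n.+2 - t n.+1) ^+ 2.
  have -> : 4 * (t n.+2 - t n.+1) ^+ 2 = (2 * (t n.+2 - t n.+1)) ^+ 2 by ring.
  have h0 : t n < t n.+1 by exact: ht.
  have h1 : t n.+1 - t n <= t n.+2 - t n.+1.
    by have [_ _ h _] := qm; have /andP[] := h n nM.
  have -> : t n.+2 - t n = (t n.+1 - t n) + (t n.+2 - t n.+1) by ring.
  apply: lerXn2r; rewrite ?nnegrE ?mulr_ge0 ?(ltW hn)//.
    by rewrite addr_ge0 ?(ltW hn)// subr_ge0 ltW.
  by rewrite [leRHS]mulr_natl mulr2n lerD2r.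
have e2 : t n `^ (al - 3) <= (1 + C) ^+ 6 * t n.+2 `^ (al - 3).
  have r1 := ratio_le qm C0 n0 nM1; have r2 := ratio_le (j:=n.+1) qm C0 isT nM.
  have r3 : t n.+2 <= (1 + C) ^+ 2 * t n.
    by apply: le_trans r2 _; rewrite expr2 -mulrA ler_wpM2l// ltW.
  have C2p : 0 < (1 + C) ^+ 2 by rewrite exprn_gt0.
  apply: (@le_trans _ _ ((t n.+2 / (1 + C) ^+ 2) `^ (al - 3))).
    apply: powR_ge_base => //; [by rewrite divr_gt0|by rewrite ler_pdivrMr// mulrC].
  rewrite powR_div ?(ltW tn2)// mulrC ler_wpM2r ?powR_ge0//.
  have -> : (1 + C) ^+ 6 = ((1 + C) ^+ 2) `^ 3.
    by rewrite -[3 in RHS]/(3%:R) powR_mulrn ?(ltW C2p)// -exprM.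
  apply: ler_powR; last exact: al3m.
  by rewrite exprn_ege1// lerDl.
have al1' : 0 <= (1 - al)^-1 by rewrite invr_ge0 subr_ge0 ltW.
apply: (@le_trans _ _ ((4 * (t n.+2 - t n.+1) ^+ 2) *
  (A * ((1 + C) ^+ 6 * t n.+2 `^ (al - 3))) * ((t n.+2 - t n.+1) `^ (1 - al) / (1 - al)))).
  rewrite ler_wpM2r ?mulr_ge0 ?powR_ge0//; apply: ler_pM => //.
  - by rewrite exprn_even_ge0.
  - by rewrite mulr_ge0 ?powR_ge0.
  - by rewrite ler_wpM2l.
have E : (t n.+2 - t n.+1) ^+ 2 * (t n.+2 - t n.+1) `^ (1 - al) =
   (t n.+2 - t n.+1) `^ (3 - al).
  by rewrite -powR_mulrn ?(ltW hn)// -powR_add//; congr (_ `^ _); ring.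
have -> : (4 * (t n.+2 - t n.+1) ^+ 2) *
  (A * ((1 + C) ^+ 6 * t n.+2 `^ (al - 3))) * ((t n.+2 - t n.+1) `^ (1 - al) / (1 - al)) =
  A * (4 * (1 + C) ^+ 6 / (1 - al)) * (((t n.+2 - t n.+1) ^+ 2 *
  (t n.+2 - t n.+1) `^ (1 - al)) * t n.+2 `^ (al - 3)) by ring.
rewrite E.
have -> : A * (4 * (1 + C) ^+ 6 * C `^ (3 - al) / (1 - al)) * (t 1%N `^ mu * t n.+2 `^ (- mu))
  = A * (4 * (1 + C) ^+ 6 / (1 - al)) * (C `^ (3 - al) * (t 1%N `^ mu * t n.+2 `^ (- mu)))
  by ring.
rewrite ler_wpM2l//.
  apply: mulr_ge0 => //; apply: mulr_ge0 => //; apply: mulr_ge0 => //.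
  by apply: exprn_ge0; exact: ltW.
by apply: (last_pow_u (rho := rho) (M := M)).
Qed.

Lemma trunc_u n : (n < M)%N ->
  `|delta al t U n.+1 - caputo al u (t n.+1)| <=
  Gammainv al * (A * trunc_const al mu C * (t 1%N `^ mu * t n.+1 `^ (- mu))).
Proof.
move=> nM.
have al1' : 0 <= (1 - al)^-1 by rewrite invr_ge0 subr_ge0 ltW.
have ali : 0 <= al^-1 by rewrite invr_ge0 ltW.
have C10 : 0 <= 1 + C by rewrite addr_ge0.
pose K1 := 2 * ((1 - al)^-1 + al^-1) + al^-1 / (1 - al).
pose KD := al^-1 * (5 * (1 + C) + 1) + (1 + C) ^+ 5.
pose KS := 4 * C ^+ 3 * (1 + (al + 1 - mu)^-1) + 16 * C `^ (3 - al).
pose K2 := (al^-1 * (5 * (1 + C)) + 1) * (1 + C) ^+ 3 / (1 - al).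
pose K3 := 4 * (1 + C) ^+ 6 * C `^ (3 - al) / (1 - al).
have K10 : 0 <= K1.
  by apply: addr_ge0; [apply: mulr_ge0 => //; exact: addr_ge0|exact: mulr_ge0].
have KD0 : 0 <= KD.
  apply: addr_ge0; last exact: exprn_ge0.
  by apply: mulr_ge0 => //; apply: addr_ge0 => //; exact: mulr_ge0.
have KS0 : 0 <= KS.
  apply: addr_ge0; last by apply: mulr_ge0 => //; exact: powR_ge0.
  apply: mulr_ge0; first by apply: mulr_ge0 => //; exact: exprn_ge0.
  by rewrite addr_ge0// invr_ge0 subr_ge0 ltW.
have K20 : 0 <= K2.
  apply: mulr_ge0 => //; apply: mulr_ge0; last exact: exprn_ge0.
  by apply: addr_ge0 => //; apply: mulr_ge0 => //; exact: mulr_ge0.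
have K30 : 0 <= K3.
  apply: mulr_ge0 => //; apply: mulr_ge0; last exact: powR_ge0.
  by apply: mulr_ge0 => //; exact: exprn_ge0.
have KE : trunc_const al mu C = K1 + KD * KS + (K2 + K3) by [].
pose Q := t 1%N `^ mu * t n.+1 `^ (- mu).
have Q0 : 0 <= Q by rewrite mulr_ge0 ?powR_ge0.
have KDS : 0 <= KD * KS by exact: mulr_ge0.
case: n nM @Q Q0 => [|n] nM Q Q0.
  apply: le_trans (trunc_u1 nM) _; rewrite ler_wpM2l ?Gammainv_ge0//.
  rewrite powR_addK ?tpos// mulr1 ler_wpM2l// KE -/K1 -addrA lerDl.
  by apply: addr_ge0 => //; exact: addr_ge0.
have [L [iL BL LK]] : exists L : R, [/\
    wintegrable al (t n.+2) (t n.+1) (t n.+2) (fun s => dpiece t U n.+2 n.+1 s - u1 s),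
    `|wint al (t n.+2) (t n.+1) (t n.+2) (fun s => dpiece t U n.+2 n.+1 s - u1 s)| <= L
    & L <= A * (K2 + K3) * Q].
  case: n nM @Q Q0 => [|n] nM Q Q0.
    have [i B] := last_u2 nM; exists (A * K2 * Q); split=> //.
    by rewrite ler_wpM2r// ler_wpM2l// lerDl.
  have [i B] := last_u3 (isT : (1 < n.+2)%N) nM; exists (A * K3 * Q); split=> //.
  by rewrite ler_wpM2r// ler_wpM2l// lerDr.
apply: le_trans (@delta_sub_caputo _ al t n.+2 u u1 U
  (fun j => if j == n.+1 then L else wjump al t n.+2 j * D j) al1 t0 (htm nM) _ _) _.
- move=> j jn s; rewrite in_itv/= => /andP[s0 s1]; apply: d1.
  have jM : (j < M)%N by exact: leq_trans nM.
  by rewrite in_itv/= (le_lt_trans _ s0) ?(lt_le_trans s1) ?tleT ?tge0// ltnW.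
- move=> j; rewrite ltnS leq_eqVlt => /predU1P[->|jn]; first by rewrite eqxx.
  rewrite (ltn_eqF jn); exact: history_u.
rewrite ler_wpM2l ?Gammainv_ge0// big_nat_recr//= eqxx KE.
have -> : A * (K1 + KD * KS + (K2 + K3)) * Q =
  A * K1 * Q + A * KD * (KS * Q) + A * (K2 + K3) * Q by ring.
apply: lerD => //; rewrite -[leLHS]add0r; apply: lerD.
  by apply: mulr_ge0 => //; exact: mulr_ge0.
have -> : \sum_(0 <= j < n.+1) (if j == n.+1 then L else wjump al t n.+2 j * D j) =
    \sum_(0 <= j < n.+1) wjump al t n.+2 j * D j.
  by apply: eq_big_nat => j /andP[_ jn]; rewrite (ltn_eqF jn).
apply: (jump_sum_u (rho := rho) (M := M) al01 qm C0 r01 nM) => //.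
- exact: mulr_ge0.
- by move=> j jn; apply: D_ge0; exact: ltn_trans nM.
- by move=> j jn; apply: D_le; exact: leq_ltn_trans nM.
Qed.

End Fixed.
End TruncationU.

(** * Barriers *)
Section Barrier.
Variable R : realType.
Implicit Types (t U D E : nat -> R).
Implicit Types (al rho nu mu s x y p A C T a b c q : R) (m j n M : nat).

(** Written with pure powers of s + c, so that all derivatives keep the same two-term shape. *)
Definition barrier al c s : R := (s + c) `^ (al - 1) - c * (s + c) `^ (al - 2).

Lemma barrier_alt al c s : 0 < s + c -> barrier al c s = s * (s + c) `^ (al - 2).
Proof.
move=> sc; rewrite /barrier (_ : al - 1 = (al - 2) + 1); last by ring.
by rewrite powR_add// powRr1 ?ltW//; ring.
Qed.

Definition barrier1 al c s : R :=
  (al - 1) * (s + c) `^ (al - 2) - c * ((al - 2) * (s + c) `^ (al - 3)).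
Definition barrier2 al c s : R :=
  (al - 1) * ((al - 2) * (s + c) `^ (al - 3))
  - c * ((al - 2) * ((al - 3) * (s + c) `^ (al - 4))).
Definition barrier3 al c s : R :=
  (al - 1) * ((al - 2) * ((al - 3) * (s + c) `^ (al - 4)))
  - c * ((al - 2) * ((al - 3) * ((al - 4) * (s + c) `^ (al - 5)))).

Lemma is_derive_addpow p c s : 0 < s + c ->
  is_derive s (1:R) (fun s => (s + c) `^ p) (p * (s + c) `^ (p - 1)).
Proof.
have := @is_derive_powR_comp _ (fun s => s + c) 1 s p => H sc.
by have := H sc (is_derive_addr c s); rewrite mulr1.
Qed.

Lemma is_derive_addpow_lin p q c (k l : R) s : 0 < s + c ->
  is_derive s (1:R) (fun s => k * (s + c) `^ p - c * (l * (s + c) `^ q))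
   (k * (p * (s + c) `^ (p - 1)) - c * (l * (q * (s + c) `^ (q - 1)))).
Proof.
move=> sc.
exact: (is_deriveB (is_deriveZ k (is_derive_addpow p sc))
  (is_deriveZ c (is_deriveZ l (is_derive_addpow q sc)))).
Qed.

Lemma is_derive_barrier al c s : 0 < s + c ->
  is_derive s (1:R) (barrier al c) (barrier1 al c s).
Proof.
move=> sc; apply: (is_derive_ext (is_derive_addpow_lin (al - 1) (al - 2) 1 1 sc)).
  by move=> x; rewrite /barrier !mul1r.
rewrite /barrier1 !mul1r; congr (_ * _ `^ _ - _ * (_ * _ `^ _)); ring.
Qed.

Lemma is_derive_barrier1 al c s : 0 < s + c ->
  is_derive s (1:R) (barrier1 al c) (barrier2 al c s).
Proof.
move=> sc; apply: (is_derive_ext (is_derive_addpow_lin _ _ _ _ sc)) => //.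
rewrite /barrier2; congr (_ * (_ * _ `^ _) - _ * (_ * (_ * _ `^ _))); ring.
Qed.

Lemma is_derive_barrier2 al c s : 0 < s + c ->
  is_derive s (1:R) (barrier2 al c) (barrier3 al c s).
Proof.
move=> sc; apply: (is_derive_ext (is_derive_addpow_lin (al - 3) (al - 4)
  ((al - 1) * (al - 2)) ((al - 2) * (al - 3)) sc)).
  by move=> x; rewrite /barrier2 !mulrA.
rewrite /barrier3 -!mulrA; congr (_ * (_ * (_ * _ `^ _)) - _ * (_ * (_ * (_ * _ `^ _)))); ring.
Qed.

Lemma cpow_le c s p : 0 < c -> 0 <= s -> c * (s + c) `^ (p - 1) <= (s + c) `^ p.
Proof.
move=> c0 s0; have sc : 0 < s + c by rewrite ltr_wpDl.
rewrite powR_sub1// mulrCA ler_piMr ?powR_ge0// ler_pdivrMr// mul1r lerDr//.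
Qed.

(** As c <= s + c and |al - i| <= i for i >= 1, the constants here and in the next two bounds are 1
    + 2, then 1 * 2 + 2 * 3, then 1 * 2 * 3 + 2 * 3 * 4. *)
Lemma barrier1_bound al c s : 0 < al < 1 -> 0 < c -> 0 <= s ->
  `|barrier1 al c s| <= 3 * (s + c) `^ (al - 2).
Proof.
move=> /andP[al0 al1] c0 s0; have sc : 0 < s + c by rewrite ltr_wpDl.
have p1 := powR_ge0 (s + c) (al - 2).
have p2 := powR_ge0 (s + c) (al - 3).
have := cpow_le (al - 2) c0 s0; rewrite (_ : al - 2 - 1 = al - 3); last by ring.
set X := (s + c) `^ (al - 2) in p1 *; set Y := (s + c) `^ (al - 3) in p2 * => cY.
have cY0 : 0 <= c * Y by rewrite mulr_ge0// ltW.
rewrite /barrier1 -/X -/Y; apply: le_trans (ler_normB _ _) _.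
have -> : 3 * X = X + 2 * X by ring.
apply: lerD; first by rewrite normrM (ger0_norm p1) ler_piMl// ler_norml; lra.
rewrite mulrCA normrM (ger0_norm cY0); apply: ler_pM => //.
by rewrite ler_norml; lra.
Qed.

Lemma barrier2_bound al c s : 0 < al < 1 -> 0 < c -> 0 <= s ->
  `|barrier2 al c s| <= 8 * (s + c) `^ (al - 3).
Proof.
move=> /andP[al0 al1] c0 s0; have sc : 0 < s + c by rewrite ltr_wpDl.
have p1 := powR_ge0 (s + c) (al - 3).
have p2 := powR_ge0 (s + c) (al - 4).
have := cpow_le (al - 3) c0 s0; rewrite (_ : al - 3 - 1 = al - 4); last by ring.
set X := (s + c) `^ (al - 3) in p1 *; set Y := (s + c) `^ (al - 4) in p2 * => cY.
have cY0 : 0 <= c * Y by rewrite mulr_ge0// ltW.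
rewrite /barrier2 -/X -/Y; apply: le_trans (ler_normB _ _) _.
have -> : 8 * X = 1 * (2 * X) + 2 * (3 * X) by ring.
apply: lerD.
  rewrite !normrM (ger0_norm p1); apply: ler_pM; rewrite ?mulr_ge0 ?(ltW c0)//.
    by rewrite ler_norml; lra.
  by rewrite ler_wpM2r// ler_norml; lra.
have -> : c * ((al - 2) * ((al - 3) * Y)) = (al - 2) * ((al - 3) * (c * Y)) by ring.
rewrite !normrM -normrM (ger0_norm cY0); apply: ler_pM; rewrite ?mulr_ge0 ?(ltW c0)//.
  by rewrite ler_norml; lra.
by apply: ler_pM => //; rewrite ler_norml; lra.
Qed.

Lemma barrier3_bound al c s : 0 < al < 1 -> 0 < c -> 0 <= s ->
  `|barrier3 al c s| <= 30 * (s + c) `^ (al - 4).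
Proof.
move=> /andP[al0 al1] c0 s0; have sc : 0 < s + c by rewrite ltr_wpDl.
have p1 := powR_ge0 (s + c) (al - 4).
have p2 := powR_ge0 (s + c) (al - 5).
have := cpow_le (al - 4) c0 s0; rewrite (_ : al - 4 - 1 = al - 5); last by ring.
set X := (s + c) `^ (al - 4) in p1 *; set Y := (s + c) `^ (al - 5) in p2 * => cY.
have cY0 : 0 <= c * Y by rewrite mulr_ge0// ltW.
rewrite /barrier3 -/X -/Y; apply: le_trans (ler_normB _ _) _.
have -> : 30 * X = 1 * (2 * (3 * X)) + 2 * (3 * (4 * X)) by ring.
apply: lerD.
  rewrite !normrM (ger0_norm p1); apply: ler_pM; rewrite ?mulr_ge0 ?(ltW c0)//.
    by rewrite ler_norml; lra.
  apply: ler_pM; rewrite ?mulr_ge0 ?(ltW c0)//; first by rewrite ler_norml; lra.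
  by rewrite ler_wpM2r// ler_norml; lra.
have -> : c * ((al - 2) * ((al - 3) * ((al - 4) * Y))) =
   (al - 2) * ((al - 3) * ((al - 4) * (c * Y))) by ring.
rewrite (normrM (al - 2)) (normrM (al - 3)) (normrM (al - 4)) (ger0_norm cY0).
apply: ler_pM; rewrite ?mulr_ge0 ?(ltW c0)//; first by rewrite ler_norml; lra.
apply: ler_pM; rewrite ?mulr_ge0 ?(ltW c0)//; first by rewrite ler_norml; lra.
by apply: ler_pM => //; rewrite ler_norml; lra.
Qed.

Lemma prim_derive2 (f f' f'' : R -> R) a b :
  {in `[a, b]%R, forall s, is_derive s (1:R) f (f' s)} ->
  {in `]a, b[%R, forall s, is_derive s (1:R) f' (f'' s)} -> prim f f' a b.
Proof.
move=> df df'; split.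
- by apply: derivable_within_continuous => s sab; have := df s sab => -[].
- by move=> s sab; apply: df; exact: subset_itv_oo_cc.
- by move=> s sab; exact: is_derive_continuous (df' s sab).
Qed.

Lemma prim_addpow p c a b : 0 < c -> 0 <= a ->
  prim (fun s => (s + c) `^ p) (fun s => p * (s + c) `^ (p - 1)) a b.
Proof.
move=> c0 a0.
apply: (@prim_derive2 _ _ (fun s => p * ((p - 1) * (s + c) `^ (p - 1 - 1)))) => s;
  rewrite in_itv/= => /andP[sa _].
  by apply: is_derive_addpow; rewrite ltr_wpDl// (le_trans a0).
apply: is_deriveZ; apply: is_derive_addpow; rewrite ltr_wpDl// (le_trans a0)//.
exact: ltW.
Qed.

(* The substitution y = (T - s) / (s + c) turns the integrand into
   (T + c)^-2 ((c - (1 - al) T) y^-al + (2 - al) c y^(1 - al)) dy. *)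
Lemma caputo_barrier al c T : 0 < al < 1 -> 0 < c -> 0 < T ->
  caputo al (barrier al c) T =
  Gammainv al * (c `^ al * T `^ (1 - al) * (T + c) `^ (- 2) / (1 - al)).
Proof.
move=> al01 c0 T0; have /andP[al0 al1] := al01; rewrite /caputo; congr (_ * _).
have Tc : 0 < T + c by rewrite addr_gt0.
have d0 : 1 - al != 0 by rewrite subr_eq0 gt_eqF.
(* This is y, in a form whose derivative is a single power. *)
pose h s := (T + c) * (s + c) `^ (-1) - 1.
pose h' s := (T + c) * (-1 * (s + c) `^ (-1 - 1)) - 0.
have ph : prim h h' 0 T.
  exact: primB (primZ (T + c) (prim_addpow (-1) T c0 (lexx 0))) (prim_cst 1 0 T).
have hE s : 0 <= s -> h s = (T - s) / (s + c).
  move=> s0; have sc : 0 < s + c by rewrite ltr_wpDl.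
  by rewrite /h powR_inv1 ?(ltW sc)//; field; rewrite gt_eqF.
have hpos : {in `]0, T[%R, forall s, 0 < h s}.
  move=> s; rewrite in_itv/= => /andP[s0 sT].
  by rewrite hE ?(ltW s0)// divr_gt0 ?subr_gt0// addr_gt0.
have hge0 : {in `[0, T]%R, forall s, 0 <= h s}.
  move=> s; rewrite in_itv/= => /andP[s0 sT].
  by rewrite hE// divr_ge0 ?subr_ge0// addr_ge0// ltW.
have p1 : 0 < 1 - al by rewrite subr_gt0.
have p2 : 0 < 2 - al by lra.
(* The sign reflects that y decreases in s; the bracket multiplied by [k] in [pF] is the
   antiderivative in y. *)
pose k := - (T + c) `^ (- 2).
have pF := primZ k (primD (primZ (c / (1 - al) - T) (prim_powR_comp p1 ph hpos hge0))
  (primZ c (prim_powR_comp p2 ph hpos hge0))).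
have feq : {in `]0, T[%R, (fun s => k * ((c / (1 - al) - T) *
     ((1 - al) * h s `^ (1 - al - 1) * h' s) + c * ((2 - al) * h s `^ (2 - al - 1) * h' s)))
   =1 (fun s => (T - s) `^ (- al) * barrier1 al c s)}.
  move=> s sI; have hs := hpos s sI; move: sI; rewrite in_itv/= => /andP[s0 sT].
  have sc : 0 < s + c by rewrite addr_gt0.
  have Ts : 0 < T - s by rewrite subr_gt0.
  have e1 : h s `^ (1 - al - 1) = (T - s) `^ (- al) * (s + c) `^ al.
    rewrite hE ?(ltW s0)// (_ : 1 - al - 1 = - al); last by ring.
    by rewrite powR_div ?(ltW Ts)// opprK.
  have e2 : h s `^ (2 - al - 1) = (T - s) / (s + c) * h s `^ (1 - al - 1).
    rewrite -[X in X / _ * _]/(T - s) -hE ?(ltW s0)// -{2}[h s]powRr1 ?(ltW hs)//.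
    by rewrite -powR_add//; congr (_ `^ _); ring.
  have e3 : (T + c) `^ (- 2) = (T + c) ^- 2.
    by rewrite -[2 in LHS]/(2%:R) powR_invn// ltW.
  have e4 : (s + c) `^ (-1 - 1) = (s + c) ^- 2.
    by rewrite (_ : -1 - 1 = - (2%:R)) ?powR_invn ?(ltW sc)//; ring.
  have e5 : (s + c) `^ (al - 2) = (s + c) `^ al / (s + c) ^+ 2.
    by rewrite powR_add// -[2 in LHS]/(2%:R) powR_invn// ltW.
  have e6 : (s + c) `^ (al - 3) = (s + c) `^ al / (s + c) ^+ 3.
    by rewrite powR_add// -[3 in LHS]/(3%:R) powR_invn// ltW.
  rewrite /barrier1 /h' /k e2 e1 e3 e4 e5 e6; field.
  by rewrite d0 !gt_eqF.
have pF' := prim_eq (fun s _ => erefl) feq pF.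
(* The integrand changes sign, so a multiple of the kernel serves as majorant. *)
have c2 : 0 <= c `^ (al - 2) by exact: powR_ge0.
have [|i E] := prim_dom T0 pF' (primZ (3 * c `^ (al - 2)) (prim_weight 0 al1 (lexx T))).
  move=> s; rewrite in_itv/= => /andP[s0 sT].
  rewrite normrM (ger0_norm (powR_ge0 _ _)) mulrC ler_wpM2r ?powR_ge0//.
  apply: le_trans (barrier1_bound al01 c0 (ltW s0)) _; rewrite ler_wpM2l//.
  by apply: powR_ge_base => //; [lra|rewrite lerDr ltW].
transitivity (\int[lebesgue_measure]_(s in `]0, T[) ((T - s) `^ (- al) * barrier1 al c s)).
  apply: eq_Rintegral => s /set_mem /=; rewrite in_itv/= => /andP[s0 sT].
  rewrite derive1E; have [_ ->//] := is_derive_barrier al (addr_gt0 s0 c0).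
(* y = 0 at s = T, so only the value y = T / c at s = 0 contributes. *)
rewrite E (hE T (ltW T0)) (hE 0 (lexx 0)) subrr mul0r subr0 add0r.
rewrite !powR0 ?(gt_eqF p1) ?(gt_eqF p2)// !mulr0 add0r mulr0 sub0r.
have e1 : (T / c) `^ (2 - al) = T / c * (T / c) `^ (1 - al).
  rewrite -{2}[T / c]powRr1 ?divr_ge0 ?(ltW T0) ?(ltW c0)//.
  by rewrite -powR_add ?divr_gt0//; congr (_ `^ _); ring.
have e2 : (T / c) `^ (1 - al) = T `^ (1 - al) * (c `^ al / c).
  by rewrite powR_div ?(ltW T0)// opprB powR_sub1.
rewrite e1 e2 /k; field.
by rewrite d0 gt_eqF.
Qed.

End Barrier.

(** * The discrete operator on a barrier *)

Section BarrierDelta.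
Variable R : realType.
Implicit Types (t U D E : nat -> R).
Implicit Types (al rho nu mu s x y p A C T a b c q : R) (m j n M : nat).

Section Fixed.
Variables (al rho C c : R) (M : nat) (t : nat -> R).
Hypotheses (al01 : 0 < al < 1) (r01 : 0 < rho <= 1) (C1 : 1 <= C) (c0 : 0 < c).
Hypotheses (qm : qmesh C rho M t) (M0 : (0 < M)%N) (t1c : t 1%N <= c).
Variables (B B1 B2 B3 : R -> R).
Hypothesis derB : forall s, 0 <= s -> is_derive s (1:R) B (B1 s).
Hypothesis derB1 : forall s, 0 <= s -> is_derive s (1:R) B1 (B2 s).
Hypothesis derB2 : forall s, 0 <= s -> is_derive s (1:R) B2 (B3 s).
Hypothesis bound2 : forall s, 0 <= s -> `|B2 s| <= 8 * (s + c) `^ (al - 3).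
Hypothesis bound3 : forall s, 0 <= s -> `|B3 s| <= 30 * (s + c) `^ (al - 4).

Let U j := B (t j).
Let al0 : 0 < al. Proof. by have /andP[] := al01. Qed.
Let al1 : al < 1. Proof. by have /andP[] := al01. Qed.
Let C0 : 0 <= C. Proof. exact: le_trans C1. Qed.
Let t0 : t 0%N = 0. Proof. by have [] := qm. Qed.
Let ht : increasing_to t M. Proof. by have [] := qm. Qed.
Let htm m : (m <= M)%N -> increasing_to t m.
Proof. by move=> mM j jm; apply: ht; exact: leq_trans mM. Qed.
Let tge0 j : (j <= M)%N -> 0 <= t j.
Proof. by move=> jM; rewrite -t0; apply: (increasing_le ht). Qed.
Let tpos j : (0 < j <= M)%N -> 0 < t j. Proof. exact: qmesh_pos qm. Qed.
Let al3n : al - 3 <= 0. Proof. by have /andP[] := al01; lra. Qed.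
Let al4n : al - 4 <= 0. Proof. by have /andP[] := al01; lra. Qed.
Let al4m : - (al - 4) <= 4. Proof. by have /andP[] := al01; lra. Qed.
Let al1' : 0 <= (1 - al)^-1. Proof. by rewrite invr_ge0 subr_ge0 ltW. Qed.
Let C1p : 0 < 1 + C. Proof. by rewrite ltr_pwDl. Qed.

Let contB a b : 0 <= a -> {within `[a, b], continuous B}.
Proof.
move=> a0; apply: derivable_within_continuous => x; rewrite in_itv/= => /andP[ax _].
by have [] := derB (le_trans a0 ax).
Qed.
Let contB1 n : (n < M)%N ->
  {in `]t n, t n.+1[%R, forall s, {for s, continuous B1}}.
Proof.
move=> nM s; rewrite in_itv/= => /andP[s1 _]; apply: (is_derive_continuous (derB1 _)).
by apply: le_trans (ltW s1); apply/tge0/ltnW.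
Qed.

Lemma barrier_quad_error3 (a : nat) (G : R) : (a.+2 <= M)%N ->
  G = (t a.+2 - t a) ^+ 2 * (30 * (t a + c) `^ (al - 4)) ->
  {in `]t a, t a.+2[%R, forall s, `|dquad t U a s - B1 s| <= G}.
Proof.
move=> aM -> s sI; rewrite distrC.
have ta : 0 <= t a by apply/tge0/ltnW/ltnW.
have pos x : x \in `]t a, t a.+2[%R -> 0 <= x /\ t a <= x.
  by rewrite in_itv/= => /andP[/ltW xa _]; split => //; exact: le_trans xa.
apply: (@quad_interp_error3 _ t U a B B1 B2
  _ _ _ _ _ _ B3) => //.
- exact/ht/ltnW.
- exact: ht.
- exact: contB.
- by move=> x /pos[x0 _]; exact: derB.
- by move=> x /pos[x0 _]; exact: derB1.
- by move=> x /pos[x0 _]; exact: derB2.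
- move=> x /pos[x0 ax]; apply: le_trans (bound3 x0) _.
  rewrite ler_wpM2l//; apply: powR_ge_base => //; last by rewrite lerD2r.
  by rewrite ltr_wpDl.
Qed.

Let B2bound x : 0 <= x -> `|B2 x| <= 8 * c `^ (al - 3).
Proof.
move=> x0; apply: le_trans (bound2 x0) _; rewrite ler_wpM2l//.
by apply: powR_ge_base => //; rewrite lerDr.
Qed.

(** Meant for nodes below c, where s + c is comparable to c. Every step is at most the last one; the
    constant is 2 * 2 * 8. *)
Lemma barrier_error2 n j : (n < M)%N -> (j <= n)%N ->
  {in `]t j, t j.+1[%R, forall s, `|dpiece t U n.+1 j s - B1 s| <=
     32 * ((t n.+1 - t n) * c `^ (al - 3))}.
Proof.
move=> nM jn s sI.
have hn : 0 < t n.+1 - t n by rewrite subr_gt0; exact: ht.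
have c3 : 0 <= c `^ (al - 3) by exact: powR_ge0.
have hc : 0 <= (t n.+1 - t n) * c `^ (al - 3) by rewrite mulr_ge0// ltW.
rewrite distrC /dpiece; case: ifPn => n1.
  have nn : n = 0%N by move/eqP: n1 => [].
  have jj : j = 0%N by apply/eqP; rewrite -leqn0 -nn.
  rewrite nn jj in hn hc sI *.
  have pos x : x \in `]t 0%N, t 1%N[%R -> 0 <= x.
    by rewrite in_itv/= t0 => /andP[/ltW].
  apply: (@le_trans _ _ ((t 1%N - t 0%N) * (8 * c `^ (al - 3)))); last first.
    by rewrite mulrCA ler_wpM2r// ler_nat.
  apply: (@linear_interp_error _ t U B B1 B2) => //.
  - exact: ht.
  - by apply: contB; rewrite t0.
  - by move=> x /pos; exact: derB.
  - by move=> x /pos; exact: derB1.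
  - by move=> x /pos; exact: B2bound.
have hm : increasing_to t n.+1 by exact: htm.
have [sm h1 h2 h3 h4] := stencil_cell hm (jn : (j < n.+1)%N) n1.
set a := stencil n.+1 j in sm h1 h2 h3 h4 *.
have a1M : (a.+1 < M)%N by exact: leq_trans nM.
have ta : 0 <= t a by apply/tge0/ltnW/ltnW.
have pos x : x \in `]t a, t a.+2[%R -> 0 <= x.
  by rewrite in_itv/= => /andP[/ltW xa _]; exact: le_trans xa.
apply: (@le_trans _ _ ((t a.+2 - t a) * (2 * (8 * c `^ (al - 3))))).
  apply: (@quad_interp_error2 _ t U a B B1 B2) => //.
  - exact: contB.
  - by move=> x /pos; exact: derB.
  - by move=> x /pos; exact: derB1.
  - by move=> x /pos; exact: B2bound.
  - move: sI; rewrite !in_itv/= => /andP[s1 s2].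
    by rewrite (le_lt_trans h1 s1) (lt_le_trans s2 h2).
have s1 := step_le (i := a) (j := n) qm.
have s2 := step_le (i := a.+1) (j := n) qm.
have l1 : t a.+1 - t a <= t n.+1 - t n by apply: s1; rewrite nM andbT ltnW.
have l2 : t a.+2 - t a.+1 <= t n.+1 - t n by apply: s2; rewrite nM andbT.
have -> : 32 * ((t n.+1 - t n) * c `^ (al - 3)) =
  (2 * (t n.+1 - t n)) * (2 * (8 * c `^ (al - 3))) by ring.
rewrite ler_wpM2r ?mulr_ge0//; lra.
Qed.

(** No cancellation is used: a uniform error is integrated against the kernel, and the cell
    integrals telescope. *)
Lemma barrier_delta_near n : (n < M)%N ->
  `|delta al t U n.+1 - caputo al B (t n.+1)| <=
  Gammainv al * (32 * ((t n.+1 - t n) * c `^ (al - 3)) * t n.+1 `^ (1 - al) / (1 - al)).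
Proof.
move=> nM; set d := 32 * _.
have tn : 0 < t n.+1 by exact: tpos.
have hm := htm nM.
apply: le_trans (@delta_sub_caputo _ al t n.+1 B B1 U
  (fun j => d * (((t n.+1 - t j) `^ (1 - al) - (t n.+1 - t j.+1) `^ (1 - al)) / (1 - al)))
  al1 t0 hm _ _) _.
- move=> j jn s; rewrite in_itv/= => /andP[s0 s1]; apply: derB.
  apply: le_trans (ltW s0); apply: tge0; apply: ltnW; exact: leq_trans jn nM.
- move=> j jn; have jM : (j < M)%N by exact: leq_trans jn nM.
  apply: wint_bound => //.
  + exact: ht.
  + by apply: (increasing_le hm); rewrite jn leqnn.
  + move=> s sI; apply: cvgB; last exact: contB1 jM s sI.
    exact: is_derive_continuous (is_derive_dpiece t U n.+1 j s).
  + exact: barrier_error2.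
rewrite ler_wpM2l ?Gammainv_ge0// -mulr_sumr -mulr_suml -mulrA.
have -> : \sum_(0 <= i < n.+1) ((t n.+1 - t i) `^ (1 - al) - (t n.+1 - t i.+1) `^ (1 - al)) =
   t n.+1 `^ (1 - al).
  under eq_bigr do rewrite -opprB.
  rewrite sumrN telescope_sumr// opprB subrr powR0 ?subr0 ?t0 ?subr0//.
  by rewrite subr_eq0 gt_eqF.
by [].
Qed.

(** At j = 0 the ratio of nodes is infinite, and t_1 <= c takes over. *)
Lemma shift_ratio j : (j < M)%N -> t j.+1 + c <= (1 + C) * (t j + c).
Proof.
case: j => [|j] jM.
  rewrite t0 add0r mulrDl mul1r addrC lerD2l.
  by apply: le_trans t1c _; rewrite ler_peMl// ltW.
rewrite mulrDr; apply: lerD; first exact: ratio_le qm C0 _ _.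
by rewrite ler_peMl ?(ltW c0)// lerDl.
Qed.

Lemma pow_ratio x y : 0 < x -> 0 < y -> y <= (1 + C) * x ->
  x `^ (al - 4) <= (1 + C) ^+ 4 * y `^ (al - 4).
Proof.
move=> x0 y0 yx.
apply: (@le_trans _ _ ((y / (1 + C)) `^ (al - 4))).
  by apply: powR_ge_base => //; [rewrite divr_gt0|rewrite ler_pdivrMr// mulrC].
rewrite powR_div ?(ltW y0)// mulrC ler_wpM2r ?powR_ge0//.
by rewrite -powR_mulrn ?(ltW C1p)//; apply: ler_powR; rewrite ?lerDl.
Qed.

Let xpos j : (j <= M)%N -> 0 < t j + c.
Proof. by move=> jM; rewrite ltr_wpDl// tge0. Qed.

Let D j : R := (t j.+1 - t j) * ((t j.+2 - t j) ^+ 2 * (30 * (t j + c) `^ (al - 4))).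

Lemma DB_ge0 j : (j < M)%N -> 0 <= D j.
Proof.
move=> jM; apply: mulr_ge0; first by rewrite subr_ge0; apply/ltW/ht.
by apply: mulr_ge0; [exact: exprn_even_ge0|rewrite mulr_ge0 ?powR_ge0].
Qed.

Lemma DB_le j : (j.+1 < M)%N ->
  D j <= 30 * (1 + C) ^+ 6 * ((t j.+1 - t j) ^+ 3 * (t j.+1 + c) `^ (al - 4)).
Proof.
move=> jM; have jM' := ltnW jM; have C10 := ltW C1p.
have hj : 0 < t j.+1 - t j by rewrite subr_gt0; exact: ht.
have hj2 : t j.+2 - t j <= (1 + C) * (t j.+1 - t j).
  have [_ _ h _] := qm; have /andP[_ hh] := h j jM.
  have -> : t j.+2 - t j = (t j.+1 - t j) + (t j.+2 - t j.+1) by ring.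
  by rewrite mulrDl mul1r lerD2l.
have hj20 : 0 <= t j.+2 - t j.
  by rewrite subr_ge0; apply: (increasing_le ht); rewrite jM !leqW.
have e1 : (t j.+2 - t j) ^+ 2 <= (1 + C) ^+ 2 * (t j.+1 - t j) ^+ 2.
  by rewrite -exprMn; apply: lerXn2r => //; rewrite nnegrE mulr_ge0// ltW.
have e2 := pow_ratio (xpos (ltnW jM')) (xpos jM') (shift_ratio jM').
have -> : 30 * (1 + C) ^+ 6 * ((t j.+1 - t j) ^+ 3 * (t j.+1 + c) `^ (al - 4)) =
  (t j.+1 - t j) * (((1 + C) ^+ 2 * (t j.+1 - t j) ^+ 2) *
    (30 * ((1 + C) ^+ 4 * (t j.+1 + c) `^ (al - 4)))) by ring.
rewrite ler_wpM2l ?(ltW hj)//; apply: ler_pM => //.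
- by rewrite exprn_even_ge0.
- by rewrite mulr_ge0 ?powR_ge0.
- by rewrite ler_wpM2l.
Qed.

Lemma history_barrier n j : (n < M)%N -> (j < n)%N ->
  wintegrable al (t n.+1) (t j) (t j.+1) (fun s => dpiece t U n.+1 j s - B1 s) /\
  `|wint al (t n.+1) (t j) (t j.+1) (fun s => dpiece t U n.+1 j s - B1 s)| <=
    wjump al t n.+1 j * D j.
Proof.
move=> nM jn; have jM := ltn_trans jn nM.
have hn1 := htm nM.
have tj0 := tge0 (ltnW jM).
have pu : prim B B1 (t j) (t j.+1).
  apply: (@prim_derive2 _ _ _ B2) => s; rewrite in_itv/= => /andP[sa _].
    by apply/derB/(le_trans tj0).
  by apply/derB1/(le_trans tj0)/ltW.
have n1 : (n.+1 == 1)%N = false by rewrite eqSS; case: n jn {nM hn1}.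
have sten : stencil n.+1 j = j by rewrite /stencil ltnS jn.
pose g := (t j.+2 - t j) ^+ 2 * (30 * (t j + c) `^ (al - 4)).
have pG := primZ g (prim_lin (t j) (t j.+1)).
have j2M : (j.+2 <= M)%N by exact: leq_trans nM.
have [|i Bd] := history_cell (U := U) al01 hn1 (jn : (j.+1 < n.+1)%N) pu erefl erefl pG.
  move=> s sj; rewrite mulr1 /dpiece n1 sten.
  apply: (barrier_quad_error3 j2M erefl).
  move: sj; rewrite !in_itv/= => /andP[-> sj] /=.
  by apply: lt_trans sj _; exact: ht.
split=> //; apply: le_trans Bd _.
rewrite le_eqVlt; apply/orP; left; apply/eqP; rewrite /g /D; ring.
Qed.

Hypothesis nu1 : al < (3 - al) * rho.
Let nu := (3 - al) * rho.

(** The constant collects 4 from the width of the stencil, 30 from the third derivative, and (1 +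
    C)^8 from moving the evaluation point across two cells. *)
Lemma last_barrier n : (n.+1 < M)%N -> c <= t n.+2 ->
  wintegrable al (t n.+2) (t n.+1) (t n.+2) (fun s => dpiece t U n.+2 n.+1 s - B1 s) /\
  `|wint al (t n.+2) (t n.+1) (t n.+2) (fun s => dpiece t U n.+2 n.+1 s - B1 s)| <=
   120 * (1 + C) ^+ 8 * C `^ (3 - al) / (1 - al) *
   (t 1%N `^ nu * (c `^ (al - nu) * t n.+2 `^ (- al - 1))).
Proof.
move=> nM cT; have C10 := ltW C1p.
have nM1 := ltnW nM; have nM2 := ltnW nM1.
have hn : 0 < t n.+2 - t n.+1 by rewrite subr_gt0; exact: ht.
pose g := (t n.+2 - t n) ^+ 2 * (30 * (t n + c) `^ (al - 4)).
have [|i Bd] := last_cell (U:=U) (d := g) al1 (htm nM) (contB1 nM).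
  move=> s; rewrite /dpiece /stencil /= ltnn in_itv/= => /andP[s1 s2].
  apply: (barrier_quad_error3 nM erefl).
  by rewrite in_itv/= s2 andbT; apply: lt_trans s1; exact: ht.
split=> //; apply: le_trans Bd _.
have e1 : (t n.+2 - t n) ^+ 2 <= 4 * (t n.+2 - t n.+1) ^+ 2.
  have -> : 4 * (t n.+2 - t n.+1) ^+ 2 = (2 * (t n.+2 - t n.+1)) ^+ 2 by ring.
  have h0 : t n < t n.+1 by exact: ht.
  have h1 : t n.+1 - t n <= t n.+2 - t n.+1.
    by have [_ _ h _] := qm; have /andP[] := h n nM.
  have -> : t n.+2 - t n = (t n.+1 - t n) + (t n.+2 - t n.+1) by ring.
  apply: lerXn2r; rewrite ?nnegrE ?mulr_ge0 ?(ltW hn)//.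
    by rewrite addr_ge0 ?(ltW hn)// subr_ge0 ltW.
  by rewrite [leRHS]mulr_natl mulr2n lerD2r.
have e2 : (t n + c) `^ (al - 4) <= (1 + C) ^+ 8 * (t n.+2 + c) `^ (al - 4).
  apply: le_trans (pow_ratio (xpos nM2) (xpos nM1) (shift_ratio nM1)) _.
  have -> : (1 + C) ^+ 8 * (t n.+2 + c) `^ (al - 4) =
    (1 + C) ^+ 4 * ((1 + C) ^+ 4 * (t n.+2 + c) `^ (al - 4)) by ring.
  rewrite ler_wpM2l ?exprn_ge0//.
  exact: pow_ratio (xpos nM1) (xpos nM) (shift_ratio nM).
apply: (@le_trans _ _ ((4 * (t n.+2 - t n.+1) ^+ 2) *
  (30 * ((1 + C) ^+ 8 * (t n.+2 + c) `^ (al - 4))) *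
  ((t n.+2 - t n.+1) `^ (1 - al) / (1 - al)))).
  rewrite ler_wpM2r ?mulr_ge0 ?powR_ge0//; apply: ler_pM => //.
  - by rewrite exprn_even_ge0.
  - by rewrite mulr_ge0 ?powR_ge0.
  - by rewrite ler_wpM2l.
have E : (t n.+2 - t n.+1) ^+ 2 * (t n.+2 - t n.+1) `^ (1 - al) =
   (t n.+2 - t n.+1) `^ (3 - al).
  by rewrite -powR_mulrn ?(ltW hn)// -powR_add//; congr (_ `^ _); ring.
have -> : (4 * (t n.+2 - t n.+1) ^+ 2) *
  (30 * ((1 + C) ^+ 8 * (t n.+2 + c) `^ (al - 4))) *
  ((t n.+2 - t n.+1) `^ (1 - al) / (1 - al)) =
  120 * (1 + C) ^+ 8 / (1 - al) * (((t n.+2 - t n.+1) ^+ 2 *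
  (t n.+2 - t n.+1) `^ (1 - al)) * (t n.+2 + c) `^ (al - 4)) by ring.
rewrite E.
have -> : 120 * (1 + C) ^+ 8 * C `^ (3 - al) / (1 - al) *
   (t 1%N `^ nu * (c `^ (al - nu) * t n.+2 `^ (- al - 1))) =
  120 * (1 + C) ^+ 8 / (1 - al) * (C `^ (3 - al) *
   (t 1%N `^ nu * (c `^ (al - nu) * t n.+2 `^ (- al - 1)))) by ring.
rewrite ler_wpM2l//.
  by apply: mulr_ge0 => //; apply: mulr_ge0 => //; exact: exprn_ge0.
exact: (last_pow_b (M := M)).
Qed.

Definition far_const : R :=
  30 * (1 + C) ^+ 6 * (4 * C ^+ 3 * (nu - al)^-1 + 16 * C `^ (3 - al))
  + 120 * (1 + C) ^+ 8 * C `^ (3 - al) / (1 - al).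

(** For t >= c the Caputo derivative is of order c^al t^(-al - 1); this error is smaller by the
    factor (t_1 / c)^nu. *)
Lemma barrier_delta_far n : (n.+1 < M)%N -> c <= t n.+2 ->
  `|delta al t U n.+2 - caputo al B (t n.+2)| <=
  Gammainv al * (far_const * (t 1%N `^ nu * (c `^ (al - nu) * t n.+2 `^ (- al - 1)))).
Proof.
move=> nM cT; have [iL BL] := last_barrier nM cT; set L := (_ * _ in leRHS) in BL.
apply: le_trans (@delta_sub_caputo _ al t n.+2 B B1 U
  (fun j => if j == n.+1 then L else wjump al t n.+2 j * D j) al1 t0 (htm nM) _ _) _.
- move=> j jn s; rewrite in_itv/= => /andP[s0 s1]; apply: derB.
  apply: le_trans (ltW s0); apply: tge0; apply: ltnW; exact: leq_trans jn nM.
- move=> j; rewrite ltnS leq_eqVlt => /predU1P[->|jn]; first by rewrite eqxx.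
  rewrite (ltn_eqF jn); exact: history_barrier.
rewrite ler_wpM2l ?Gammainv_ge0// big_nat_recr//= eqxx /far_const [leRHS]mulrDl.
apply: lerD => //.
have -> : \sum_(0 <= j < n.+1) (if j == n.+1 then L else wjump al t n.+2 j * D j) =
    \sum_(0 <= j < n.+1) wjump al t n.+2 j * D j.
  by apply: eq_big_nat => j /andP[_ jn]; rewrite (ltn_eqF jn).
rewrite -mulrA.
apply: (jump_sum_b (rho := rho) (M := M) al01 qm C0 r01 nM) => //.
- by apply: mulr_ge0 => //; apply: exprn_ge0; exact: ltW.
- by move=> j jn; apply: DB_ge0; exact: ltn_trans nM.
- by move=> j jn; apply: DB_le; exact: leq_ltn_trans nM.
Qed.

End Fixed.
End BarrierDelta.

(** * Lower bound for the operator on a barrier *)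

Section BarrierLower.
Variable R : realType.
Implicit Types (t U W D E : nat -> R).
Implicit Types (al rho nu mu s x y p A C T a b c q sbar : R) (m j n M N : nat).

Lemma sub_le_of_dist x y z : `|x - y| <= z -> y - z <= x.
Proof. by rewrite ler_norml => /andP[]; lra. Qed.

Lemma powR_neg2 x : 0 < x -> x `^ (- 2) = (x ^+ 2)^-1.
Proof. by move=> x0; rewrite -[2 in LHS]/(2%:R) powR_invn// ltW. Qed.

Lemma root_bound x y p z : 0 <= x -> 0 < p -> 0 <= z -> x `^ p^-1 * z <= y ->
  x * z `^ p <= y `^ p.
Proof.
move=> x0 p0 z0 h.
have -> : x = (x `^ p^-1) `^ p by rewrite -powRrM mulVf ?gt_eqF// powRr1.
by rewrite -powRM ?powR_ge0//; apply: powR_le_base; rewrite ?mulr_ge0 ?powR_ge0// ltW.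
Qed.

Lemma far_const_ge0 al rho C : 0 < al < 1 -> 1 <= C -> al < (3 - al) * rho ->
  0 <= far_const al rho C.
Proof.
move=> /andP[al0 al1] C1 nu; have C0 : 0 <= C by exact: le_trans C1.
have C10 : 0 <= 1 + C by exact: addr_ge0.
have al1' : 0 <= (1 - al)^-1 by rewrite invr_ge0 subr_ge0 ltW.
rewrite /far_const; apply: addr_ge0.
  apply: mulr_ge0; first by apply: mulr_ge0 => //; exact: exprn_ge0.
  apply: addr_ge0; last by apply: mulr_ge0 => //; exact: powR_ge0.
  apply: mulr_ge0; last by rewrite invr_ge0 subr_ge0 ltW.
  by apply: mulr_ge0 => //; exact: exprn_ge0.
apply: mulr_ge0 => //; apply: mulr_ge0; last exact: powR_ge0.
by apply: mulr_ge0 => //; exact: exprn_ge0.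
Qed.

(** Half of the exact value survives when the truncation error is at most the other half. The
    relative error is O((t_1 / c)^rho) if t_m < c and O((t_1 / c)^nu) if t_m >= c. *)
Lemma barrier_delta_ge al rho C : 0 < al < 1 -> 0 < rho <= 1 -> 1 <= C ->
  al < (3 - al) * rho ->
  exists2 P : R, 1 < P & forall M t c m, qmesh C rho M t -> (0 < m <= M)%N ->
    P * t 1%N <= c ->
    Gammainv al * (c `^ al * t m `^ (1 - al) * (t m + c) `^ (- 2) / (1 - al) / 2) <=
    delta al t (fun j => barrier al c (t j)) m.
Proof.
move=> al01 r01 C1 nu1; have /andP[al0 al1] := al01; have /andP[r0 r1] := r01.
have C0 : 0 <= C by exact: le_trans C1.
have Kf := far_const_ge0 al01 C1 nu1; set K := far_const al rho C in Kf.
set nu := (3 - al) * rho in nu1.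
have nu0 : 0 < nu by exact: lt_trans nu1.
have C256 : 0 <= 256 * C by exact: mulr_ge0 (ler0n _ _) C0.
have K8 : 0 <= 8 * K by exact: mulr_ge0.
(* The three terms ensure, in this order, 2 t_1 <= c, 256 C (t_1 / c)^rho <= 1 and 8 K (t_1 / c)^nu
   <= 1. *)
pose P := 2 + (256 * C) `^ rho^-1 + (8 * K) `^ nu^-1; exists P.
  have := powR_ge0 (256 * C) rho^-1; have := powR_ge0 (8 * K) nu^-1.
  rewrite /P; clear; lra.
move=> M t c m qm mM Pc.
have [t0 ht _ _] := qm; have M0 : (0 < M)%N by case/andP: mM => /leq_trans; apply.
have t1 : 0 < t 1%N by exact: (qmesh_pos qm).
have tm : 0 < t m by exact: (qmesh_pos qm).
have p1 := powR_ge0 (256 * C) rho^-1; have p2 := powR_ge0 (8 * K) nu^-1.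
have P2 : 2 * t 1%N <= c.
  by apply: le_trans Pc; rewrite ler_wpM2r ?(ltW t1)// /P -addrA lerDl addr_ge0.
have t1c : t 1%N < c by move: P2 t1; clear; lra.
have c0 : 0 < c by exact: lt_trans t1c.
have e1 : 256 * C * t 1%N `^ rho <= c `^ rho.
  apply: root_bound => //; first exact: ltW.
  by apply: le_trans Pc; rewrite ler_wpM2r ?(ltW t1)// /P addrAC lerDr addr_ge0.
have e2 : 8 * K * t 1%N `^ nu <= c `^ nu.
  apply: root_bound => //; first exact: ltW.
  by apply: le_trans Pc; rewrite ler_wpM2r ?(ltW t1)// /P lerDr addr_ge0.
have Tc : 0 < t m + c by exact: addr_gt0.
have G0 := Gammainv_ge0 al.
have al1' : 0 < (1 - al)^-1 by rewrite invr_gt0 subr_gt0.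
have exact_val := caputo_barrier al01 c0 tm.
set X := c `^ al * _ * _ / _ in exact_val *.
suff err : `|delta al t (fun j => barrier al c (t j)) m - caputo al (barrier al c) (t m)| <=
    Gammainv al * (X / 2).
  have := sub_le_of_dist err; rewrite exact_val; apply: le_trans.
  by rewrite -mulrBr ler_wpM2l//; lra.
have dB s : 0 <= s -> is_derive s (1:R) (barrier al c) (barrier1 al c s).
  by move=> s0; apply: is_derive_barrier; rewrite ltr_wpDl.
have dB1 s : 0 <= s -> is_derive s (1:R) (barrier1 al c) (barrier2 al c s).
  by move=> s0; apply: is_derive_barrier1; rewrite ltr_wpDl.
have dB2 s : 0 <= s -> is_derive s (1:R) (barrier2 al c) (barrier3 al c s).
  by move=> s0; apply: is_derive_barrier2; rewrite ltr_wpDl.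
have b2 s (s0 : 0 <= s) := barrier2_bound al01 c0 s0.
have b3 s (s0 : 0 <= s) := barrier3_bound al01 c0 s0.
have [cT|Tltc] := leP c (t m).
  (* m = 1 is excluded because t_1 < c <= t_m. *)
  case: m mM @X tm Tc exact_val cT => [//|[|n]] mM X tm Tc exact_val cT.
    by move: (lt_le_trans t1c cT); rewrite ltxx.
  apply: le_trans (barrier_delta_far al01 r01 C1 c0 qm (ltW t1c) dB dB1 dB2 b3 nu1
    (proj2 (andP mM) : (n.+1 < M)%N) cT) _.
  rewrite ler_wpM2l// -/K -/nu.
  have s1 : 8 * (K * (t 1%N `^ nu * (c `^ (al - nu) * t n.+2 `^ (- al - 1)))) <=
      c `^ al * t n.+2 `^ (- al - 1).
    have -> : c `^ al = c `^ nu * c `^ (al - nu).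
      by rewrite -powR_add//; congr (_ `^ _); ring.
    have -> : 8 * (K * (t 1%N `^ nu * (c `^ (al - nu) * t n.+2 `^ (- al - 1)))) =
      8 * K * t 1%N `^ nu * (c `^ (al - nu) * t n.+2 `^ (- al - 1)) by ring.
    by rewrite -[leRHS]mulrA ler_wpM2r// mulr_ge0 ?powR_ge0.
  have s2 : t n.+2 `^ (- al - 1) <= 4 * (t n.+2 `^ (1 - al) * (t n.+2 + c) `^ (- 2)).
    rewrite powR_neg2// mulrA ler_pdivlMr ?exprn_gt0//.
    have -> : 4 * t n.+2 `^ (1 - al) = t n.+2 `^ (- al - 1) * (2 * t n.+2) ^+ 2.
      rewrite exprMn -[t n.+2 ^+ 2]powR_mulrn ?(ltW tm)// mulrCA -powR_add//.
      by rewrite (_ : - al - 1 + 2%:R = 1 - al); ring.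
    rewrite ler_wpM2l ?powR_ge0//; apply: lerXn2r; rewrite ?nnegrE.
    - exact: ltW.
    - by rewrite mulr_ge0 ?(ltW tm).
    - by move: cT; clear; lra.
  have s3 : c `^ al * t n.+2 `^ (- al - 1) <= 4 * X.
    apply: (@le_trans _ _ (c `^ al * (4 * (t n.+2 `^ (1 - al) * (t n.+2 + c) `^ (- 2))))).
      by rewrite ler_wpM2l ?powR_ge0.
    have -> : 4 * X = c `^ al * (4 * (t n.+2 `^ (1 - al) * (t n.+2 + c) `^ (- 2))) / (1 - al).
      by rewrite /X; ring.
    rewrite ler_peMr//; first by rewrite !mulr_ge0 ?powR_ge0.
    by rewrite invf_ge1 ?subr_gt0// gerBl ltW.
  by move: s1 s3; clear; lra.
(* Now t_m < c, and the step ending at t_m is at most c / 256. The 256 is 32 from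
   [barrier_delta_near], times 4 from (t_m + c)^2 <= 4 c^2, times 2 for the half. *)
case: m mM @X tm Tc exact_val Tltc => [//|n] mM X tm Tc exact_val Tltc.
have nM : (n < M)%N by case/andP: mM.
apply: le_trans (barrier_delta_near al01 c0 qm M0 dB dB1 b2 nM) _.
rewrite ler_wpM2l//.
have h1 : 256 * (t n.+1 - t n) <= c.
  have := qmesh_step qm C0 r01 (lexx 0) nM; rewrite addr0 => h.
  apply: (@le_trans _ _ (256 * (C * (c `^ (1 - rho) * t 1%N `^ rho)))).
    apply: ler_wpM2l; first exact: ler0n.
    apply: le_trans h _; rewrite ler_wpM2l// ler_wpM2r ?powR_ge0//.
    by apply: powR_le_base; [rewrite subr_ge0|exact: ltW|exact: ltW].
  have -> : 256 * (C * (c `^ (1 - rho) * t 1%N `^ rho)) =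
    c `^ (1 - rho) * (256 * C * t 1%N `^ rho) by ring.
  have {2}-> : c = c `^ (1 - rho) * c `^ rho.
    by rewrite -powR_add// subrK powRr1// ltW.
  by rewrite ler_wpM2l ?powR_ge0.
have Y0 : 0 <= c `^ (al - 3) * t n.+1 `^ (1 - al) / (1 - al).
  by rewrite !mulr_ge0 ?powR_ge0// ltW.
have s1 : 256 * (32 * ((t n.+1 - t n) * c `^ (al - 3)) * t n.+1 `^ (1 - al) / (1 - al)) <=
    32 * (c * (c `^ (al - 3) * t n.+1 `^ (1 - al) / (1 - al))).
  have -> : 256 * (32 * ((t n.+1 - t n) * c `^ (al - 3)) * t n.+1 `^ (1 - al) / (1 - al)) =
    32 * ((256 * (t n.+1 - t n)) * (c `^ (al - 3) * t n.+1 `^ (1 - al) / (1 - al))) by ring.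
  by rewrite ler_wpM2l// ler_wpM2r.
have s2 : c * (c `^ (al - 3) * t n.+1 `^ (1 - al) / (1 - al)) <= 4 * X.
  have -> : c * (c `^ (al - 3) * t n.+1 `^ (1 - al) / (1 - al)) =
    (c * c `^ (al - 3)) * (t n.+1 `^ (1 - al) / (1 - al)) by ring.
  have -> : 4 * X = (4 * (c `^ al * (t n.+1 + c) `^ (- 2))) * (t n.+1 `^ (1 - al) / (1 - al)).
    by rewrite /X; ring.
  rewrite ler_wpM2r ?mulr_ge0 ?powR_ge0 ?(ltW al1')//.
  rewrite powR_neg2// mulrA ler_pdivlMr ?exprn_gt0//.
  have -> : 4 * c `^ al = c * c `^ (al - 3) * (2 * c) ^+ 2.
    have -> : c * c `^ (al - 3) * (2 * c) ^+ 2 = 4 * (c `^ (al - 3) * c ^+ 3) by ring.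
    rewrite -powR_mulrn ?(ltW c0)// -powR_add//; congr (_ * _ `^ _); ring.
  rewrite ler_wpM2l ?mulr_ge0 ?powR_ge0 ?(ltW c0)//; apply: lerXn2r; rewrite ?nnegrE.
  - exact: ltW.
  - by rewrite mulr_ge0 ?(ltW c0).
  - by move: Tltc; clear; lra.
by move: s1 s2; clear; lra.
Qed.

End BarrierLower.

(** * Stability *)
Section Stability.
Variable R : realType.
Implicit Types (t U W D E : nat -> R).
Implicit Types (al rho nu mu s x y p A C T a b c q sbar P tau : R) (m j n M N : nat).

Lemma floor_pow2 x : 1 <= x -> exists n, 2 ^+ n <= x < 2 ^+ n.+1.
Proof.
move=> x1.
have ex : exists n, x < 2 ^+ n.
  exists (Num.truncn x).+1.
  have x0 : 0 <= x by exact: le_trans x1.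
  have /andP[_ h] := truncn_itv x0; apply: lt_trans h _.
  by rewrite -natrX ltr_nat ltn_expl.
case: (ex_minnP ex) => -[|n]; first by rewrite expr0 ltNge x1.
move=> xn mn; exists n; rewrite xn andbT leNgt; apply/negP => h.
by have := mn n h; rewrite ltnn.
Qed.

Lemma qmesh_trunc C rho M m t : (m <= M)%N -> qmesh C rho M t -> qmesh C rho m t.
Proof.
move=> mM [t0 ht h1 h2]; split => //.
- by move=> j jm; apply: ht; exact: leq_trans mM.
- by move=> j jm; apply: h1; exact: leq_trans mM.
- by move=> j jm; apply: h2; exact: leq_trans mM.
Qed.

(** [Gamma] is a bare integral, so a priori its inverse could be 0 and [delta] trivial. Property
    (iii) rules this out: on the mesh {0, 1} the values U j = j would have zero [delta] although U 1
    = 1. *)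
Lemma Gammainv_gt0 al sbar : al < 1 -> stability_constant al sbar -> 0 < Gammainv al.
Proof.
move=> al1 [_ _ [K K0 stab]]; rewrite lt_neqAle Gammainv_ge0 andbT eq_sym.
apply/negP => /eqP G0.
pose t j : R := j%:R.
have mesh : is_mesh 1 1 t by split => // j _; rewrite /t ltr_nat.
have adm : [/\ is_mesh 1 1 t, sigma_nonincreasing 1 t & (2 <= 1)%N -> sigma t 2 <= sbar].
  by split => //; split => j /andP[]; case: j => [|[|]].
have [_ t0 _ ht] := mesh.
have := stab _ _ _ adm t t0 1%N isT.
rewrite big_ltn// big_geq//.
have -> : delta al t t 1 = 0.
  by rewrite delta_wint// -/(Gammainv al) G0 mul0r.
by rewrite normr0 mulr0 maxxx mulr0 /t normr1 leNgt ltr01.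
Qed.

Definition admissible_mesh sbar (M : nat) t : Prop :=
  sigma_nonincreasing M t /\ ((2 <= M)%N -> sigma t 2 <= sbar).

Lemma admissible_trunc sbar M m t : (m <= M)%N -> admissible_mesh sbar M t ->
  admissible_mesh sbar m t.
Proof.
move=> mM [[s1 s2] s3]; split; first split.
- by move=> j /andP[j2 jm]; apply: s1; rewrite j2 (leq_trans jm).
- by move=> j /andP[j2 jm]; apply: s2; rewrite j2 (leq_trans jm).
- by move=> m2; apply: s3; exact: leq_trans mM.
Qed.

Lemma qmesh_is_mesh C rho M t : (0 < M)%N -> qmesh C rho M t -> is_mesh (t M) M t.
Proof. by move=> M0 [t0 ht _ _]. Qed.

Lemma stability_small al sbar mu : stability_constant al sbar -> mu <= al ->
  exists2 K : R, 0 < K & forall C rho M t W A m,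
    qmesh C rho M t -> admissible_mesh sbar M t -> W 0%N = 0 -> 0 <= A ->
    (forall j, (0 < j <= M)%N -> `|delta al t W j| <= A * (t 1%N `^ mu * t j `^ (- mu))) ->
    (0 < m <= M)%N -> `|W m| <= K * (A * (t 1%N `^ mu * t m `^ (al - mu))).
Proof.
move=> [_ _ [K K0 stab]] mual; exists K => // C rho M t W A m qm [s1 s2] W0 A0 dW mM.
have M0 : (0 < M)%N by case/andP: mM => /leq_trans; apply.
have [t0 ht _ _] := qm.
apply: le_trans (stab (t M) M t _ W W0 m mM) _.
  by split => //; exact: qmesh_is_mesh qm.
rewrite ler_wpM2l ?(ltW K0)// big_seq.
apply: (big_ind (fun x => x <= A * (t 1%N `^ mu * t m `^ (al - mu)))).
- by rewrite !mulr_ge0 ?powR_ge0.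
- by move=> x y hx hy; rewrite ge_max hx.
- move=> j; rewrite mem_index_iota ltnS => /andP[j0 jm].
  have jM : (j <= M)%N by case/andP: mM => _; exact: leq_trans.
  have tj : 0 < t j by apply: (qmesh_pos qm); rewrite j0.
  apply: le_trans (ler_wpM2l (powR_ge0 _ _) (dW j _)) _; first by rewrite j0.
  rewrite mulrCA ler_wpM2l// mulrCA ler_wpM2l ?powR_ge0// -powR_add//.
  apply: powR_le_base; rewrite ?subr_ge0 ?(ltW tj)//.
  by apply: (increasing_le ht); rewrite jm; case/andP: mM.
Qed.

Lemma barrier_le al c s : al < 1 -> 0 < c -> 0 < s -> barrier al c s <= s `^ (al - 1).
Proof.
move=> al1 c0 s0; rewrite barrier_alt ?addr_gt0//.
have -> : s `^ (al - 1) = s * s `^ (al - 2).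
  rewrite -{2}[s]powRr1 ?(ltW s0)// -powR_add//; congr (_ `^ _); ring.
rewrite ler_wpM2l ?(ltW s0)//; apply: powR_ge_base => //; last by rewrite lerDl ltW.
by move: al1; clear; lra.
Qed.

(* Among the barriers with c = 2^n P t_1, the one with c <= t_j < 2c (or the
   first one, if t_j < P t_1) alone dominates the source at t_j. *)
Lemma barrier_weight_ge al mu P tau T : 0 < al < 1 -> 0 < mu -> 1 <= P ->
  0 < tau -> tau <= T -> exists n,
  [/\ n = 0%N \/ 2 ^+ n * (P * tau) <= T &
   (9 * P ^+ 2)^-1 * (tau `^ mu * T `^ (- mu)) <=
   tau * (2 `^ (1 - mu)) ^+ n * ((2 ^+ n * (P * tau)) `^ al * T `^ (1 - al) *
     (T + 2 ^+ n * (P * tau)) `^ (- 2))].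
Proof.
move=> /andP[al0 al1] mu0 P1 tau0 tauT.
have T0 : 0 < T by exact: lt_le_trans tauT.
have P0 : 0 < P by exact: lt_le_trans P1.
have Pt0 : 0 < P * tau by exact: mulr_gt0.
have [small|big] := ltP T (P * tau).
  (* Here T and tau are comparable up to P: the source is at most 1, and T + P tau <= 3 P tau. *)
  exists 0%N; split; first by left.
  rewrite !expr0 mulr1 mul1r powR_neg2 ?addr_gt0//.
  apply: (@le_trans _ _ (9 * P ^+ 2)^-1).
    rewrite ler_piMr ?invr_ge0 ?mulr_ge0 ?exprn_ge0 ?(ltW P0)//.
    rewrite -(powR_addK mu T0) ler_wpM2r ?powR_ge0//.
    by apply: powR_le_base; rewrite ?(ltW mu0) ?(ltW tau0).
  have h1 : tau `^ al * tau `^ (1 - al) <= (P * tau) `^ al * T `^ (1 - al).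
    apply: ler_pM; rewrite ?powR_ge0//; apply: powR_le_base; rewrite ?(ltW tau0)//.
    - exact: ltW.
    - by rewrite ler_peMl// ltW.
    - by rewrite subr_ge0 ltW.
  rewrite -powR_add// addrC subrK powRr1 ?(ltW tau0)// in h1.
  have h2 : (T + P * tau) ^+ 2 <= 9 * P ^+ 2 * tau ^+ 2.
    have -> : 9 * P ^+ 2 * tau ^+ 2 = (3 * (P * tau)) ^+ 2 by ring.
    apply: lerXn2r; rewrite ?nnegrE.
    - by rewrite addr_ge0// ltW.
    - by rewrite mulr_ge0// ltW.
    - by move: small Pt0; clear; lra.
  rewrite -[leLHS]mul1r ler_pdivrMr; last by rewrite mulr_gt0// exprn_gt0.
  have -> : tau * ((P * tau) `^ al * T `^ (1 - al) / (T + P * tau) ^+ 2) * (9 * P ^+ 2) =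
    ((T + P * tau) ^+ 2)^-1 * (tau * ((P * tau) `^ al * T `^ (1 - al)) * (9 * P ^+ 2)) by ring.
  rewrite ler_pdivlMl ?exprn_gt0 ?addr_gt0// mulr1; apply: le_trans h2 _.
  have -> : 9 * P ^+ 2 * tau ^+ 2 = tau * tau * (9 * P ^+ 2) by ring.
  by rewrite ler_wpM2r ?mulr_ge0 ?exprn_ge0 ?(ltW P0)// ler_wpM2l// ltW.
have x1 : 1 <= T / (P * tau) by rewrite ler_pdivlMr// mul1r.
have [n /andP[n1 n2]] := floor_pow2 x1.
have c1 : 2 ^+ n * (P * tau) <= T by rewrite -ler_pdivlMr.
have c2 : T < 2 * (2 ^+ n * (P * tau)) by rewrite mulrA -exprS -ltr_pdivrMr.
(* As c <= T < 2 c, the barrier yields at least 1 / (9 c), which its weight turns into 2^(-n mu) /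
   (9 P), while (tau / T)^mu <= 2^(-n mu). *)
exists n; split; first by right.
set c := 2 ^+ n * (P * tau) in c1 c2 *.
have e0 : (0 : R) < 2 ^+ n by exact: exprn_gt0.
have c0 : 0 < c by exact: mulr_gt0.
have E1 : (2 `^ (1 - mu)) ^+ n = (2 ^+ n) `^ (1 - mu).
  by rewrite powR_natr// mulrC powRrM powR_mulrn.
have h1 : c <= c `^ al * T `^ (1 - al).
  have {1}-> : c = c `^ al * c `^ (1 - al).
    by rewrite -powR_add// addrC subrK powRr1// ltW.
  by rewrite ler_wpM2l ?powR_ge0//; apply: powR_le_base; rewrite ?subr_ge0 ?(ltW al1) ?(ltW c0).
have h2 : (T + c) ^+ 2 <= 9 * c ^+ 2.
  have -> : 9 * c ^+ 2 = (3 * c) ^+ 2 by ring.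
  apply: lerXn2r; rewrite ?nnegrE.
  - by rewrite addr_ge0// ltW.
  - by rewrite mulr_ge0// ltW.
  - by move: c2; clear; lra.
have h3 : c / (9 * c ^+ 2) <= c `^ al * T `^ (1 - al) * (T + c) `^ (- 2).
  rewrite powR_neg2 ?addr_gt0//; apply: ler_pM => //; first exact: ltW.
    by rewrite invr_ge0 mulr_ge0// exprn_ge0// ltW.
  by rewrite lef_pV2 ?posrE ?mulr_gt0 ?exprn_gt0 ?addr_gt0.
apply: (@le_trans _ _ (tau * (2 ^+ n) `^ (1 - mu) * (c / (9 * c ^+ 2)))); last first.
  by rewrite E1 ler_wpM2l// mulr_ge0 ?powR_ge0// ltW.
have h4 : tau `^ mu * T `^ (- mu) <= (2 ^+ n) `^ (- mu).
  have -> : (2 ^+ n) `^ (- mu) = (P * tau) `^ mu * c `^ (- mu).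
    by rewrite /c (powRM _ (ltW e0) (ltW Pt0)) mulrCA powR_addK// mulr1.
  apply: ler_pM; rewrite ?powR_ge0//.
    by apply: powR_le_base; rewrite ?(ltW mu0) ?(ltW tau0)// ler_peMl// ltW.
  by apply: powR_ge_base; rewrite // oppr_le0 ltW.
apply: (@le_trans _ _ ((9 * P ^+ 2)^-1 * (2 ^+ n) `^ (- mu))).
  by rewrite ler_wpM2l// invr_ge0 mulr_ge0// exprn_ge0// ltW.
have -> : (2 ^+ n) `^ (1 - mu) = (2 ^+ n) `^ (- mu) * 2 ^+ n :> R.
  by rewrite -{3}[2 ^+ n]powRr1 ?(ltW e0)// -powR_add//; congr (_ `^ _); ring.
have -> : tau * ((2 ^+ n) `^ (- mu) * 2 ^+ n) * (c / (9 * c ^+ 2)) =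
   (9 * P)^-1 * (2 ^+ n) `^ (- mu).
  by rewrite /c; field; rewrite !gt_eqF.
rewrite ler_wpM2r ?powR_ge0// lef_pV2 ?posrE ?mulr_gt0 ?exprn_gt0//.
by rewrite ler_wpM2l// expr2 ler_peMl// ltW.
Qed.

(** Origin of the weights: around c_n = 2^n P t_1 the barrier produces a multiple of 1 / c_n and the
    source is of order 2^(-n mu), so the weight has to be of order c_n 2^(-n mu), that is t_1 (2^(1
    - mu))^n. *)
Lemma stability_large al rho C sbar mu : 0 < al < 1 -> 0 < rho <= 1 -> 1 <= C ->
  al < (3 - al) * rho -> stability_constant al sbar -> 0 < mu ->
  exists2 K : R, 0 < K & forall M t W A m,
    qmesh C rho M t -> admissible_mesh sbar M t -> W 0%N = 0 -> 0 <= A ->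
    (forall j, (0 < j <= M)%N -> `|delta al t W j| <= A * (t 1%N `^ mu * t j `^ (- mu))) ->
    (0 < m <= M)%N -> exists2 N, 2 ^+ N * t 1%N <= t m &
    `|W m| <= K * (A * (t 1%N * ((\sum_(0 <= n < N.+1) (2 `^ (1 - mu)) ^+ n) *
       t m `^ (al - 1)))).
Proof.
move=> al01 r01 C1 nu1 stabc mu0; have /andP[al0 al1] := al01.
have G0 := Gammainv_gt0 al1 stabc; have [_ stab _] := stabc.
have [P P1 lower] := barrier_delta_ge al01 r01 C1 nu1.
have P0 : 0 < P by exact: lt_trans P1.
pose k := Gammainv al / (1 - al) / 2 / (9 * P ^+ 2).
have k0 : 0 < k by rewrite /k !divr_gt0 ?subr_gt0 ?mulr_gt0 ?exprn_gt0.
exists k^-1; first by rewrite invr_gt0.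
move=> M t W A m qmM admM W0 A0 dW mM.
have mM' : (m <= M)%N by case/andP: mM.
have m0 : (0 < m)%N by case/andP: mM.
(* The mesh is cut at t_m, so that scales up to t_m suffice; otherwise the number of barriers would
   depend on the final time. *)
have qm := qmesh_trunc mM' qmM; have adm := admissible_trunc mM' admM.
have [t0 ht _ _] := qm.
have htj j : (j <= m)%N -> increasing_to t j.
  by move=> jm i ij; apply: ht; exact: leq_trans jm.
have tau0 : 0 < t 1%N by exact: (qmesh_pos qm).
have Pt0 : 0 < P * t 1%N by exact: mulr_gt0.
have tm1 : t 1%N <= t m by apply: (increasing_le ht); rewrite m0 leqnn.
have tm0 : 0 < t m by exact: lt_le_trans tm1.
have [N [NT Nmax]] : exists N, 2 ^+ N * t 1%N <= t m /\
    forall n, 2 ^+ n * (P * t 1%N) <= t m -> (n <= N)%N.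
  have [small|big] := ltP (t m) (P * t 1%N).
    exists 0%N; rewrite expr0 mul1r; split => // n h.
    suff : P * t 1%N <= t m by rewrite leNgt small.
    by apply: le_trans h; rewrite ler_peMl ?(ltW Pt0)// exprn_ege1// ler1n.
  have x1 : 1 <= t m / (P * t 1%N) by rewrite ler_pdivlMr// mul1r.
  have [N /andP[n1 n2]] := floor_pow2 x1; exists N; split.
    move: n1; rewrite ler_pdivlMr// mulrCA => /(le_trans _); apply.
    by rewrite ler_peMl ?mulr_ge0 ?exprn_ge0 ?(ltW tau0)// ltW.
  move=> n; rewrite -ler_pdivlMr// => h.
  have := le_lt_trans h n2; rewrite ltr_eXn2l ?ltr1n// ltnS//.
exists N => //.
pose x := 2 `^ (1 - mu) : R.
have x0 n : 0 <= x ^+ n by rewrite exprn_ge0// powR_ge0.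
pose c n := 2 ^+ n * (P * t 1%N).
have c0 n : 0 < c n by rewrite mulr_gt0// exprn_gt0.
have cP n : P * t 1%N <= c n by rewrite ler_peMl ?(ltW Pt0)// exprn_ege1// ler1n.
pose a := k^-1 * (A * t 1%N).
have a0 : 0 <= a by rewrite !mulr_ge0 ?invr_ge0 ?(ltW k0) ?(ltW tau0).
pose B j := \sum_(0 <= n < N.+1) (a * x ^+ n) * barrier al (c n) (t j).
have B0 : B 0%N = 0.
  rewrite /B big1// => n _; rewrite t0 barrier_alt ?add0r// mul0r mulr0//.
have dB j : (0 < j <= m)%N -> delta al t B j =
    \sum_(0 <= n < N.+1) (a * x ^+ n) * delta al t (fun j => barrier al (c n) (t j)) j.
  move=> /andP[_ jm].
  exact: (delta_sum N.+1 (fun n => a * x ^+ n) (fun n j => barrier al (c n) (t j)) al1 t0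
    (htj j jm)).
have main j : (0 < j <= m)%N -> `|delta al t W j| <= delta al t B j.
  move=> jm; have jM : (0 < j <= M)%N by case/andP: jm => -> /leq_trans; apply.
  apply: le_trans (dW j jM) _; rewrite dB//.
  have tj0 : 0 < t j by exact: (qmesh_pos qm).
  have tj1 : t 1%N <= t j by exact: (qmesh_ge1 qm).
  have low n : Gammainv al * (c n `^ al * t j `^ (1 - al) * (t j + c n) `^ (- 2) / (1 - al) / 2)
      <= delta al t (fun j => barrier al (c n) (t j)) j := lower m t (c n) j qm jm (cP n).
  have low0 n : 0 <= delta al t (fun j => barrier al (c n) (t j)) j.
    apply: le_trans (low n); rewrite mulr_ge0 ?(ltW G0)//.
    by rewrite !mulr_ge0 ?powR_ge0 ?invr_ge0 ?subr_ge0// ltW.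
  have [n [nN wn]] := barrier_weight_ge al01 mu0 (ltW P1) tau0 tj1.
  have nN' : (n <= N)%N.
    case: nN => [-> //|h]; apply: Nmax; apply: le_trans h _.
    by apply: (increasing_le ht); case/andP: jm => _ ->; rewrite leqnn.
  (* The other terms are nonnegative, so the barrier singled out by [barrier_weight_ge] is
     enough. *)
  apply: (@le_trans _ _ (a * x ^+ n * delta al t (fun j => barrier al (c n) (t j)) j)); last first.
    have nin : n \in index_iota 0 N.+1 by rewrite mem_index_iota.
    rewrite (bigD1_seq n nin (iota_uniq _ _)) /=.
    rewrite lerDl; apply: sumr_ge0 => i _.
    by apply: mulr_ge0 (low0 i); exact: mulr_ge0.
  apply: le_trans (ler_wpM2l _ (low n)); last exact: mulr_ge0.
  move: wn; rewrite -/(c n) -/x; set Z := c n `^ al * _ * _ => wn.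
  have -> : a * x ^+ n * (Gammainv al * (Z / (1 - al) / 2)) =
     A * (k^-1 * (Gammainv al / (1 - al) / 2)) * (t 1%N * x ^+ n * Z) by rewrite /a; ring.
  have -> : k^-1 * (Gammainv al / (1 - al) / 2) = 9 * P ^+ 2.
    by rewrite /k; field; rewrite !gt_eqF ?subr_gt0.
  rewrite -mulrA ler_wpM2l// -ler_pdivrMl ?mulr_gt0 ?exprn_gt0//.
apply: le_trans (stab (t m) m t _ W B _ main m (leqnn m)) _.
- by case: adm => s1 s2; split => //; exact: qmesh_is_mesh qm.
- by rewrite W0 normr0 B0.
have -> : k^-1 * (A * (t 1%N * ((\sum_(0 <= n < N.+1) x ^+ n) * t m `^ (al - 1)))) =
    \sum_(0 <= n < N.+1) (a * x ^+ n) * t m `^ (al - 1).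
  by rewrite -mulr_suml -mulr_sumr /a; ring.
apply: ler_sum => n _; apply: ler_wpM2l; first exact: mulr_ge0.
exact: barrier_le.
Qed.

End Stability.

(** * The three regimes of the rate *)

Section Rate.
Variable R : realType.
Implicit Types (t U W D E : nat -> R).
Implicit Types (al rho nu mu s x y p A C T a b c q sbar P tau : R) (m j n M N : nat).

(** [error_bound] in terms of tau = t_1, of order M^-r, and of mu instead of (3 - al) / r. The
    branches tell whether the geometric sum of ratio 2^(1 - mu) converges, has equal terms, or is
    dominated by its last term. *)
Definition rate al mu tau T : R :=
  if 1 < mu then tau * T `^ (al - 1)
  else if mu == 1 then tau * T `^ (al - 1) * (1 + ln (T / tau))
  else tau `^ mu * T `^ (al - mu).

Lemma geometric_sum x N : x != 1 ->
  \sum_(0 <= n < N.+1) x ^+ n = (x ^+ N.+1 - 1) / (x - 1).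
Proof.
move=> x1; rewrite big_mkord subrX1 mulrC mulKf// subr_eq0//.
Qed.

Lemma powR_neq1 x p : 1 < x -> p != 0 -> x `^ p != 1.
Proof.
move=> x1 p0; have x0 : 0 < x by exact: lt_trans x1.
rewrite /powR (gt_eqF x0); apply/eqP => h.
have := @expR_inj R (p * ln x) 0; rewrite expR0 => /(_ h)/eqP.
by rewrite mulf_eq0 (negPf p0)/= gt_eqF// ln_gt0.
Qed.

(** N is at most log2 (T / tau). The sum is bounded for a ratio below 1, equals N + 1 for ratio 1,
    and is a multiple of (T / tau)^(1 - mu) at most for a ratio above 1. *)
Lemma geometric_rate al mu : exists2 K : R, 0 < K & forall N tau T, 0 < tau ->
  2 ^+ N * tau <= T ->
  tau * ((\sum_(0 <= n < N.+1) (2 `^ (1 - mu)) ^+ n) * T `^ (al - 1)) <=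
  K * rate al mu tau T.
Proof.
have l2 : 1 < (2 : R) by rewrite ltr1n.
have ln2 : 0 < ln (2 : R) by exact: ln_gt0.
set x : R := 2 `^ (1 - mu).
have x0 : 0 < x by exact: powR_gt0.
rewrite /rate; have [mu1|mu1] := ltP 1 mu.
  have xn1 : x != 1 by rewrite powR_neq1// subr_eq0 lt_eqF.
  have x1 : x < 1.
    have : x <= 2 `^ 0 by apply: ler_powR; rewrite ?subr_le0 ltW.
    by rewrite powRr0 lt_neqAle xn1.
  exists (1 - x)^-1; first by rewrite invr_gt0 subr_gt0.
  move=> N tau T tau0 NT.
  have -> : (1 - x)^-1 * (tau * T `^ (al - 1)) = tau * ((1 - x)^-1 * T `^ (al - 1)) by ring.
  rewrite ler_wpM2l ?(ltW tau0)// ler_wpM2r ?powR_ge0// geometric_sum//.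
  have -> : (x ^+ N.+1 - 1) / (x - 1) = (1 - x ^+ N.+1) / (1 - x).
    by rewrite -[x - 1]opprB invrN mulrN -mulNr opprB.
  by rewrite ler_piMl ?invr_ge0 ?subr_ge0 ?(ltW x1)// gerBl exprn_ge0 ?ltW.
have [mue|mun1] := eqVneq mu 1.
  exists (1 + (ln 2)^-1); first by rewrite addr_gt0// invr_gt0.
  move=> N tau T tau0 NT; rewrite /x mue subrr powRr0.
  have -> : \sum_(0 <= n < N.+1) (1 : R) ^+ n = N.+1%:R.
    by under eq_bigr do rewrite expr1n; rewrite sumr_const_nat subn0.
  have T0 : 0 < T by apply: lt_le_trans NT; rewrite mulr_gt0 ?exprn_gt0.
  have hN : N%:R * ln 2 <= ln (T / tau).
    rewrite mulrC mulr_natr -lnXn// ler_ln ?posrE ?exprn_gt0 ?divr_gt0//.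
    by rewrite ler_pdivlMr.
  have -> : (1 + (ln 2)^-1) * (tau * T `^ (al - 1) * (1 + ln (T / tau))) =
    tau * ((1 + (ln 2)^-1) * (1 + ln (T / tau)) * T `^ (al - 1)) by ring.
  rewrite ler_wpM2l ?(ltW tau0)// ler_wpM2r ?powR_ge0//.
  have h : N%:R <= (ln 2)^-1 * ln (T / tau) by rewrite mulrC ler_pdivlMr.
  have l0 : 0 <= ln (T / tau) by apply: le_trans hN; rewrite mulr_ge0// ltW.
  have i0 : 0 < (ln (2:R))^-1 by rewrite invr_gt0.
  rewrite -natr1 mulrDl mul1r mulrDr mulr1.
  move: h l0 i0; clear; lra.
have mul : mu < 1 by rewrite lt_neqAle mun1.
have xn1 : x != 1 by rewrite powR_neq1// subr_eq0 eq_sym.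
have x1 : 1 < x.
  have : 2 `^ 0 <= x by apply: ler_powR; rewrite ?subr_ge0// ltW.
  by rewrite powRr0 lt_neqAle eq_sym xn1.
exists (x / (x - 1)); first by rewrite divr_gt0// subr_gt0.
move=> N tau T tau0 NT; rewrite geometric_sum//.
have T0 : 0 < T by apply: lt_le_trans NT; rewrite mulr_gt0 ?exprn_gt0.
have e0 : 0 < (2 : R) ^+ N by exact: exprn_gt0.
have xN : x ^+ N * tau `^ (1 - mu) <= T `^ (1 - mu).
  have -> : x ^+ N = (2 ^+ N) `^ (1 - mu).
    by rewrite /x powR_natr// mulrC powRrM powR_mulrn.
  rewrite -powRM ?(ltW e0) ?(ltW tau0)//.
  by apply: powR_le_base; rewrite ?subr_ge0 ?mulr_ge0 ?(ltW e0) ?(ltW tau0).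
have -> : tau `^ mu * T `^ (al - mu) = tau `^ mu * (T `^ (1 - mu) * T `^ (al - 1)).
  by rewrite -powR_add//; congr (_ * _ `^ _); ring.
have -> : tau = tau `^ mu * tau `^ (1 - mu).
  by rewrite -powR_add// [mu + _]addrC subrK powRr1// ltW.
rewrite -powR_add// [mu + _]addrC subrK powRr1 ?(ltW tau0)//.
have d0 : 0 < (x - 1)^-1 by rewrite invr_gt0 subr_gt0.
have -> : x / (x - 1) * (tau `^ mu * (T `^ (1 - mu) * T `^ (al - 1))) =
   T `^ (1 - mu) * (tau `^ mu * (T `^ (al - 1) * (x / (x - 1)))) by ring.
apply: le_trans (ler_wpM2r _ xN); last first.
  by rewrite !mulr_ge0 ?powR_ge0 ?(ltW x0) ?(ltW d0).
have -> : x ^+ N * tau `^ (1 - mu) * (tau `^ mu * (T `^ (al - 1) * (x / (x - 1)))) =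
   tau `^ mu * tau `^ (1 - mu) * (x ^+ N.+1 / (x - 1) * T `^ (al - 1)) by rewrite exprS; ring.
rewrite -powR_add// [mu + _]addrC subrK powRr1 ?(ltW tau0)//.
rewrite ler_wpM2l ?(ltW tau0)// ler_wpM2r ?powR_ge0// ler_wpM2r ?(ltW d0)//.
by rewrite gerBl.
Qed.

Lemma stability_rate al rho C sbar mu : 0 < al < 1 -> 0 < rho <= 1 -> 1 <= C ->
  stability_constant al sbar -> 0 < mu -> mu <= (3 - al) * rho ->
  exists2 K : R, 0 < K & forall M t W A m,
    qmesh C rho M t -> admissible_mesh sbar M t -> W 0%N = 0 -> 0 <= A ->
    (forall j, (0 < j <= M)%N -> `|delta al t W j| <= A * (t 1%N `^ mu * t j `^ (- mu))) ->
    (0 < m <= M)%N -> `|W m| <= K * (A * rate al mu (t 1%N) (t m)).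
Proof.
move=> al01 r01 C1 stab mu0 mu1; have /andP[al0 al1] := al01.
have [nual|nual] := leP ((3 - al) * rho) al.
  have mual : mu <= al by exact: le_trans nual.
  have [K K0 h] := stability_small stab mual.
  exists K => // M t W A m qm adm W0 A0 dW mM.
  (* mu <= al < 1 selects the last branch of [rate]. *)
  rewrite /rate ltNge (le_trans mual (ltW al1))/= lt_eqF ?(le_lt_trans mual)//.
  exact: h qm adm _ _ dW mM.
have [K K0 h] := stability_large al01 r01 C1 nual stab mu0.
have [K' K'0 h'] := geometric_rate al mu.
exists (K * K'); first exact: mulr_gt0.
move=> M t W A m qm adm W0 A0 dW mM.
have [N N1 N2] := h _ _ _ _ _ qm adm W0 A0 dW mM.
apply: le_trans N2 _; rewrite -[leRHS]mulrA ler_wpM2l ?(ltW K0)// [leRHS]mulrCA ler_wpM2l//.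
apply: h' => //; apply: (qmesh_pos qm).
by case/andP: mM => m0 mM; rewrite /= (leq_trans m0 mM).
Qed.

End Rate.

(** * The first steps *)
Section Startup.
Variable R : realType.
Implicit Types (t U V W D E e : nat -> R).
Implicit Types (al rho nu mu s x y p A B C T a b c q sbar P v : R) (m j n k i M N K : nat).

Lemma wint_ge al T a b q d (X x : R -> R) : al < 1 -> a < b -> b <= T ->
  prim X x a b -> {in `]a, b[%R, forall s, `|x s| <= d} ->
  {in `]a, b[%R, forall s, q * x s <= (T - s) `^ (- al) * x s} ->
  q * (X b - X a) <= wint al T a b x.
Proof.
move=> al1 ab bt pX xd kx; have [_ _ cx] := pX.
have [ix _] := wint_bound al1 ab bt cx xd.
have pd : prim (fun s => d * s) (fun=> d) a b.
  by apply: prim_eq (primZ d (prim_lin a b)) => s _ //=; rewrite mulr1.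
have [i1 <-] := prim_dom ab pX pd xd.
have i2 := integrable_scale q i1.
by rewrite -RintegralZl//; apply: le_Rintegral.
Qed.

Lemma qmesh_growth C rho M t j : qmesh C rho M t -> 0 <= C -> (j < M)%N ->
  t j.+1 <= (1 + C) ^+ j * t 1%N.
Proof.
move=> qm C0; elim: j => [|j IH] jM; first by rewrite expr0 mul1r.
apply: le_trans (ratio_le qm C0 _ jM) _ => //.
rewrite exprS -mulrA ler_wpM2l ?addr_ge0//.
exact: IH (ltnW jM).
Qed.

Lemma dd1_bound C rho M t V v i m : qmesh C rho M t -> (m <= M)%N ->
  (forall j, (j <= m)%N -> `|V j| <= v) -> (i < m)%N -> `|dd1 t V i| <= 2 * (v / t 1%N).
Proof.
move=> qm mM Vv im; have [t0 ht _ _] := qm.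
have iM : (i < M)%N by exact: leq_trans mM.
have hi : t 1%N <= t i.+1 - t i.
  have := step_le (i := 0%N) qm iM; rewrite t0 subr0; exact.
have t1 : 0 < t 1%N by apply: (qmesh_pos qm); rewrite /= (leq_trans _ iM).
have h0 : 0 < t i.+1 - t i by exact: lt_le_trans hi.
rewrite /dd1 normrM normfV (gtr0_norm h0) mulrA; apply: ler_pM.
- exact: normr_ge0.
- by rewrite invr_ge0 ltW.
- rewrite mulr_natl mulr2n; apply: le_trans (ler_normB _ _) _.
  by apply: lerD; apply: Vv => //; exact: ltnW.
- by rewrite lef_pV2.
Qed.

(** Steps are at least t_1, so slopes are at most 2 v / t_1, and derivatives of pieces at most 5
    times that. *)
Lemma delta_crude al C rho M t V v m : al < 1 -> qmesh C rho M t -> (m <= M)%N ->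
  (forall j, (j <= m)%N -> `|V j| <= v) ->
  `|delta al t V m| <= Gammainv al * (10 * (v / t 1%N) * (t m `^ (1 - al) / (1 - al))).
Proof.
move=> al1 qm mM Vv; have [t0 htM _ _] := qm.
have ht : increasing_to t m by move=> j jm; apply: htM; exact: leq_trans mM.
rewrite delta_wint// normrM -/(Gammainv al) (ger0_norm (Gammainv_ge0 al)).
rewrite ler_wpM2l ?Gammainv_ge0//; apply: le_trans (ler_norm_sum _ _ _) _.
pose F j : R := - (10 * (v / t 1%N) * ((t m - t j) `^ (1 - al) / (1 - al))).
have -> : 10 * (v / t 1%N) * (t m `^ (1 - al) / (1 - al)) = F m - F 0%N.
  rewrite /F subrr t0 subr0 powR0 ?subr_eq0 ?gt_eqF//; ring.
rewrite -telescope_sumr//; apply: ler_sum_nat => j /andP[_ jm].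
have tj : t j.+1 <= t m by apply: (increasing_le ht); rewrite jm leqnn.
have [_ _ cx] := prim_piece t V m j (t j) (t j.+1).
have [|_ h] := wint_bound (d := 10 * (v / t 1%N)) al1 (ht j jm) tj cx.
  move=> s; rewrite in_itv/= => /andP[s1 s2].
  have -> : 10 * (v / t 1%N) = 5 * (2 * (v / t 1%N)) by ring.
  apply: (dpiece_bound ht jm); first by rewrite !ltW.
  by move=> i im; exact: dd1_bound qm mM Vv im.
apply: le_trans h _; rewrite /F le_eqVlt; apply/orP; left; apply/eqP; ring.
Qed.

(** The interpolant has total increment 0 over (0, t_n), so one constant, the kernel at t_0, is
    subtracted on all cells together. What remains is the variation of the kernel over (0, t_n), of
    order t_n t_m^(-al - 1). *)
Lemma delta_far al C rho M t V v n m : 0 < al < 1 -> qmesh C rho M t -> (m <= M)%N ->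
  (n.+1 < m)%N -> 2 * t n <= t m -> V 0%N = 0 -> (forall j, (n <= j)%N -> V j = 0) ->
  (forall j, `|V j| <= v) ->
  `|delta al t V m| <=
  Gammainv al * (4 * (t n * t m `^ (- al - 1)) * (10 * (v / t 1%N) * t n)).
Proof.
move=> al01 qm mM nm far V0 Vn Vv; have [t0 htM _ _] := qm.
have /andP[al0 al1] := al01.
have ht : increasing_to t m by move=> j jm; apply: htM; exact: leq_trans mM.
have t1 : 0 < t 1%N by apply: (qmesh_pos qm); rewrite /= (leq_trans _ mM)// (leq_trans _ nm).
rewrite delta_wint// normrM -/(Gammainv al) (ger0_norm (Gammainv_ge0 al)).
rewrite ler_wpM2l ?Gammainv_ge0//.
have nm' : (n <= m)%N by rewrite ltnW// ltnW.
rewrite (big_cat_nat _ nm')//= [X in _ + X]big_nat_cond [X in _ + X]big1 ?addr0; last first.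
  (* Beyond t_n the pieces vanish: even the stencil of the last cell starts at m - 2 >= n. *)
  move=> j /andP[/andP[nj jm] _].
  have d0 i : (n <= i)%N -> dd1 t V i = 0.
    by move=> ni; rewrite /dd1 !Vn ?subrr ?mul0r// ltnW.
  have -> : dpiece t V m j = fun=> 0.
    apply/funext => s; rewrite /dpiece /dquad /dd2.
    have -> : (m == 1%N) = false by apply/eqP => m1; move: nm; rewrite m1; case: (n).
    have ns : (n <= stencil m j)%N by rewrite /stencil; case: ifP => _ //; move: nm; clear; lia.
    by rewrite !d0 ?subrr ?mul0r ?addr0// ltnW.
  by rewrite /wint /Rintegral; under eq_integral do rewrite mulr0; rewrite integral0.
pose k := (t m - t 0%N) `^ (- al).
have nM : (n <= M)%N by exact: leq_trans mM.
have tn0 : 0 <= t n by rewrite -t0; apply: (increasing_le htM); rewrite nM.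
have tm0 : 0 < t m by apply: (qmesh_pos qm); rewrite mM andbT; exact: leq_ltn_trans nm.
have S0 : \sum_(0 <= j < n) k * (V j.+1 - V j) = 0.
  by rewrite -mulr_sumr telescope_sumr// V0 Vn// subrr mulr0.
rewrite -[X in `|X|]subr0 -[X in _ - X]S0 -sumrB.
apply: le_trans (ler_norm_sum _ _ _) _.
pose F j : R := 4 * (t n * t m `^ (- al - 1)) * (10 * (v / t 1%N) * t j).
have -> : 4 * (t n * t m `^ (- al - 1)) * (10 * (v / t 1%N) * t n) = F n - F 0%N.
  by rewrite /F t0 !mulr0 subr0.
rewrite -telescope_sumr//; apply: ler_sum_nat => j /andP[_ jn].
have jm : (j < m)%N by exact: leq_trans nm'.
have tj : t j.+1 <= t m by apply: (increasing_le ht); rewrite jm leqnn.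
have tjn : t j.+1 <= t n by apply: (increasing_le ht); rewrite jn.
have tj0 : 0 <= t j by rewrite -t0; apply: (increasing_le ht); rewrite (ltnW jm).
have pd : prim (fun s => 10 * (v / t 1%N) * s) (fun=> 10 * (v / t 1%N)) (t j) (t j.+1).
  by apply: prim_eq (primZ (10 * (v / t 1%N)) (prim_lin _ _)) => s _ //=; rewrite mulr1.
have [||_ h] := wint_ref (k := k) (D := 4 * (t n * t m `^ (- al - 1))) (al := al)
  (ht j jm) tj (prim_piece t V m j _ _) pd.
- move=> s; rewrite in_itv/= => /andP[s1 s2].
  have -> : 10 * (v / t 1%N) = 5 * (2 * (v / t 1%N)) by ring.
  apply: (dpiece_bound ht jm); first by rewrite !ltW.
  by move=> i im; apply: (dd1_bound qm mM) im.
- move=> s; rewrite in_itv/= => /andP[s1 s2].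
  have tn1 : 0 < t n by apply: lt_le_trans tjn; apply: le_lt_trans tj0 _; exact: ht.
  have tnm : t n <= t m / 2 by rewrite ler_pdivlMr// mulrC.
  have tnm' : t n < t m by apply: le_lt_trans tnm _; rewrite ltr_pdivrMr// ltr_pMr// ltr1n.
  have := weight_diff al01 (lexx 0) tn1 tnm; rewrite !subr0 => wd.
  have s0 : 0 <= s by apply: le_trans tj0 _; exact: ltW.
  have sn : s <= t n by apply: le_trans tjn; exact: ltW.
  have w1 := weight_mono (T := t m) al0 s0 (le_lt_trans sn tnm').
  have w2 := weight_mono (T := t m) al0 sn tnm'.
  rewrite /k t0 ger0_norm ?subr_ge0//; apply: le_trans wd.
  by rewrite subr0 lerB.
have [n1 n2] := piece_nodes V ht jm.
move: h; rewrite n1 n2 => /le_trans; apply.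
rewrite /F le_eqVlt; apply/orP; left; apply/eqP; ring.
Qed.

(** As long as t_m <= P t_1 the two times are comparable and the crude bound does; beyond, the
    cancellation in [delta_far] provides the decay. *)
Lemma delta_local al C rho n : 0 < al < 1 -> 0 <= C -> exists2 B : R, 0 <= B &
  forall M t V v m, qmesh C rho M t -> (0 < m <= M)%N -> V 0%N = 0 ->
  (forall j, (n < j)%N -> V j = 0) -> (forall j, `|V j| <= v) ->
  `|delta al t V m| <= B * (v * (t 1%N * t m `^ (- al - 1))).
Proof.
move=> al01 C0; have /andP[al0 al1] := al01.
have C1 : 1 <= 1 + C by rewrite lerDl.
(* P t_1 exceeds t_m both when m <= n + 2 and when t_m <= 2 t_{n+1}. *)
have [P P0 PE] : exists2 P : R, 0 <= P & P = 2 * (1 + C) ^+ n.+1.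
  by eexists; last reflexivity; rewrite mulr_ge0// exprn_ge0// addr_ge0.
have a1 : 0 < 1 - al by rewrite subr_gt0.
exists (Gammainv al * (40 * P ^+ 2 / (1 - al))).
  apply: mulr_ge0; first exact: Gammainv_ge0.
  by apply: divr_ge0; [rewrite mulr_ge0// exprn_ge0|exact: ltW].
move=> M t V v m qm m0M V0 Vn Vv; have /andP[m0 mM] := m0M.
have v0 : 0 <= v by apply: le_trans (Vv 0%N).
have [t0 ht _ _] := qm.
have t1 : 0 < t 1%N by apply: (qmesh_pos qm); rewrite /= (leq_trans m0 mM).
have tm : 0 < t m by exact: (qmesh_pos qm).
have near : t m <= P * t 1%N -> `|delta al t V m| <=
    Gammainv al * (40 * P ^+ 2 / (1 - al)) * (v * (t 1%N * t m `^ (- al - 1))).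
  move=> tmP; apply: le_trans (delta_crude al1 qm mM (v := v) _) _ => //.
  rewrite -!mulrA ler_wpM2l ?Gammainv_ge0//.
  have -> : t m `^ (1 - al) = t m `^ (- al - 1) * (t m ^+ 2).
    by rewrite -powR_mulrn ?(ltW tm)// -powR_add//; congr (_ `^ _); ring.
  have h2 : t m ^+ 2 <= P ^+ 2 * t 1%N ^+ 2.
    by rewrite -exprMn; apply: lerXn2r; rewrite ?nnegrE ?mulr_ge0 ?(ltW tm) ?(ltW t1).
  set z := v * ((1 - al)^-1 * t m `^ (- al - 1)).
  have z0 : 0 <= z by rewrite !mulr_ge0 ?powR_ge0 ?invr_ge0 ?(ltW a1).
  have -> : 10 * (v * ((t 1%N)^-1 * (t m `^ (- al - 1) * t m ^+ 2 / (1 - al)))) =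
     10 * z * (t m ^+ 2 / t 1%N) by rewrite /z; ring.
  have -> : 40 * (P * (P * ((1 - al)^-1 * (v * (t 1%N * t m `^ (- al - 1)))))) =
     40 * z * (P ^+ 2 * t 1%N) by rewrite /z; ring.
  apply: ler_pM.
  - by rewrite mulr_ge0.
  - by rewrite mulr_ge0 ?exprn_ge0 ?invr_ge0 ?(ltW tm) ?(ltW t1).
  - by rewrite ler_wpM2r// ler_nat.
  - by rewrite ler_pdivrMr// -mulrA -expr2.
have [nm|nm] := leqP m n.+2.
  case: m m0 nm {m0M} mM tm near => // m _ nm mM tm; apply.
  apply: le_trans (qmesh_growth qm C0 mM) _; rewrite ler_wpM2r ?(ltW t1)//.
  rewrite PE -[leLHS]mul1r; apply: ler_pM; rewrite ?exprn_ge0 ?ler1n ?(le_trans ler01)//.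
  by rewrite ler_weXn2l.
have nM : (n < M)%N by apply: leq_trans mM; move: nm; clear; lia.
have tn : t n.+1 <= (1 + C) ^+ n.+1 * t 1%N.
  apply: le_trans (qmesh_growth qm C0 nM) _; rewrite ler_wpM2r ?(ltW t1)//.
  by rewrite ler_weXn2l.
have [far|/ltW close] := leP (2 * t n.+1) (t m); last first.
  by apply: near; apply: le_trans close _; rewrite PE -mulrA ler_wpM2l.
apply: le_trans (delta_far al01 qm mM nm far V0 Vn Vv) _.
rewrite -!mulrA ler_wpM2l ?Gammainv_ge0//.
have tn0 : 0 < t n.+1 by apply: (qmesh_pos qm).
have h2 : t n.+1 ^+ 2 <= P ^+ 2 * t 1%N ^+ 2.
  rewrite -exprMn; apply: lerXn2r; rewrite ?nnegrE ?mulr_ge0 ?(ltW tn0) ?(ltW t1)//.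
  apply: le_trans tn _; rewrite PE -mulrA ler_peMl ?mulr_ge0 ?exprn_ge0 ?(ltW t1) ?ler1n//.
  exact: le_trans C1.
set z := v * t m `^ (- al - 1).
have z0 : 0 <= z by rewrite mulr_ge0 ?powR_ge0.
have -> : 4 * (t n.+1 * (t m `^ (- al - 1) * (10 * (v * ((t 1%N)^-1 * t n.+1))))) =
   40 * z * (t n.+1 ^+ 2 / t 1%N) by rewrite /z; ring.
have -> : 40 * (P * (P * ((1 - al)^-1 * (v * (t 1%N * t m `^ (- al - 1)))))) =
   40 * z * ((1 - al)^-1 * (P ^+ 2 * t 1%N)) by rewrite /z; ring.
apply: ler_wpM2l; first by rewrite mulr_ge0.
rewrite ler_pdivrMr//.
have -> : (1 - al)^-1 * (P ^+ 2 * t 1%N) * t 1%N = (1 - al)^-1 * (P ^+ 2 * t 1%N ^+ 2) by ring.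
apply: le_trans h2 _; rewrite ler_peMl ?mulr_ge0 ?exprn_ge0 ?(ltW t1)//.
by rewrite invf_ge1// gerBl ltW.
Qed.

End Startup.

(** * Diagonal coefficient and induction over the first nodes *)

Section FirstSteps.
Variable R : realType.
Implicit Types (t U V W D E e : nat -> R).
Implicit Types (al rho nu mu s x y p A B C T a b c q sbar P v : R) (m j n k i M N K : nat).

(** On a history cell the piece is convex with equal end values: its derivative is nonpositive
    before the midpoint and nonnegative after it, so against an increasing kernel the contribution
    is nonnegative. On the last cell the derivative is nonnegative with integral 1, and the kernel
    is at least its value at the left end. *)
Lemma delta_diag al t n : 0 < al < 1 -> t 0%N = 0 -> increasing_to t n.+1 ->
  Gammainv al * (t n.+1 - t n) `^ (- al) <= delta al t (fun j => (j == n.+1)%:R) n.+1.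
Proof.
move=> /andP[al0 al1] t0 ht; rewrite delta_wint// -/(Gammainv al).
set U : nat -> R := fun j => (j == n.+1)%:R.
have U0 j : (j <= n)%N -> U j = 0 by move=> jn; rewrite /U lt_eqF.
have Un : U n.+1 = 1 by rewrite /U eqxx.
have d0 j : (j < n)%N -> dd1 t U j = 0.
  by move=> jn; rewrite /dd1 !U0 ?subrr ?mul0r// ltnW.
have hn : 0 < t n.+1 - t n by rewrite subr_gt0; exact: ht.
have dn : dd1 t U n = (t n.+1 - t n)^-1 by rewrite /dd1 Un U0// subr0 mul1r.
have db j : (j <= n)%N -> exists d, {in `]t j, t j.+1[%R, forall s, `|dpiece t U n.+1 j s| <= d}.
  move=> jn; exists (5 * (t n.+1 - t n)^-1) => s; rewrite in_itv/= => /andP[s1 s2].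
  apply: (dpiece_bound ht); [by []|by rewrite !ltW|] => i.
  rewrite ltnS leq_eqVlt => /predU1P[->|im]; first by rewrite dn ger0_norm// invr_ge0 ltW.
  by rewrite d0// normr0 invr_ge0 ltW.
rewrite ler_wpM2l ?Gammainv_ge0// big_nat_recr//=.
have key j q : (j <= n)%N ->
   {in `]t j, t j.+1[%R, forall s, q * dpiece t U n.+1 j s <= (t n.+1 - s) `^ (- al) * dpiece t U n.+1 j s} ->
   q * (U j.+1 - U j) <= wint al (t n.+1) (t j) (t j.+1) (dpiece t U n.+1 j).
  move=> jn h; have [d hd] := db j jn.
  have [<- <-] := piece_nodes U ht jn.
  apply: wint_ge (prim_piece _ _ _ _ _ _) hd h => //; first exact: ht.
  by apply: (increasing_le ht); rewrite ltnS jn leqnn.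
rewrite -[leLHS]add0r; apply: lerD.
  rewrite big_nat_cond; apply: sumr_ge0 => j; rewrite andbT => /andP[_ jn].
  (* The kernel at the midpoint, where the derivative of the piece changes sign. *)
  pose q := (t n.+1 - (t j + t j.+1) / 2) `^ (- al).
  have := key j q (ltnW jn); rewrite !U0 ?(ltnW jn)// subrr mulr0; apply.
  move=> s; rewrite in_itv/= => /andP[s1 s2].
  have hj : t j.+1 <= t n.+1 by apply: (increasing_le ht); rewrite ltnS (ltnW jn) leqnn.
  have tj : t j < t j.+1 by apply: ht; exact: ltnW.
  have -> : dpiece t U n.+1 j s = dd2 t U j * (2 * s - t j - t j.+1).
    rewrite /dpiece ifF; last by apply/eqP => -[n0]; rewrite n0 in jn.
    by rewrite /stencil ltnS jn /dquad d0// add0r.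
  have D0 : 0 <= dd2 t U j.
    rewrite /dd2 (d0 j jn) subr0; have [->|jn'] := eqVneq j.+1 n.
      rewrite dn divr_ge0 ?invr_ge0 ?(ltW hn)// subr_ge0.
      by apply: (increasing_le ht); rewrite ltnW//=; lia.
    by rewrite d0 ?mul0r//; lia.
  rewrite -subr_ge0 -mulrBl mulrCA; apply: mulr_ge0 => //.
  have [sm|/ltW sm] := leP ((t j + t j.+1) / 2) s.
    apply: mulr_ge0; last by move: sm; clear; lra.
    by rewrite subr_ge0; apply: weight_mono => //; exact: lt_le_trans s2 hj.
  rewrite -mulrNN; apply: mulr_ge0; last by move: sm; clear; lra.
  rewrite opprB subr_ge0; apply: weight_mono => //.
  by apply: lt_le_trans hj; move: tj; clear; lra.
have := key n ((t n.+1 - t n) `^ (- al)) (leqnn n); rewrite Un U0// subr0 mulr1; apply.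
move=> s; rewrite in_itv/= => /andP[s1 s2]; apply: ler_wpM2r; last first.
  by apply: weight_mono => //; exact: ltW.
rewrite /dpiece; case: ifPn => n1.
  have n0 : n = 0%N by move: n1; clear; lia.
  by move: dn hn; rewrite n0 => -> hn; rewrite invr_ge0 ltW.
have n0 : (0 < n)%N by move: n1; clear; lia.
rewrite /stencil ltnn /= /dquad d0 ?add0r; last by rewrite prednK.
have tp : t n.-1 < t n by have := ht n.-1; rewrite prednK//; apply; exact: ltnW.
rewrite /dd2 prednK// dn d0 ?prednK// subr0 -addrA.
have tpn : t n.-1 < t n.+1 by apply: lt_trans tp _; exact: ht.
apply: mulr_ge0; first by apply: divr_ge0; [rewrite invr_ge0 ltW|rewrite subr_ge0 ltW].
by move: tp s1; clear; lra.
Qed.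

(** The equation at t_{n+1} is solved for its diagonal term, the earlier values entering through
    [delta_crude]. Since t_1, ..., t_{n+1} are comparable, the constant depends on n but not on the
    mesh. *)
Lemma first_steps al C rho n : 0 < al < 1 -> 0 <= C -> 0 < Gammainv al ->
  exists2 c : R, 0 <= c & forall M t e A, qmesh C rho M t -> e 0%N = 0 -> 0 <= A ->
  (forall j, (0 < j <= M)%N -> `|delta al t e j| <= A) ->
  forall j, (j <= n)%N -> (j <= M)%N -> `|e j| <= c * (A * t 1%N `^ al).
Proof.
move=> al01 C0 G0; have /andP[al0 al1] := al01.
have C1 : 1 <= 1 + C by rewrite lerDl.
elim: n => [|n [c c0 IH]].
  exists 0 => // M t e A _ e0 _ _ j; rewrite leqn0 => /eqP -> _.
  by rewrite e0 normr0 mul0r.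
pose L : R := (1 + C) ^+ n.
have L1 : 1 <= L by exact: exprn_ege1.
have L0 : 0 < L by exact: lt_le_trans L1.
have a1 : 0 < 1 - al by rewrite subr_gt0.
pose c' : R := L * ((Gammainv al)^-1 + 10 * c / (1 - al)).
have c'0 : 0 <= c'.
  apply: mulr_ge0; first exact: ltW.
  apply: addr_ge0; first by rewrite invr_ge0 Gammainv_ge0.
  by apply: divr_ge0; [rewrite mulr_ge0|exact: ltW].
exists (c + c'); first exact: addr_ge0.
move=> M t e A qm e0 A0 de j jn jM.
have P0 : 0 <= A * t 1%N `^ al by rewrite mulr_ge0 ?powR_ge0.
move: jn; rewrite leq_eqVlt ltnS => /predU1P[jn|jn]; last first.
  apply: le_trans (IH M t e A qm e0 A0 de j jn jM) _.
  by rewrite ler_wpM2r// lerDl.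
rewrite {}jn {j} in jM *.
have [t0 htM _ _] := qm.
have ht : increasing_to t n.+1 by move=> j jm; apply: htM; exact: leq_trans jM.
have t1 : 0 < t 1%N by apply: (qmesh_pos qm); rewrite /= (leq_trans _ jM).
have tn : 0 < t n.+1 by exact: (qmesh_pos qm).
have hn : 0 < t n.+1 - t n by rewrite subr_gt0; exact: ht.
have htn : t n.+1 - t n <= t n.+1.
  by rewrite gerBl -t0; apply: (increasing_le ht); rewrite leqnSn.
have tL : t n.+1 <= L * t 1%N by exact: qmesh_growth qm C0 jM.
(* The known values, so that [e n.+1] is isolated as a multiple of the nodal vector of
   [delta_diag]. *)
pose e' j := if (j <= n)%N then e j else 0.
pose v := c * (A * t 1%N `^ al).
have v0 : 0 <= v by exact: mulr_ge0.
have e'v j : (j <= n.+1)%N -> `|e' j| <= v.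
  move=> jn; rewrite /e'; case: ifP => jn'; last by rewrite normr0.
  by apply: (IH M t e A qm e0 A0 de j jn'); exact: leq_trans jn' (ltnW jM).
have de' := delta_crude al1 qm jM e'v.
have diag := delta_diag al01 t0 ht.
set U : nat -> R := fun j => (j == n.+1)%:R in diag.
have E : delta al t e n.+1 = delta al t e' n.+1 + e n.+1 * delta al t U n.+1.
  rewrite -(deltaZ (e n.+1) U al1 t0 ht) -(deltaD e' (fun j => e n.+1 * U j) al1 t0 ht).
  apply: (eq_delta al1 t0 ht) => j jn.
  rewrite /e' /U; move: jn; rewrite leq_eqVlt ltnS => /predU1P[->|jn].
    by rewrite ltnn eqxx mulr1 add0r.
  by rewrite jn lt_eqF ?mulr0 ?addr0// ltnS.
have h1 : Gammainv al * (t n.+1 - t n) `^ (- al) * `|e n.+1| <=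
    A + Gammainv al * (10 * (v / t 1%N) * (t n.+1 `^ (1 - al) / (1 - al))).
  apply: le_trans (ler_wpM2r (normr_ge0 _) diag) _.
  have d0 : 0 <= delta al t U n.+1 by apply: le_trans diag; rewrite mulr_ge0 ?powR_ge0// ltW.
  rewrite mulrC -{1}(ger0_norm d0) -normrM.
  have -> : e n.+1 * delta al t U n.+1 = delta al t e n.+1 - delta al t e' n.+1.
    by rewrite E addrC addKr.
  apply: le_trans (ler_normB _ _) _; apply: lerD => //.
  by apply: de; rewrite jM.
set h := t n.+1 - t n in hn htn h1 *.
have h2 : `|e n.+1| <= h `^ al * ((Gammainv al)^-1 *
    (A + Gammainv al * (10 * (v / t 1%N) * (t n.+1 `^ (1 - al) / (1 - al))))).
  by rewrite -ler_pdivrMl ?powR_gt0// ler_pdivlMl// [leLHS]mulrA -powRN.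
apply: le_trans h2 _.
have hL : h `^ al <= L * t 1%N `^ al.
  apply: (@le_trans _ _ ((L * t 1%N) `^ al)).
    by apply: powR_le_base; rewrite ?(ltW al0) ?(ltW hn)//; exact: le_trans tL.
  rewrite powRM ?(ltW L0) ?(ltW t1)// ler_wpM2r ?powR_ge0//.
  by rewrite -[leRHS](powRr1 (ltW L0)) ler_powR// ltW.
have hT : h `^ al * t n.+1 `^ (1 - al) <= L * t 1%N.
  apply: le_trans tL; rewrite -[leRHS](powRr1 (ltW tn)).
  have -> : 1 = al + (1 - al) by ring.
  rewrite powR_add// (_ : al + (1 - al) - al = 1 - al); last by ring.
  by rewrite ler_wpM2r ?powR_ge0//; apply: powR_le_base; rewrite ?(ltW al0) ?(ltW hn).
have -> : h `^ al * ((Gammainv al)^-1 *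
    (A + Gammainv al * (10 * (v / t 1%N) * (t n.+1 `^ (1 - al) / (1 - al))))) =
   (Gammainv al)^-1 * A * h `^ al +
   (Gammainv al)^-1 * Gammainv al * (10 * v / (1 - al) / t 1%N * (h `^ al * t n.+1 `^ (1 - al))) by ring.
rewrite mulVf ?gt_eqF// mul1r.
apply: (@le_trans _ _ (c' * (A * t 1%N `^ al))); last by rewrite ler_wpM2r// lerDr.
have -> : c' * (A * t 1%N `^ al) = (Gammainv al)^-1 * A * (L * t 1%N `^ al) +
   10 * v / (1 - al) / t 1%N * (L * t 1%N).
  by rewrite /c' /v; field; rewrite !gt_eqF.
apply: lerD; apply: ler_wpM2l => //.
  by rewrite mulr_ge0// invr_ge0 ltW.
by apply: divr_ge0; [apply: divr_ge0; [exact: mulr_ge0|exact: ltW]|exact: ltW].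
Qed.

End FirstSteps.

(** * Restarting the mesh at t_k *)

Section Shift.
Variable R : realType.
Implicit Types (t U V W D E e : nat -> R).
Implicit Types (al rho nu mu s x y p A B C T a b c q sbar P v : R) (m j n k i M N K : nat).

Definition tshift k t : nat -> R := fun i => t (k + i)%N - t k.

Lemma tau_shift k t j : (0 < j)%N -> tau (tshift k t) j = tau t (k + j).
Proof. by case: j => // j _; rewrite /tau /tshift addnS /=; ring. Qed.

Lemma sigma_shift k t j : (1 < j)%N -> sigma (tshift k t) j = sigma t (k + j).
Proof. by case: j => // j j0; rewrite /sigma /= !tau_shift// addnS. Qed.

Lemma sigma_nonincreasing_shift k t M : sigma_nonincreasing M t ->
  sigma_nonincreasing (M - k) (tshift k t).
Proof.
move=> [s1 s2]; split=> j /andP[j2 jM]; rewrite !sigma_shift//.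
- by rewrite addnS; apply: s1; lia.
- exact: ltnW.
- by apply: s2; lia.
Qed.

(** Steps do not decrease, so t_k is at most k times the first shifted step; original and shifted
    times differ at most by the factor k + 1. *)
Lemma qmesh_shift C rho M t k : qmesh C rho M t -> 1 <= C -> 0 < rho <= 1 -> (k < M)%N ->
  [/\ qmesh (C * k.+1%:R) rho (M - k) (tshift k t), t 1%N <= tshift k t 1 &
      forall i, (0 < i <= M - k)%N ->
        0 < tshift k t i <= t (k + i)%N /\ t (k + i)%N <= k.+1%:R * tshift k t i].
Proof.
move=> qm C1 /andP[r0 r1] kM; have [t0 ht h1 h2] := qm.
have C0 : 0 <= C by exact: le_trans C1.
have k1 : (1 : R) <= k.+1%:R by rewrite ler1n.
have hs i : (i < M - k)%N -> tshift k t i < tshift k t i.+1.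
  by move=> iM; rewrite /tshift ltrD2r addnS; apply: ht; lia.
have tk0 : 0 <= t k by rewrite -t0; apply: (increasing_le ht); rewrite (ltnW kM).
have s0 : tshift k t 0 = 0 by rewrite /tshift addn0 subrr.
have s1 : tshift k t 1 = t k.+1 - t k by rewrite /tshift addn1.
have t1 : 0 < t 1%N by apply: (qmesh_pos qm); rewrite (leq_trans _ kM).
have ts1 : t 1%N <= tshift k t 1.
  by rewrite s1 -[leLHS]subr0 -t0; exact: (step_le (i := 0%N) qm).
have sums j : (j <= k)%N -> t j <= j%:R * tshift k t 1.
  elim: j => [|j IH] jk; first by rewrite t0 mul0r.
  rewrite -(subrK (t j) (t j.+1)) addrC -natr1 mulrDl mul1r; apply: lerD.
    exact: IH (ltnW jk).
  by rewrite s1; apply: (step_le qm); rewrite (ltnW jk).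
have cmp i : (0 < i <= M - k)%N ->
    0 < tshift k t i <= t (k + i)%N /\ t (k + i)%N <= k.+1%:R * tshift k t i.
  move=> /andP[i0 iM]; split.
    rewrite gerBl tk0 andbT -s0.
    by apply: (increasing_lt (n := (M - k)%N)) => //; rewrite i0.
  have -> : t (k + i)%N = t k + tshift k t i by rewrite /tshift; ring.
  rewrite -natr1 mulrDl mul1r lerD2r; apply: le_trans (sums k (leqnn k)) _.
  rewrite ler_wpM2l//; apply: (increasing_le (n := (M - k)%N)) => //.
  by rewrite i0.
split => //; split => //.
- move=> j jM; have jM' : ((k + j).+1 < M)%N by lia.
  have := h1 (k + j)%N jM'; rewrite /tshift !addnS => /andP[a1 a2].
  have E x y z : x - z - (y - z) = x - y by ring.
  rewrite !E a1; apply: le_trans a2 _; rewrite ler_wpM2r ?ler_peMr//.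
  by rewrite subr_ge0; apply/ltW/ht; exact: ltnW.
- move=> j jM; have jM' : (k + j < M)%N by lia.
  have E x y z : x - z - (y - z) = x - y by ring.
  have [/andP[sj _] sj'] := cmp j.+1 jM.
  rewrite {1}/tshift /tshift E -/(tshift k t j.+1) -/(tshift k t 1) addnS.
  apply: le_trans (h2 (k + j)%N jM') _; rewrite -mulrA ler_wpM2l//.
  rewrite mulrA; apply: ler_pM; rewrite ?powR_ge0//; last first.
    by apply: powR_le_base; rewrite ?(ltW r0) ?(ltW t1).
  have tp : 0 <= t (k + j).+1 by apply/ltW/(qmesh_pos qm).
  apply: (@le_trans _ _ ((k.+1%:R * tshift k t j.+1) `^ (1 - rho))).
    by apply: powR_le_base; rewrite ?subr_ge0 -?addnS// addnS.
  rewrite powRM ?(ltW sj)// ler_wpM2r ?powR_ge0//.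
  by rewrite -[leRHS]powRr1 ?ler_powR// gerBl ltW.
Qed.

(** Cell k - 1 still involves node k + 1, so V has to vanish up to there. At i = 1 the shifted
    operator has a linear piece, whereas the original one is quadratic as soon as k > 0. *)
Lemma delta_shift al t V k i : al < 1 -> t 0%N = 0 -> increasing_to t (k + i) ->
  (1 < i)%N -> (forall j, (j <= k.+1)%N -> V j = 0) ->
  delta al (tshift k t) (fun j => V (k + j)%N) i = delta al t V (k + i).
Proof.
move=> al1 t0 ht i1 V0.
have hs : increasing_to (tshift k t) i.
  by move=> j ji; rewrite /tshift ltrD2r addnS; apply: ht; rewrite ltn_add2l.
have s0 : tshift k t 0 = 0 by rewrite /tshift addn0 subrr.
rewrite !delta_waff//; congr (_ * _).
rewrite (big_cat_nat (leq0n k) (leq_addr i k))//= [X in _ = X + _]big_nat_cond.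
rewrite [X in _ = X + _]big1 ?add0r; last first.
  move=> j /andP[/andP[_ jk] _].
  have m1 : ((k + i)%N == 1%N) = false by lia.
  have sj : stencil (k + i) j = j by rewrite /stencil ifT//; lia.
  have d1 : dd1 t V j = 0 by rewrite /dd1 !V0 ?subrr ?mul0r// ltnW// ltnW.
  have d2 : dd1 t V j.+1 = 0 by rewrite /dd1 !V0 ?subrr ?mul0r// ltnW.
  rewrite /dpiece /ddpiece m1 sj /dquad /dd2 d1 d2 /waff subrr !mul0r mulr0 addr0 !mul0r.
  by rewrite subr0.
rewrite -[X in _ = \sum_(X <= _ < _) _]add0n big_addn addKn; apply: eq_big_nat => j /andP[_ ji].
have E1 n : dd1 (tshift k t) (fun j => V (k + j)%N) n = dd1 t V (k + n).
  rewrite /dd1 /tshift addnS; congr (_ / _); ring.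
have E2 n : dd2 (tshift k t) (fun j => V (k + j)%N) n = dd2 t V (k + n).
  rewrite /dd2 !E1 addnS /tshift !addnS; congr (_ / _); ring.
have m1 : ((k + i)%N == 1%N) = false by lia.
have m2 : (i == 1%N) = false by lia.
have sj : stencil (k + i) (j + k) = (k + stencil i j)%N.
  by rewrite /stencil; case: ifP; case: ifP; lia.
rewrite /dpiece /ddpiece m1 m2 sj /dquad !E1 !E2 /waff /tshift !addnS [(j + k)%N]addnC.
have E x y z : x - z - (y - z) = x - y by ring.
rewrite !E; congr (_ * _ - _ * _); ring.
Qed.

End Shift.

(** * Rates at comparable arguments *)

Section RateComparison.
Variable R : realType.
Implicit Types (al mu T B x : R).

Lemma powR_ratio al x B T : 1 <= B -> 0 < x -> 0 < T -> x <= T -> T <= B * x ->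
  -1 <= al <= 1 -> x `^ al <= B * T `^ al.
Proof.
move=> B1 x0 T0 xT TB /andP[a1 a2]; have [h|h] := leP 0 al.
  apply: (@le_trans _ _ (T `^ al)); first by apply: powR_le_base => //; exact: ltW.
  by rewrite ler_peMl ?powR_ge0.
have B0 : 0 < B by exact: lt_le_trans B1.
apply: (@le_trans _ _ ((T / B) `^ al)).
  apply: powR_ge_base; rewrite ?(ltW h) ?divr_gt0//.
  by rewrite ler_pdivrMr// mulrC.
rewrite powR_div ?(ltW T0)// mulrC ler_wpM2r ?powR_ge0//.
by rewrite -[leRHS]powRr1 ?(ltW B0)// ler_powR// lerNl.
Qed.

Lemma rate_le al mu B (tau tau' : R) T (T' : R) : 0 < al < 1 -> 0 < mu -> 1 <= B -> 0 < tau ->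
  tau <= tau' <= B * tau -> tau' <= T' -> T' <= T -> T <= B * T' ->
  rate al mu tau' T' <= B ^+ 2 * rate al mu tau T.
Proof.
move=> /andP[al0 al1] mu0 B1 tau0 /andP[tt1 tt2] tT TT1 TT2.
have B0 : 0 < B by exact: lt_le_trans B1.
have tau'0 : 0 < tau' by exact: lt_le_trans tt1.
have T'0 : 0 < T' by exact: lt_le_trans tT.
have T0 : 0 < T by exact: lt_le_trans TT1.
have h1 : T' `^ (al - 1) <= B * T `^ (al - 1).
  apply: powR_ratio => //; apply/andP; split; move: al0 al1; clear; lra.
have h2 : tau' * T' `^ (al - 1) <= B ^+ 2 * (tau * T `^ (al - 1)).
  apply: (@le_trans _ _ (B * tau * (B * T `^ (al - 1)))).
    by apply: ler_pM => //; rewrite ?powR_ge0// ltW.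
  by rewrite le_eqVlt; apply/orP; left; apply/eqP; ring.
rewrite /rate; case: ifPn => // mu1; case: ifPn => mu1'.
  rewrite mulrA; apply: ler_pM => //.
  - by rewrite mulr_ge0 ?powR_ge0// ltW.
  - by rewrite addr_ge0// ln_ge0// ler_pdivlMr// mul1r.
  rewrite lerD2l ler_ln ?posrE ?divr_gt0//; apply: ler_pM => //; rewrite ?invr_ge0 ?(ltW T'0) ?(ltW tau'0)//.
  by rewrite lef_pV2.
rewrite -leNgt in mu1.
have h3 : T' `^ (al - mu) <= B * T `^ (al - mu).
  apply: powR_ratio => //; apply/andP; split; move: al0 al1 mu0 mu1; clear; lra.
have h4 : tau' `^ mu <= B * tau `^ mu.
  apply: (@le_trans _ _ ((B * tau) `^ mu)).
    by apply: powR_le_base; rewrite // ltW.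
  rewrite powRM ?(ltW B0) ?(ltW tau0)// ler_wpM2r ?powR_ge0//.
  by rewrite -[leRHS]powRr1 ?(ltW B0)// ler_powR.
apply: (@le_trans _ _ (B * tau `^ mu * (B * T `^ (al - mu)))).
  by apply: ler_pM => //; rewrite powR_ge0.
by rewrite le_eqVlt; apply/orP; left; apply/eqP; ring.
Qed.

(** For T comparable to tau every branch is at least of order tau^al, the size delivered by
    [first_steps]. *)
Lemma rate_ge al mu B (tau : R) T : 0 < al < 1 -> 0 < mu -> 1 <= B -> 0 < tau ->
  tau <= T <= B * tau -> tau `^ al <= B * rate al mu tau T.
Proof.
move=> /andP[al0 al1] mu0 B1 tau0 /andP[tT TB].
have B0 : 0 < B by exact: lt_le_trans B1.
have T0 : 0 < T by exact: lt_le_trans tT.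
have h1 : tau `^ (al - 1) <= B * T `^ (al - 1).
  apply: powR_ratio => //; apply/andP; split; move: al0 al1; clear; lra.
have h2 : tau `^ al <= B * (tau * T `^ (al - 1)).
  have -> : tau `^ al = tau * tau `^ (al - 1).
    by rewrite -{2}[tau]powRr1 ?(ltW tau0)// -powR_add//; congr (_ `^ _); ring.
  by rewrite mulrCA ler_wpM2l// ltW.
rewrite /rate; case: ifPn => // mu1; case: ifPn => mu1'.
  apply: le_trans h2 _; rewrite ler_wpM2l ?(ltW B0)// ler_peMr//.
    by rewrite mulr_ge0 ?powR_ge0// ltW.
  by rewrite lerDl ln_ge0// ler_pdivlMr// mul1r.
rewrite -leNgt in mu1.
have h3 : tau `^ (al - mu) <= B * T `^ (al - mu).
  apply: powR_ratio => //; apply/andP; split; move: al0 al1 mu0 mu1; clear; lra.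
have -> : tau `^ al = tau `^ mu * tau `^ (al - mu).
  by rewrite -powR_add//; congr (_ `^ _); ring.
by rewrite mulrCA ler_wpM2l// powR_ge0.
Qed.

Lemma rate_ge0 al mu (tau : R) T : 0 < tau -> tau <= T -> 0 <= rate al mu tau T.
Proof.
move=> tau0 tT; have T0 : 0 < T by exact: lt_le_trans tT.
rewrite /rate; case: ifP => _; first by rewrite mulr_ge0 ?powR_ge0// ltW.
case: ifP => _; last by rewrite mulr_ge0 ?powR_ge0.
rewrite !mulr_ge0 ?powR_ge0 ?(ltW tau0)// addr_ge0// ln_ge0// ler_pdivlMr// mul1r//.
Qed.

End RateComparison.

(** * Stability with sigma controlled from index k + 2 on *)

Section FullStability.
Variable R : realType.
Implicit Types (t U V W D E e : nat -> R).
Implicit Types (al rho nu mu s x y p A B C T a b c q sbar P v : R) (m j n k i M N K : nat).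

(** mu <= al + 1 lets the correction from the first nodes, of order t_1^(al + 1) t_j^(-al - 1),
    count as a source of the same type. The shift by k moves sigma_{k+2} to position 2, where the
    stability constant asks for its bound. *)
Lemma stability_from al rho C sbar mu k : 0 < al < 1 -> 0 < rho <= 1 -> 1 <= C ->
  stability_constant al sbar -> 0 < mu -> mu <= (3 - al) * rho -> mu <= al + 1 ->
  exists2 D : R, 0 < D & forall M t e A, qmesh C rho M t -> sigma_nonincreasing M t ->
    ((k.+2 <= M)%N -> sigma t k.+2 <= sbar) -> e 0%N = 0 -> 0 <= A ->
    (forall j, (0 < j <= M)%N -> `|delta al t e j| <= A * (t 1%N `^ mu * t j `^ (- mu))) ->
    forall m, (0 < m <= M)%N -> `|e m| <= D * (A * rate al mu (t 1%N) (t m)).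
Proof.
move=> al01 r01 C1 stab mu0 mu1 mu2; have /andP[al0 al1] := al01.
have C0 : 0 <= C by exact: le_trans C1.
have k1 : (1 : R) <= k.+1%:R by rewrite ler1n.
have CK1 : 1 <= C * k.+1%:R by rewrite mulr_ege1.
have [D1 D10 stable] := stability_rate al01 r01 CK1 stab mu0 mu1.
have [c c0 first] := @first_steps R al C rho k.+1 al01 C0 (Gammainv_gt0 al1 stab).
have [b b0 local] := @delta_local R al C rho k.+1 al01 C0.
have [B [B1 BL BK]] : exists B : R, [/\ 1 <= B, (1 + C) ^+ k <= B & k.+1%:R <= B].
  have h : 0 <= (1 + C) ^+ k by rewrite exprn_ge0// addr_ge0.
  exists ((1 + C) ^+ k + k.+1%:R); split.
  - by apply: le_trans k1 _; rewrite lerDr.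
  - by rewrite lerDl.
  - by rewrite lerDr.
have B0 : 0 < B by exact: lt_le_trans B1.
exists (c * B + D1 * (1 + b * c) * B ^+ 2).
  rewrite addrC; apply: ltr_pwDl; last by rewrite mulr_ge0// ltW.
  by rewrite !mulr_gt0 ?exprn_gt0// ltr_pwDl// mulr_ge0.
move=> M t e A qm sn sbK e0 A0 de m mM; have /andP[m0 mM'] := mM.
have [t0 ht _ _] := qm.
have M0 : (0 < M)%N by exact: leq_trans mM'.
have t1 : 0 < t 1%N by exact: (qmesh_pos qm).
have tpos j : (0 < j <= M)%N -> 0 < t j by exact: (qmesh_pos qm).
have tge j : (0 < j <= M)%N -> t 1%N <= t j by exact: (qmesh_ge1 qm).
have rm0 : 0 <= A * rate al mu (t 1%N) (t m) by rewrite mulr_ge0// rate_ge0// tge.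
have deA j : (0 < j <= M)%N -> `|delta al t e j| <= A.
  move=> jM; apply: le_trans (de j jM) _; rewrite ler_piMr//.
  rewrite -(powR_addK mu (tpos j jM)) ler_wpM2r ?powR_ge0//.
  by apply: powR_le_base; rewrite ?(ltW mu0) ?(ltW t1)// tge.
have small j := first M t e A qm e0 A0 deA j.
have [mk|km] := leqP m k.+1.
  apply: le_trans (small m mk mM') _.
  have h : t 1%N `^ al <= B * rate al mu (t 1%N) (t m).
    apply: rate_ge => //; rewrite tge//=.
    case: m m0 mM' mk {mM rm0} => // m _ mM mk.
    apply: le_trans (qmesh_growth qm C0 mM) _; rewrite ler_wpM2r ?(ltW t1)//.
    by apply: le_trans BL; rewrite ler_weXn2l// lerDl.
  rewrite mulrDl; apply: ler_wpDr.
    by rewrite !mulr_ge0 ?exprn_ge0 ?(ltW D10) ?(ltW B0) ?addr_ge0 ?mulr_ge0// rate_ge0// tge.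
  rewrite -mulrA ler_wpM2l// mulrCA ler_wpM2l//.
(* Nothing is known of [e] beyond M, whereas [delta_local] wants a bound at all indices; hence the
   inner test. *)
pose V j := if (j <= k.+1)%N then (if (j <= M)%N then e j else 0) else 0.
pose W j := if (j <= k.+1)%N then 0 else e j.
have V0 : V 0%N = 0 by rewrite /V /= e0.
have Vk j : (k.+1 < j)%N -> V j = 0 by move=> kj; rewrite /V leqNgt kj.
have P0 : 0 <= A * t 1%N `^ al by rewrite mulr_ge0 ?powR_ge0.
have Vv j : `|V j| <= c * (A * t 1%N `^ al).
  rewrite /V; case: leqP => jk; last by rewrite normr0 mulr_ge0.
  by case: leqP => jM; [exact: small|rewrite normr0 mulr_ge0].
have dW j : (0 < j <= M)%N -> `|delta al t W j| <=
    A * (1 + b * c) * (t 1%N `^ mu * t j `^ (- mu)).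
  move=> jM; have /andP[_ jM'] := jM.
  have htj : increasing_to t j by move=> i ij; apply: ht; exact: leq_trans jM'.
  have -> : delta al t W j = delta al t e j - delta al t V j.
    apply/eqP; rewrite eq_sym subr_eq; apply/eqP; rewrite -(deltaD W V al1 t0 htj).
    apply: (eq_delta al1 t0 htj) => i ij.
    by rewrite /W /V (leq_trans ij jM'); case: ifP; rewrite ?add0r ?addr0.
  apply: le_trans (ler_normB _ _) _; rewrite mulrDr mulr1 [leRHS]mulrDl.
  apply: lerD; first exact: de.
  apply: le_trans (local M t V _ j qm jM V0 Vk Vv) _.
  have -> : b * (c * (A * t 1%N `^ al) * (t 1%N * t j `^ (- al - 1))) =
    A * (b * c) * (t 1%N `^ al * t 1%N * t j `^ (- al - 1)) by ring.
  rewrite ler_wpM2l ?mulr_ge0//.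
  have -> : t 1%N `^ al * t 1%N = t 1%N `^ mu * t 1%N `^ (al + 1 - mu).
    rewrite -{2}[t 1%N]powRr1 ?(ltW t1)// -!powR_add//; congr (_ `^ _); ring.
  have -> : t j `^ (- mu) = t j `^ (al + 1 - mu) * t j `^ (- al - 1).
    by rewrite -!powR_add ?tpos//; congr (_ `^ _); ring.
  rewrite -mulrA ler_wpM2l ?powR_ge0// ler_wpM2r ?powR_ge0//.
  by apply: powR_le_base; rewrite ?subr_ge0 ?(ltW t1) ?tge.
have kM : (k < M)%N by apply: leq_trans mM'; exact: ltnW.
have [qs ts1 cmp] := qmesh_shift qm C1 r01 kM.
set s := tshift k t in qs ts1 cmp.
have adm : admissible_mesh sbar (M - k) s.
  split; first exact: sigma_nonincreasing_shift.
  by move=> M2; rewrite sigma_shift// addn2; apply: sbK; move: M2; clear; lia.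
have A2 : 0 <= A * (1 + b * c) by rewrite mulr_ge0// addr_ge0// mulr_ge0.
have s0 : s 0%N = 0 by case: qs.
have s1 : 0 < s 1%N by exact: lt_le_trans ts1.
have W0 : W (k + 0)%N = 0 by rewrite addn0 /W leqnSn.
have dWs i : (0 < i <= M - k)%N -> `|delta al s (fun i => W (k + i)%N) i| <=
    A * (1 + b * c) * (s 1%N `^ mu * s i `^ (- mu)).
  move=> iM; have /andP[i0 iM'] := iM; have [_ hs _ _] := qs.
  have hsi : increasing_to s i by move=> j ji; apply: hs; exact: leq_trans iM'.
  (* At the first shifted node [delta_shift] does not apply, but all values involved are 0. *)
  have [i1|i1] := leqP i 1.
    rewrite (eq_delta (V := fun=> 0) al1 s0 hsi) ?delta0// ?normr0.
      by apply: mulr_ge0 => //; rewrite mulr_ge0 ?powR_ge0.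
    by move=> j ji; rewrite /W ifT//; move: i1 ji; clear; lia.
  have kiM : (0 < k + i <= M)%N by move: i0 iM' kM; clear; lia.
  have htk : increasing_to t (k + i).
    by move=> j ji; apply: ht; case/andP: kiM => _; exact: leq_trans.
  rewrite delta_shift//; last by move=> j jk; rewrite /W jk.
  apply: le_trans (dW _ kiM) _; rewrite ler_wpM2l//.
  have [/andP[si0 si] _] := cmp i iM.
  apply: ler_pM; rewrite ?powR_ge0//.
    by apply: powR_le_base; rewrite // ltW.
  by apply: powR_ge_base; rewrite // oppr_le0 ltW.
have mkM : (0 < m - k <= M - k)%N by move: km mM'; clear; lia.
have km' : (k + (m - k))%N = m by move: km; clear; lia.
have := stable _ _ _ _ _ qs adm W0 A2 dWs mkM.
have [] := cmp _ mkM; rewrite km' => /andP[sm0 smt] tms.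
rewrite {1}/W leqNgt km /= => h; apply: le_trans h _.
(* Shifted and original times are comparable with a factor that depends on k and C alone. *)
have hr : rate al mu (s 1%N) (s (m - k)%N) <= B ^+ 2 * rate al mu (t 1%N) (t m).
  apply: rate_le => //.
  - rewrite ts1 /=; apply: (@le_trans _ _ (t k.+1)).
      rewrite /s /tshift addn1 gerBl -t0.
      by apply: (increasing_le ht); rewrite (ltnW kM).
    by apply: le_trans (qmesh_growth qm C0 kM) _; rewrite ler_wpM2r// ltW.
  - by apply: (qmesh_ge1 qs).
  - by apply: le_trans tms _; rewrite ler_wpM2r// ltW.
rewrite mulrDl; apply: ler_wpDl; first by rewrite mulr_ge0// mulr_ge0// ltW.
have -> : D1 * (1 + b * c) * B ^+ 2 * (A * rate al mu (t 1%N) (t m)) =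
  D1 * (A * (1 + b * c) * (B ^+ 2 * rate al mu (t 1%N) (t m))) by ring.
by rewrite ler_wpM2l ?(ltW D10)// ler_wpM2l.
Qed.

End FullStability.

(** * The error bound *)
Section Final.
Variable R : realType.
Implicit Types (t U V W D E e : nat -> R).
Implicit Types (al rho nu mu s x y p A B C T a b c q sbar P v r : R) (m j n k i M N K : nat).

(** sigma is the increasing function (x - 1) / (x + 1) of the ratio x of consecutive steps. *)
Lemma sigma_cross a b c (d : R) : 0 < b -> 0 < d -> 0 < a -> 0 < c ->
  (a - b) / (a + b) <= (c - d) / (c + d) -> a * d <= c * b.
Proof.
move=> b0 d0 a0 c0; rewrite ler_pdivrMr ?addr_gt0// mulrAC ler_pdivlMr ?addr_gt0//.
by clear; lra.
Qed.

(** Step ratios do not increase, so they are bounded by the first one, which is at most c3 2^r. For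
    the last condition, the hypothesis on t_j is solved for the index, 1 / j <= (c3 t_1 /
    t_j)^(1/r), and inserted in the one on tau_j. *)
Lemma mesh_qmesh r T c2 c3 M t : 1 <= r -> 0 < c2 -> 0 < c3 -> is_mesh T M t ->
  (forall j, (1 <= j <= M)%N -> simeq c2 (tau t j) (t j / j%:R)) ->
  (forall j, (1 <= j <= M)%N -> simeq c3 (t j) (tau t 1 * j%:R `^ r)) ->
  sigma_nonincreasing M t -> qmesh (1 + c3 * 2 `^ r + c2 * c3 `^ r^-1) r^-1 M t.
Proof.
move=> r1 c20 c30 [M0 t0 _ ht] h2 h3 [s1 s2].
have r0 : 0 < r by exact: lt_le_trans r1.
have p2 : 0 <= c3 * 2 `^ r by rewrite mulr_ge0 ?powR_ge0// ltW.
have p3 : 0 <= c2 * c3 `^ r^-1 by rewrite mulr_ge0 ?powR_ge0// ltW.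
have tau0 j : (j < M)%N -> 0 < tau t j.+1 by move=> jM; rewrite /tau subr_gt0 ht.
have tau1 : tau t 1 = t 1%N by rewrite /tau t0 subr0.
have t1 : 0 < t 1%N by rewrite -tau1 tau0.
split => //.
  move=> j jM; have jM' := ltnW jM.
  have a0 := tau0 _ jM; have b0 := tau0 _ jM'.
  have -> : t j.+1 - t j = tau t j.+1 by [].
  have -> : t j.+2 - t j.+1 = tau t j.+2 by [].
  apply/andP; split.
    have := s2 j.+2; rewrite jM /sigma /= => /(_ isT).
    have d0 : 0 < (tau t j.+2 + tau t j.+1)^-1 by rewrite invr_gt0 addr_gt0.
    by rewrite (pmulr_lge0 _ d0) subr_ge0.
  have s12 : sigma t j.+2 <= sigma t 2.
    elim: {a0 b0 jM'} j jM => // j IH jM; apply: le_trans (IH (ltnW jM)).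
    exact: s1.
  have M2 : (1 < M)%N by exact: leq_ltn_trans jM.
  have := sigma_cross b0 (tau0 0%N M0) a0 (tau0 1%N M2) s12; rewrite tau1.
  have t2 : tau t 2 <= c3 * 2 `^ r * t 1%N.
    apply: (@le_trans _ _ (t 2)); first by rewrite /tau gerBl /= ltW.
    by have [h _] := h3 2%N M2; apply: le_trans h _; rewrite tau1 [t 1%N * _]mulrC mulrA.
  move=> h; rewrite -(ler_pM2r t1); apply: le_trans h _.
  apply: le_trans (ler_wpM2r (ltW b0) t2) _.
  rewrite mulrAC ler_wpM2r ?(ltW t1)// ler_wpM2r ?(ltW b0)//.
  by rewrite [1 + _]addrC -addrA lerDl addr_ge0.
move=> j jM; have [h _] := h2 j.+1 jM; have [h' _] := h3 j.+1 jM.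
have tj : 0 < t j.+1 by rewrite -t0; apply: (increasing_lt ht).
have j0 : 0 < j.+1%:R :> R by rewrite ltr0n.
apply: le_trans h _.
have key : j.+1%:R^-1 <= c3 `^ r^-1 * t 1%N `^ r^-1 * t j.+1 `^ (- r^-1).
  rewrite -powRM ?(ltW t1) ?(ltW c30)// powRN ler_pdivlMr ?powR_gt0// ler_pdivrMl//.
  have -> : j.+1%:R = (j.+1%:R `^ r) `^ r^-1 :> R.
    by rewrite -powRrM divff ?gt_eqF// powRr1 ?(ltW j0).
  rewrite -powRM ?powR_ge0 ?mulr_ge0 ?(ltW t1) ?(ltW c30)//.
  apply: powR_le_base; rewrite ?invr_ge0 ?(ltW r0) ?(ltW tj)//.
  by apply: le_trans h' _; rewrite tau1 le_eqVlt; apply/orP; left; apply/eqP; ring.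
apply: (@le_trans _ _ (c2 * c3 `^ r^-1 * (t j.+1 `^ (1 - r^-1) * t 1%N `^ r^-1))).
  rewrite -mulrA ler_wpM2l ?(ltW c20)//.
  apply: le_trans (ler_wpM2l (ltW tj) key) _.
  rewrite powR_add// powRr1 ?(ltW tj)//.
  by rewrite le_eqVlt; apply/orP; left; apply/eqP; ring.
by rewrite ler_wpM2r ?mulr_ge0 ?powR_ge0// lerDr addr_ge0.
Qed.

Lemma is_derive_in (A : set R) (f : R -> R) (s : R) : nbhs s A -> cvg (dquot_in A f s) ->
  is_derive s (1:R) f (derive_in A f s).
Proof.
move=> sA; rewrite /derive_in; set l := lim _ => cl.
suff H : (fun h : R => h^-1 *: ((f \o shift s) (h *: (1:R)) - f s)) @ 0^' --> l.
  by split; [apply/cvg_ex; exists l|exact: cvg_lim].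
apply/cvgrPdist_lt => eps eps0.
have /cvgrPdist_lt/(_ eps eps0) : dquot_in A f s --> l := cl.
rewrite /= near_withinE near_withinE => near_s.
rewrite near_withinE.
have : \forall x \near s, A x /\ (x != s -> A x -> `|l - (f x - f s) / (x - s)| < eps).
  near=> x; split; first by near: x.
  by near: x.
rewrite (near_shift 0); apply: filterS => h /= [Ah +] h0.
rewrite subr0 -subr_eq0 addrK => /(_ h0).
by rewrite /GRing.scale /= mulr1 mulrC; apply; move: Ah; rewrite subr0.
Unshelve. all: by end_near.
Qed.

(** The cap 1 + al / 2 exceeds 1, so it changes neither the branch of [rate] nor the value of mu
    when mu <= 1. Thus r below, equal to or above 3 - al means mu above, equal to or below 1. *)
Lemma rate_error_bound al r (c : R) M t m mu : 0 < al < 1 -> 1 <= r -> 0 < c ->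
  (0 < M)%N -> 0 < t 1%N -> t 1%N <= t m -> t 1%N <= c * M%:R `^ (- r) ->
  mu = Num.min ((3 - al) / r) (1 + al / 2) ->
  rate al mu (t 1%N) (t m) <= (c + c `^ ((3 - al) / r)) * error_bound al r M t m.
Proof.
move=> /andP[al0 al1] r1 c0 M0 t1 tm tc ->.
have r0 : 0 < r by exact: lt_le_trans r1.
have al2 : 1 < 1 + al / 2 by rewrite ltrDl divr_gt0.
have cc : 0 <= c `^ ((3 - al) / r) by exact: powR_ge0.
have tm0 : 0 < t m by exact: lt_le_trans tm.
have ln0 : 0 <= 1 + ln (t m / t 1%N) by rewrite addr_ge0// ln_ge0// ler_pdivlMr// mul1r.
rewrite /rate /error_bound lt_min al2 andbT ltr_pdivlMr// mul1r.
have [h|h|h] := ltgtP r (3 - al).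
- rewrite mulrA ler_wpM2r ?powR_ge0//; apply: le_trans tc _.
  by rewrite ler_wpM2r ?powR_ge0// lerDl.
- have nu1 : (3 - al) / r < 1 by rewrite ltr_pdivrMr// mul1r.
  have -> : Num.min ((3 - al) / r) (1 + al / 2) = (3 - al) / r.
    by apply/min_idPl/ltW; exact: lt_trans al2.
  rewrite lt_eqF// mulrA ler_wpM2r ?powR_ge0//.
  have nu0 : 0 <= (3 - al) / r by rewrite divr_ge0 ?(ltW r0)// subr_ge0; move: al1; clear; lra.
  apply: le_trans (powR_le_base nu0 (ltW t1) tc) _.
  rewrite powRM ?powR_ge0 ?(ltW c0)// -powRrM.
  have -> : - r * ((3 - al) / r) = al - 3 by field; rewrite gt_eqF.
  by rewrite ler_wpM2r ?powR_ge0// lerDr ltW.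
- have -> : Num.min ((3 - al) / r) (1 + al / 2) = 1.
    by rewrite -h divff ?gt_eqF//; apply/min_idPl/ltW.
  rewrite eqxx !mulrA ler_wpM2r// ler_wpM2r ?powR_ge0//; apply: le_trans tc _.
  have -> : al - 3 = - r by rewrite h; ring.
  by rewrite ler_wpM2r ?powR_ge0// lerDl.
Qed.

(** Absorbs the regular part into the singular one, at the cost of a constant depending on T. *)
Lemma growth_bound T (cu : R) p s : 0 <= p -> 0 < cu -> 0 < s -> s <= T -> 
  cu * (1 + s `^ (- p)) <= cu * (1 + T `^ p) * s `^ (- p).
Proof.
move=> p0 cu0 s0 sT; rewrite -mulrA ler_wpM2l ?(ltW cu0)// mulrDl mul1r [leRHS]addrC lerD2r.
rewrite -(powR_addK p s0) ler_wpM2r ?powR_ge0//.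
by apply: powR_le_base; rewrite ?(ltW s0).
Qed.

End Final.

Theorem theorem4p1 (R : realType) (alpha r T : R) (K : nat)
    (u0 : R) (f : R -> R) (sbar c1 c2 c3 cu : R)
    (halpha : 0 < alpha < 1) (hr : 1 <= r) (hT : 0 < T) (hK : (1 <= K)%N)
    (hsbar : 0 < sbar < 1) (hstab : stability_constant alpha sbar)
    (hc1 : 0 < c1) (hc2 : 0 < c2) (hc3 : 0 < c3) (hcu : 0 < cu) :
  exists2 C : R, 0 < C &
  forall (M : nat) (t U : nat -> R) (u : R -> R),
    is_mesh T M t ->
    simeq c1 (tau t 1) (M%:R `^ (- r)) ->
    (forall j : nat, (1 <= j <= M)%N -> simeq c2 (tau t j) (t j / j%:R)) ->
    (forall j : nat, (1 <= j <= M)%N -> simeq c3 (t j) (tau t 1 * j%:R `^ r)) ->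
    sigma_nonincreasing M t ->
    (forall j : nat, (K.+1 <= j <= M)%N -> 0 <= sigma t j <= sbar) ->
    {within `[0, T], continuous u} ->
    Ck_on 3 `]0, T] u ->
    (forall s : R, 0 < s <= T -> caputo alpha u s = f s) ->
    u 0 = u0 ->
    (forall m : nat, (1 <= m <= M)%N -> delta alpha t U m = f (t m)) ->
    U 0%N = u0 ->
    (forall (l : nat) (s : R), l = 1%N \/ l = 3%N -> 0 < s <= T ->
       `|deriven_in `]0, T] l u s| <= cu * (1 + s `^ (alpha - l%:R))) ->
    forall m : nat, (1 <= m <= M)%N ->
      `|u (t m) - U m| <= C * error_bound alpha r M t m.
Proof.
have /andP[al0 al1] := halpha.
have r0 : 0 < r by exact: lt_le_trans hr.
have rho01 : 0 < r^-1 <= 1 by rewrite invr_gt0 r0 invf_le1.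
pose Cm := 1 + c3 * 2 `^ r + c2 * c3 `^ r^-1.
have Cm1 : 1 <= Cm.
  by rewrite /Cm -addrA lerDl addr_ge0// mulr_ge0 ?powR_ge0// ltW.
pose mu := Num.min ((3 - alpha) / r) (1 + alpha / 2).
have a3 : 0 < 3 - alpha by move: al1; clear; lra.
have mu0 : 0 < mu by rewrite lt_min divr_gt0//= addr_gt0// divr_gt0.
have mu1 : mu <= (3 - alpha) * r^-1 by rewrite ge_min lexx.
have mu2 : mu < alpha + 1.
  by rewrite gt_min; apply/orP; right; move: al0; clear; lra.
(* The mesh is restarted at t_k with k = K - 1, so the bound on sigma is used from index K + 1
   on. *)
case: K hK => // k _.
have [D D0 stable] :=
  @stability_from R alpha r^-1 Cm sbar mu k halpha rho01 Cm1 hstab mu0 mu1 (ltW mu2).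
pose A := cu * (1 + T `^ (1 - alpha)) + cu * (1 + T `^ (3 - alpha)).
have B0 p : 0 <= cu * (1 + T `^ p) by rewrite mulr_ge0 ?addr_ge0 ?powR_ge0// ltW.
have A0 : 0 <= A by exact: addr_ge0.
(* The absolute value provides the sign of G, and G + 1 below makes the final constant positive. *)
pose G := Gammainv alpha * (A * `|trunc_const alpha mu Cm|).
have G0 : 0 <= G by rewrite mulr_ge0 ?Gammainv_ge0 ?mulr_ge0.
pose c := c1 + c1 `^ ((3 - alpha) / r).
have c0 : 0 < c by rewrite ltr_pwDl ?powR_ge0.
exists (D * (G + 1) * c); first by rewrite !mulr_gt0// ltr_pwDr.
move=> M t U u mesh h1 h2 h3 sn sK cu0 [du _] hu uu0 hU UU0 bu m mM.
have [M0 t0 tM ht] := mesh.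
have qm := mesh_qmesh hr hc2 hc3 mesh h2 h3 sn; rewrite -/Cm in qm.
have t1 : 0 < t 1%N by exact: (qmesh_pos qm).
have t1c : t 1%N <= c1 * M%:R `^ (- r).
  by have [] := h1; rewrite /tau t0 subr0.
have d l s : (l < 3)%N -> s \in `]0, T[%R ->
    is_derive s (1 : R) (deriven_in `]0, T] l u) (deriven_in `]0, T] l.+1 u s).
  move=> l3; rewrite in_itv/= => /andP[s0 sT]; apply: is_derive_in.
    apply: filterS (near_in_itvoo (a:=0) (b:=T) (x:=s) _); last by rewrite in_itv/= s0.
    by move=> x; rewrite /= !in_itv/= => /andP[-> /ltW].
  by apply: du => //; rewrite /= in_itv/= s0 ltW.
have b1 : {in `]0, T[%R, forall s, `|deriven_in `]0, T] 1 u s| <= A * s `^ (alpha - 1)}.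
  move=> s; rewrite in_itv/= => /andP[s0 /ltW sT].
  apply: le_trans (bu 1%N s (or_introl erefl) _) _; first by rewrite s0.
  rewrite -opprB; apply: le_trans (growth_bound _ hcu s0 sT) _; first by rewrite subr_ge0 ltW.
  by rewrite ler_wpM2r ?powR_ge0// lerDl.
have b3 : {in `]0, T[%R, forall s, `|deriven_in `]0, T] 3 u s| <= A * s `^ (alpha - 3)}.
  move=> s; rewrite in_itv/= => /andP[s0 /ltW sT].
  apply: le_trans (bu 3%N s (or_intror erefl) _) _; first by rewrite s0.
  rewrite -opprB; apply: le_trans (growth_bound _ hcu s0 sT) _; first exact: ltW.
  by rewrite ler_wpM2r ?powR_ge0// lerDr.
(* The shape to which [deltaD] and [deltaZ] apply. *)
pose e j := u (t j) + -1 * U j.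
have de j : (0 < j <= M)%N -> `|delta alpha t e j| <= G * (t 1%N `^ mu * t j `^ (- mu)).
  case: j => // j /= jM.
  have htj : increasing_to t j.+1 by move=> i ij; apply: ht; exact: leq_trans jM.
  have tj : 0 < t j.+1 <= T.
    by rewrite (qmesh_pos qm)//= -tM; apply: (increasing_le ht); rewrite jM leqnn.
  have -> : delta alpha t e j.+1 =
      delta alpha t (fun j => u (t j)) j.+1 - caputo alpha u (t j.+1).
    rewrite (deltaD (fun j => u (t j)) (fun j => -1 * U j) al1 t0 htj).
    by rewrite (deltaZ (-1) U al1 t0 htj) mulN1r hU// hu.
  apply: le_trans (trunc_u halpha rho01 Cm1 A0 (ltW mu0) mu1 mu2 qm tM cu0
    (fun s => d 0%N s isT) (fun s => d 1%N s isT) (fun s => d 2%N s isT) b1 b3 jM) _.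
  rewrite /G -[leRHS]mulrA ler_wpM2l ?Gammainv_ge0// ler_wpM2r ?mulr_ge0 ?powR_ge0//.
  by rewrite ler_wpM2l// ler_norm.
have e0 : e 0%N = 0 by rewrite /e t0 uu0 UU0 mulN1r subrr.
have sbK : (k.+2 <= M)%N -> sigma t k.+2 <= sbar.
  by move=> kM; have := sK k.+2; rewrite leqnn kM => /(_ isT)/andP[].
have := stable M t e G qm sn sbK e0 G0 de m mM.
rewrite /e mulN1r => /le_trans; apply.
rewrite -2!mulrA; apply: ler_wpM2l; first exact: ltW.
apply: ler_pM => //.
- by rewrite rate_ge0// (qmesh_ge1 qm).
- by rewrite lerDl.
- by apply: rate_error_bound => //; exact: (qmesh_ge1 qm).
Qed.
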